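(* Let $n,m\in\mathbb{N}$ and let $\gamma=(\gamma_\alpha)_{\alpha\in\mathbb{R}_+^n}$ be a continuous family of non-negative numbers. Let $p_1,\ldots,p_m\in\mathcal{Q}_n$ be real fractional polynomials, $p_k(t)=\sum_{\xi\in I_k}a_{k\xi}t^\xi$, where $I_k\subseteq\mathbb{Q}_+^n$ is finite and $a_{k\xi}\in\mathbb{R}$, for $k=1,\ldots,m$. Then $\gamma$ is a fractional moments family with a representing measure whose support is a subset of $\bigcap_{k=1}^m p_k^{-1}(\mathbb{R}_+)$ if and only if there exists a positive semi-definite family of complex numbers $\delta=(\delta_{(\alpha,\beta)})_{(\alpha,\beta)\in\mathbb{Q}_+^n\times\mathbb{Z}_+}$ that satisfies: (1) $\delta_{(\alpha,0)}=\gamma_\alpha$ for all $\alpha\in\mathbb{Q}_+^n$; (2) for all $(\alpha,\beta)\in\mathbb{Q}_+^n\times\mathbb{Z}_+$, $$\delta_{(\alpha,\beta)}=\delta_{(\alpha,\beta+1)}+\sum_{j=1}^n\delta_{(\alpha+2e_j,\beta+1)}+\sum_{k=1}^m\sum_{\xi,\eta\in I_k}a_{k\xi}a_{k\eta}\,\delta_{(\alpha+\xi+\eta,\beta+1)};$$ (3) for every $k=1,\ldots,m$ the family $\left(\sum_{\xi\in I_k}a_{k\xi}\,\delta_{(\alpha+\xi,\beta)}\right)_{(\alpha,\beta)\in\mathbb{Q}_+^n\times\mathbb{Z}_+}$ is positive semi-definite. Moreover, the representing measure of $\gamma$ whose support is a subset of $\bigcap_{k=1}^m p_k^{-1}(\mathbb{R}_+)$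 is unique if and only if the positive semi-definite family $\delta$ satisfying (1), (2) and (3) is unique.
   Context: Notation: $\mathbb{R}_+=[0,\infty)$, $\mathbb{Q}_+=\mathbb{R}_+\cap\mathbb{Q}$, $\mathbb{Z}_+=\{0,1,2,\ldots\}$; $e_1,\ldots,e_n$ is the standard basis of $\mathbb{R}^n$. For $t,\alpha\in\mathbb{R}_+^n$, $t^\alpha=t_1^{\alpha_1}\cdots t_n^{\alpha_n}$ (with $0^0=1$). $\mathcal{Q}_n$ is the complex algebra of fractional polynomials: all functions $\mathbb{R}_+^n\ni t\mapsto\sum_{\alpha\in\mathbb{Q}_+^n}a_\alpha t^\alpha$ with complex coefficients $a_\alpha$, only finitely many of which are nonzero. Each $p_k$ is a function on $\mathbb{R}_+^n$, so $p_k^{-1}(\mathbb{R}_+)=\{t\in\mathbb{R}_+^n: p_k(t)\ge 0\}$. A family $\gamma=(\gamma_\alpha)_{\alpha\in\mathbb{R}_+^n}$ of non-negative numbers is continuous if $\alpha\mapsto\gamma_\alpha$ is continuous from $\mathbb{R}_+^n$ to $\mathbb{R}_+$. It is a fractional moments family if there is a positive Borel measure $\mu$ on $\mathbb{R}_+^n$ with $\gamma_\alpha=\int_{\mathbb{R}_+^n}t^\alpha\,d\mu(t)$ for all $\alpha\in\mathbb{R}_+^n$; such a $\mu$ is called a representing measure of $\gamma$. $\widetilde{\mathcal{Q}}_n$ is the complex algebra of functions of $(t,s)\in\mathbb{R}_+^n\times\mathbb{R}_+$ consisting of the finite complex linear combinations of the functions $t^\alpha s^\beta$, $(\alpha,\beta)\in\mathbb{Q}_+^n\times\mathbb{Z}_+$.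 A family of complex numbers $\delta=(\delta_{(\alpha,\beta)})_{(\alpha,\beta)\in\mathbb{Q}_+^n\times\mathbb{Z}_+}$ induces the linear functional $L_\delta$ on $\widetilde{\mathcal{Q}}_n$ determined by $L_\delta(t^\alpha s^\beta)=\delta_{(\alpha,\beta)}$. The family $\delta$ is positive semi-definite if $L_\delta(|f|^2)\ge 0$ for every $f\in\widetilde{\mathcal{Q}}_n$. *)

(* Defs.v *)
From HB Require Import structures.
From mathcomp Require Import all_boot all_order all_algebra finmap.
From mathcomp Require Import all_classical all_reals all_analysis.
From mathcomp Require Import complex.

Set Implicit Arguments.
Unset Strict Implicit.
Unset Printing Implicit Defensive.

Import Order.TTheory GRing.Theory Num.Theory.
Import numFieldNormedType.Exports.

Local Open Scope classical_set_scope.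
Local Open Scope ring_scope.
Local Open Scope complex_scope.

(* [nnvec R n] is R_+^n and [nnvec rat n] is Q_+^n. *)
Section NonnegVectors.
Variables (K : numDomainType) (n : nat).

Definition nnvec_pred : {pred 'rV[K]_n} := fun v => [forall i, 0 <= v 0 i].

Lemma nnvec_pred_add : addr_closed nnvec_pred.
Proof.
split; first by apply/forallP => i; rewrite mxE.
move=> u v /forallP u0 /forallP v0; apply/forallP => i.
by rewrite mxE addr_ge0.
Qed.

Definition nnvec := {v : 'rV[K]_n | nnvec_pred v}.

HB.instance Definition _ := SubChoice.on nnvec.
HB.instance Definition _ :=
  GRing.SubChoice_isSubNmodule.Build 'rV[K]_n nnvec_pred nnvec nnvec_pred_add.
HB.instance Definition _ := isPointed.Build nnvec 0.

Definition nncoord (v : nnvec) (i : 'I_n) : K := val v 0 i.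

Lemma nncoord_ge0 v i : 0 <= nncoord v i.
Proof. exact: (forallP (valP v)). Qed.

Lemma nnbasis_subproof (j : 'I_n) : nnvec_pred (delta_mx 0 j).
Proof. by apply/forallP => i; rewrite mxE ler0n. Qed.

Definition nnbasis (j : 'I_n) : nnvec := Sub (delta_mx 0 j) (nnbasis_subproof j).

End NonnegVectors.

Lemma nnratr_subproof (R : realType) n (v : nnvec rat n) :
  @nnvec_pred R n (\row_i ratr (nncoord v i)).
Proof. by apply/forallP => i; rewrite mxE ler0q nncoord_ge0. Qed.

(* The inclusion of Q_+^n in R_+^n. *)
Definition nnratr (R : realType) n (v : nnvec rat n) : nnvec R n :=
  Sub (\row_i ratr (nncoord v i)) (nnratr_subproof R v).

(* R_+^n carries the topology induced by that of R^n. *)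
HB.instance Definition _ (R : realType) n :=
  Topological.copy (nnvec R n) (initial_topology (val : nnvec R n -> 'rV[R]_n)).
HB.instance Definition _ (R : realType) n :=
  Uniform.copy (nnvec R n) (initial_topology (val : nnvec R n -> 'rV[R]_n)).
HB.instance Definition _ (R : realType) n :=
  PseudoMetric.copy (nnvec R n) (initial_topology (val : nnvec R n -> 'rV[R]_n)).

Definition borel (T : ptopologicalType) := g_sigma_algebraType (@open T).

Definition msupport (R : realType) (T : ptopologicalType)
    (mu : {measure set (borel T) -> \bar R}) : set T :=
  [set x | forall U : set T, open U -> U x -> (0 < mu U)%E].

Section Moments.
Variables (R : realType) (n : nat).

(* [powR] satisfies 0 `^ 0 = 1, and 0 `^ x = 0 for x != 0. *)
Definition nnpow (t alpha : nnvec R n) : R :=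
  \prod_(i < n) (nncoord t i `^ nncoord alpha i).

(* [a] is only relevant on [S]. *)
Definition fracpoly (S : {fset nnvec rat n}) (a : nnvec rat n -> R)
    (t : nnvec R n) : R :=
  \sum_(xi <- S) a xi * nnpow t (nnratr R xi).

Definition representing_measure (gamma : nnvec R n -> R)
    (mu : {measure set (borel (nnvec R n)) -> \bar R}) : Prop :=
  forall alpha, (\int[mu]_t (nnpow t alpha)%:E = (gamma alpha)%:E)%E.

Definition cmonomial (ab : nnvec rat n * nat)
    (ts : nnvec R n * {nonneg R}) : R[i] :=
  (nnpow ts.1 (nnratr R ab.1) * ts.2%:num ^+ ab.2)%:C.

Definition Qtilde : set (nnvec R n * {nonneg R} -> R[i]) :=
  [set f | exists (S : {fset nnvec rat n * nat}) (c : nnvec rat n * nat -> R[i]),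
    f = fun ts => \sum_(ab <- S) c ab * cmonomial ab ts].

(* Only the values of [L] on [Qtilde] matter: there, [L] is L_delta. *)
Definition induced_functional (delta : nnvec rat n -> nat -> R[i])
    (L : (nnvec R n * {nonneg R} -> R[i]) -> R[i]) : Prop :=
  (forall (c : R[i]) f g, Qtilde f -> Qtilde g ->
     L (fun ts => c * f ts + g ts) = c * L f + L g) /\
  (forall alpha beta, L (cmonomial (alpha, beta)) = delta alpha beta).

(* The functions [cmonomial ab] are linearly independent, so that [L] exists
   and is unique on [Qtilde]. *)
Definition psd (delta : nnvec rat n -> nat -> R[i]) : Prop :=
  exists2 L, induced_functional delta L &
    forall f, Qtilde f -> 0 <= L (fun ts => `|f ts| ^+ 2).

Variables (m : nat) (I : 'I_m -> {fset nnvec rat n}).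
Variable a : 'I_m -> nnvec rat n -> R.

Definition nonneg_locus : set (nnvec R n) :=
  \bigcap_(k in [set: 'I_m]) [set t | 0 <= fracpoly (I k) (a k) t].

Definition supported_representing_measure (gamma : nnvec R n -> R)
    (mu : {measure set (borel (nnvec R n)) -> \bar R}) : Prop :=
  representing_measure gamma mu /\ msupport mu `<=` nonneg_locus.

Definition admissible_extension (gamma : nnvec R n -> R)
    (delta : nnvec rat n -> nat -> R[i]) : Prop :=
  [/\ psd delta,
      forall alpha, delta alpha 0 = (gamma (nnratr R alpha))%:C,
      forall alpha beta,
        delta alpha beta =
          delta alpha beta.+1
          + \sum_(j < n) delta (alpha + nnbasis rat j *+ 2) beta.+1
          + \sum_(k < m) \sum_(xi <- I k) \sum_(eta <- I k)
              (a k xi * a k eta)%:C * delta (alpha + xi + eta) beta.+1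
    & forall k : 'I_m, psd (fun alpha beta =>
        \sum_(xi <- I k) (a k xi)%:C * delta (alpha + xi) beta)].

End Moments.

(* Main.v *)
Require Import Defs.
From HB Require Import structures.
From mathcomp Require Import all_boot all_order all_algebra finmap.
From mathcomp Require Import all_classical all_reals all_analysis.
From mathcomp Require Import complex.
From mathcomp Require Import measurable_realfun ring lra zify.

Set Implicit Arguments.
Unset Strict Implicit.
Unset Printing Implicit Defensive.

Import Order.TTheory GRing.Theory Num.Theory.
Import numFieldNormedType.Exports.

Local Open Scope classical_set_scope.
Local Open Scope ring_scope.
Local Open Scope complex_scope.

(** For a representing measure [mu] on the locus where the [p_k] are
    nonnegative, put [theta = 1 / (1 + \sum_j t_j ^ 2 + \sum_k p_k ^ 2)] and let
    [delta] collect the integrals of [t ^ alpha * theta ^ beta]. The functional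
    of [delta] is integration over the graph [s = theta t], which gives both
    positivity conditions ([psd_of_weight]), and the recursion for [delta] is
    the definition of [theta] ([measure_admissible]).

    Conversely [delta] gives a functional [L] on the real fractional polynomials
    in [(t, s)] that is nonnegative on squares and on squares times a [p_k], and
    under which [s * (1 + \sum_j t_j ^ 2 + \sum_k p_k ^ 2) = 1]. This relation
    makes [s], [s * t_j], [s * p_k] and suitable products [t ^ alpha * s ^ beta]
    behave like operators between 0 and 1 ([s_01], [tau_basis_01], [poly_01],
    [tau_01]); products of such multipliers are again positive, which is
    elementary ([mult_ge0M]), and so are their roots ([mult_01_root]). Instead
    of a spectral theorem, a probabilistic argument turns countably many
    multipliers into measurable functions on an interval with the same joint
    moments ([multiplier_model]): flip coins whose biases are the multipliers,
    with weights that [L] makes nonnegative; the frequencies have the required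
    moments in the limit, by the variance estimate of the law of large numbers
    ([bern_mean_prod]); a limit along an ultrafilter makes them exact but
    leaves only a finitely additive mean ([ultra_mean]); and the binary digits
    of the frequencies transport this mean to Lebesgue measure ([real_model]).

    Algebraic relations valid under [L] hold almost everywhere between these
    functions ([models_ae_unique]), so that they are the monomials, the [p_k]
    and [theta] evaluated at a random point of the orthant, up to powers of
    [s]. Those powers are removed by monotone convergence, where the same
    relation shows that no mass sits at [s = 0] ([unweight_has_integral]). The
    law of the random point ([moment_model]) has the rational moments of
    [gamma], and the others follow by continuity of [gamma] and dominated
    convergence ([rational_moments_representing]).

    For uniqueness, a measure is determined by its integrals of
    [t ^ alpha * theta ^ beta] ([theta_moments_determine]): a half-space
    [c * t_j + e > 0] is also given by the bounded function
    [(c * t_j + e) * theta], and its indicator is therefore a bounded limit of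
    polynomials in [t] and [theta]. Since each [delta] is recovered as the
    moments of the measure built from it ([extension_supported_measure]), this
    makes [delta] and [mu] determine each other. *)
(** * Positive functionals on a commutative algebra *)

Section PositiveFunctional.
Variables (R : realType) (A : comPzRingType) (k : {rmorphism R -> A}).

Record positive_functional := PositiveFunctional {
  pf_fun :> A -> R;
  pfD : forall f g, pf_fun (f + g) = pf_fun f + pf_fun g;
  pfZ : forall c f, pf_fun (k c * f) = c * pf_fun f;
  pf_sqr_ge0 : forall f, 0 <= pf_fun (f * f) }.

Variable L : positive_functional.

Lemma pf0 : L 0 = 0.
Proof. by have := pfD L 0 0; rewrite addr0 => h; lra. Qed.

Lemma pfN f : L (- f) = - L f.
Proof. by have := pfD L f (- f); rewrite subrr pf0 => h; lra. Qed.

Lemma pfB f g : L (f - g) = L f - L g.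
Proof. by rewrite pfD pfN. Qed.

Lemma pf_sum I (r : seq I) (P : pred I) (F : I -> A) :
  L (\sum_(i <- r | P i) F i) = \sum_(i <- r | P i) L (F i).
Proof. by apply: (big_morph L (pfD L) pf0). Qed.

Lemma pf1_ge0 : 0 <= L 1.
Proof. by rewrite -[1]mul1r pf_sqr_ge0. Qed.

Lemma pf_cauchy_schwarz f g : L (f * g) ^+ 2 <= L (f * f) * L (g * g).
Proof.
have q x y : 0 <= x ^+ 2 * L (f * f) + 2 * (x * y * L (f * g)) + y ^+ 2 * L (g * g).
  have := pf_sqr_ge0 L (k x * f + k y * g).
  have -> : (k x * f + k y * g) * (k x * f + k y * g) =
    k (x ^+ 2) * (f * f) + k (2 * (x * y)) * (f * g) + k (y ^+ 2) * (g * g).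
    by ring.
  by rewrite !pfD !pfZ; congr (0 <= _); ring.
have a0 := pf_sqr_ge0 L f; have b0 := pf_sqr_ge0 L g.
move: (L (f * f)) (L (g * g)) (L (f * g)) a0 b0 q => a b c a0 b0 q.
have [a_eq0|a_neq0] := eqVneq a 0.
  suff -> : c = 0 by rewrite a_eq0 expr0n mul0r.
  apply/eqP; apply: contraT => c0.
  have := q (- (b + 1) / (2 * c)) 1; rewrite a_eq0 mulr0 add0r expr1n mul1r mulr1.
  have -> : 2 * (- (b + 1) / (2 * c) * c) = - (b + 1) by field.
  by lra.
have := q (- c) a.
have -> : (- c) ^+ 2 * a + 2 * (- c * a * c) + a ^+ 2 * b = a * (a * b - c ^+ 2).
  by ring.
have a_gt0 : 0 < a by rewrite lt_def a_neq0.
by rewrite (pmulr_rge0 _ a_gt0) subr_ge0.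
Qed.

Definition mult_ge0 (a : A) := forall f, 0 <= L (a * (f * f)).
Definition mult_01 (a : A) := mult_ge0 a /\ mult_ge0 (1 - a).

Lemma mult_ge0_pf a : mult_ge0 a -> 0 <= L a.
Proof. by move=> /(_ 1); rewrite !mulr1. Qed.

Lemma mult_ge0D a b : mult_ge0 a -> mult_ge0 b -> mult_ge0 (a + b).
Proof. by move=> ha hb f; rewrite mulrDl pfD addr_ge0. Qed.

Lemma mult_ge0_sqr a : mult_ge0 (a * a).
Proof. by move=> f; rewrite mulrACA pf_sqr_ge0. Qed.

Lemma mult_ge0Msqr a b : mult_ge0 a -> mult_ge0 (a * (b * b)).
Proof. by move=> ha f; rewrite -mulrA mulrACA ha. Qed.

Lemma mult_ge0_1 : mult_ge0 1.
Proof. by rewrite -[1]mulr1; exact: mult_ge0_sqr. Qed.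

Lemma mult_ge0Z c a : 0 <= c -> mult_ge0 a -> mult_ge0 (k c * a).
Proof. by move=> c0 ha f; rewrite -mulrA pfZ mulr_ge0. Qed.

Lemma mult_ge0_sum I (r : seq I) (P : pred I) (F : I -> A) :
  (forall i, P i -> mult_ge0 (F i)) -> mult_ge0 (\sum_(i <- r | P i) F i).
Proof.
move=> h; elim/big_ind : _ => //; last exact: mult_ge0D.
by move=> f; rewrite mul0r pf0.
Qed.

(** The square roots that show that a product of commuting positive operators
    is positive are replaced by the sequence
    [b, b - b^2, (b - b^2) - (b - b^2)^2, ...]: it telescopes, so that [b] is
    the sum of the squares of its terms up to a remainder, and it stays between
    0 and 1, so that the remainder vanishes in the seminorm of the functional. *)
Fixpoint sqr_residue (b : A) n : A :=
  if n is m.+1 then sqr_residue b m - sqr_residue b m * sqr_residue b m else b.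

Lemma mult_01_sqr_residue b n : mult_01 b -> mult_01 (sqr_residue b n).
Proof.
move=> hb; elim: n => [|n [h0 h1]] //=; set c := sqr_residue b n in h0 h1 *.
split.
  have -> : c - c * c = (1 - c) * (c * c) + c * ((1 - c) * (1 - c)) by ring.
  by apply: mult_ge0D; exact: mult_ge0Msqr.
have -> : 1 - (c - c * c) = (1 - c) + c * c by ring.
by apply: mult_ge0D => //; exact: mult_ge0_sqr.
Qed.

Lemma sqr_residueE b n :
  b = \sum_(i < n) sqr_residue b i * sqr_residue b i + sqr_residue b n.
Proof.
elim: n => [|n IH]; first by rewrite big_ord0 add0r.
rewrite big_ord_recr /= {1}IH.
by ring.
Qed.

(** If [L (a * b * f^2)] were [- e < 0], then for every [n] the remainder [c n]
    would give [L ((a * f) * (c n * f)) <= - e], since the squares that precede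
    it contribute nonnegative terms. By Cauchy-Schwarz the numbers
    [L ((c n * f)^2)] would be bounded away from 0, but their sum is at most
    [L (b * f^2)]. *)
Lemma mult_ge0M a b : mult_ge0 a -> mult_01 b -> mult_ge0 (a * b).
Proof.
move=> ha hb f; rewrite leNgt; apply/negP => neg.
set c := sqr_residue b.
set e := - L (a * b * (f * f)).
have e_gt0 : 0 < e by rewrite oppr_gt0.
set K := L (a * f * (a * f)).
have K0 : 0 <= K := pf_sqr_ge0 _ _.
have sumE n : \sum_(i < n) (c i * f) * (c i * f) =
    (\sum_(i < n) c i * c i) * (f * f).
  by rewrite mulr_suml; apply: eq_bigr => i _; rewrite mulrACA.
have rem n : e ^+ 2 <= K * L (c n * f * (c n * f)).
  have cs := pf_cauchy_schwarz (a * f) (c n * f).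
  apply: le_trans cs; rewrite -/K.
  have -> : a * f * (c n * f) = a * b * (f * f) -
      \sum_(i < n) a * ((c i * f) * (c i * f)).
    rewrite {1}(sqr_residueE b n) -/c -mulr_sumr.
    by rewrite sumE; ring.
  rewrite pfB pf_sum -[L (a * b * (f * f))]opprK -/e.
  have h : 0 <= \sum_(i < n) L (a * ((c i * f) * (c i * f))).
    by apply: sumr_ge0 => i _; exact: ha.
  by rewrite -[leRHS]sqrrN ler_sqr ?nnegrE; lra.
have tot n : \sum_(i < n) L (c i * f * (c i * f)) <= L (b * (f * f)).
  rewrite -pf_sum sumE {1}(sqr_residueE b n) -/c mulrDl pfD.
  by rewrite lerDl; have [] := mult_01_sqr_residue n hb.
have bnd n : n%:R * e ^+ 2 <= K * L (b * (f * f)).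
  apply: le_trans (ler_wpM2l K0 (tot n)); rewrite mulr_sumr.
  rewrite mulr_natl -[n in X in X <= _](card_ord n) -sumr_const.
  by apply: ler_sum => i _; exact: rem.
have e2 : 0 < e ^+ 2 by rewrite exprn_gt0.
have := bnd (Num.truncn (K * L (b * (f * f)) / e ^+ 2)).+1.
by rewrite -ler_pdivlMr // leNgt truncnS_gt.
Qed.

Lemma mult_01M a b : mult_01 a -> mult_01 b -> mult_01 (a * b).
Proof.
move=> [a0 a1] hb; split; first exact: mult_ge0M.
have -> : 1 - a * b = (1 - b) + (1 - a) * b by ring.
by apply: mult_ge0D; [case: hb|exact: mult_ge0M].
Qed.

Lemma mult_01_1 : mult_01 1.
Proof. by split; [exact: mult_ge0_1|rewrite subrr => f; rewrite mul0r pf0]. Qed.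

Lemma mult_01_prod I (r : seq I) (P : pred I) (F : I -> A) :
  (forall i, P i -> mult_01 (F i)) -> mult_01 (\prod_(i <- r | P i) F i).
Proof.
by move=> h; elim/big_ind : _ => //; [exact: mult_01_1|exact: mult_01M].
Qed.

Lemma mult_01X a n : mult_01 a -> mult_01 (a ^+ n).
Proof.
move=> ha; elim: n => [|n IH]; first by rewrite expr0; exact: mult_01_1.
by rewrite exprS; exact: mult_01M.
Qed.

Lemma mult_01_compl a : mult_01 a -> mult_01 (1 - a).
Proof. by move=> [a0 a1]; split => //; rewrite subKr. Qed.

End PositiveFunctional.

Section Root.
Variables (R : realType) (A : comPzRingType) (k : {rmorphism R -> A}).
Variable L : positive_functional k.

Lemma mult_ge0X z n : mult_ge0 L z -> mult_ge0 L (z ^+ n).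
Proof.
move=> hz; rewrite -(odd_double_half n) exprD -addnn exprD.
case: odd; first by rewrite expr1; exact: mult_ge0Msqr.
by rewrite expr0 mul1r; exact: mult_ge0_sqr.
Qed.

Definition pf_weight z (hz : mult_ge0 L z) : positive_functional k.
Proof.
apply: (@PositiveFunctional _ _ _ (fun f => L (z * f))) => [f g|c f|//].
- by rewrite mulrDr pfD.
- by rewrite mulrCA pfZ.
Defined.

(** [n |-> L (z ^+ n * f^2)] is log-convex, so that a first step upwards would
    be repeated at every later step. *)
Lemma mult_01_root z n : (0 < n)%N -> mult_ge0 L z -> mult_01 L (z ^+ n) ->
  mult_01 L z.
Proof.
move=> n0 hz [_ hzn]; split => // f.
pose u i := L (z ^+ i * (f * f)).
have u_ge0 i : 0 <= u i by exact: mult_ge0X.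
have u_conv i : u i.+1 ^+ 2 <= u i * u i.+2.
  have := pf_cauchy_schwarz (pf_weight (mult_ge0X i hz)) f (z * f).
  rewrite /= /u !exprS.
  have -> : z * z ^+ i * (f * f) = z ^+ i * (f * (z * f)) by ring.
  by have -> : z * (z * z ^+ i) * (f * f) = z ^+ i * (z * f * (z * f)) by ring.
have un : u n <= u 0%N.
  by have := hzn f; rewrite mulrBl mul1r pfB /u expr0 mul1r subr_ge0.
have -> : L ((1 - z) * (f * f)) = u 0%N - u 1%N.
  by rewrite /u expr0 expr1 mulrBl pfB.
rewrite subr_ge0 leNgt; apply/negP => u01.
have u0_gt0 : 0 < u 0%N.
  rewrite lt_def u_ge0 andbT; apply/negP => /eqP u00.
  have := u_conv 0%N; rewrite u00 mul0r; apply/negP; rewrite -ltNge.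
  by rewrite exprn_gt0 // -u00.
have step i : 0 < u i /\ u i < u i.+1.
  elim: i => [//|i [ui uS]]; have uS0 := lt_trans ui uS; split => //.
  rewrite -(ltr_pM2l ui); apply: lt_le_trans (u_conv i).
  by rewrite expr2 ltr_pM2r.
suff : u 0%N < u n by rewrite ltNge un.
case: n n0 {hzn un} => // n _.
elim: n => [//|n IH]; exact: lt_trans IH (step n.+1).2.
Qed.

End Root.

(** * Bernoulli sampling *)

Section Bernoulli.
Variables (R : realType) (A : comPzRingType) (k : {rmorphism R -> A}).
Variable (b : nat -> A).

(** At stage [d] each of the first [d] multipliers is sampled [d] times. *)
Definition outcome d := {ffun 'I_d * 'I_d -> bool}.

Definition bern_factor (a : A) (e : bool) : A := if e then a else 1 - a.

Definition bern_weight d (w : outcome d) : A :=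
  \prod_(z : 'I_d * 'I_d) bern_factor (b z.1) (w z).

Definition freq d (w : outcome d) (i : nat) : R :=
  if insub i is Some j then (\sum_(r < d) (w (j, r))%:R) / d%:R else 0.

Lemma freq_ge0 d (w : outcome d) i : 0 <= freq w i.
Proof.
rewrite /freq; case: insubP => // j _ _.
by rewrite divr_ge0 ?sumr_ge0// => r _; rewrite ler0n.
Qed.

Lemma freq_le1 d (w : outcome d) i : freq w i <= 1.
Proof.
rewrite /freq; case: insubP => [j ij _|_ //].
have d0 : (0 < d)%N by exact: leq_ltn_trans (leq0n _) ij.
rewrite ler_pdivrMr ?ltr0n// mul1r -[d in leRHS]card_ord -sumr_const.
by apply: ler_sum => r _; rewrite lern1 leq_b1.
Qed.

Lemma bern_sum_prod d (G : 'I_d * 'I_d -> bool -> A) :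
  \sum_(w : outcome d) bern_weight w * \prod_(z : 'I_d * 'I_d) G z (w z) =
  \prod_(z : 'I_d * 'I_d) (b z.1 * G z true + (1 - b z.1) * G z false).
Proof.
under eq_bigr do rewrite -big_split.
rewrite -(bigA_distr_bigA (fun (z : 'I_d * 'I_d) e => bern_factor (b z.1) e * G z e)).
by apply: eq_bigr => z _; rewrite big_bool.
Qed.

Lemma bern_weight_sum d : \sum_(w : outcome d) bern_weight w = 1.
Proof.
transitivity (\sum_(w : outcome d) bern_weight w * \prod_(z : 'I_d * 'I_d) 1).
  by apply: eq_bigr => w _; rewrite big1_eq mulr1.
rewrite (bern_sum_prod (fun _ _ => 1)).
by rewrite big1 // => z _; ring.
Qed.

(** Samples are independent: a coordinate that does not occur in the integrand
    sums to [b + (1 - b) = 1]. *)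
Lemma bern_cov d (j r r' : 'I_d) :
  \sum_(w : outcome d)
    bern_weight w * (((w (j, r))%:R - b j) * ((w (j, r'))%:R - b j)) =
  (r == r')%:R * (b j * (1 - b j)).
Proof.
pose H (y z : 'I_d * 'I_d) (e : bool) : A := if z == y then e%:R - b j else 1.
have prodH (y : 'I_d * 'I_d) (w : outcome d) :
    \prod_(z : 'I_d * 'I_d) H y z (w z) = (w y)%:R - b j.
  by rewrite /H -big_mkcond /= big_pred1_eq.
under eq_bigr do rewrite -!prodH -big_split.
rewrite (bern_sum_prod (fun z e => H (j, r) z e * H (j, r') z e)).
rewrite (bigD1 (j, r)) //= /H !xpair_eqE !eqxx /=.
have [<-|rr'] := eqVneq r r'; last first.
  by rewrite !mulr1 (_ : b j * _ + _ = 0) ?mul0r //; ring.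
rewrite big1 => [|z /negbTE zj]; last by rewrite zj; ring.
by rewrite mulr1n; ring.
Qed.

Lemma bern_var d (j : 'I_d) :
  \sum_(w : outcome d)
    bern_weight w * ((k (freq w j) - b j) * (k (freq w j) - b j)) =
  k d%:R^-1 * (b j * (1 - b j)).
Proof.
have d0 : (0 < d)%N by exact: leq_ltn_trans (leq0n j) (ltn_ord j).
have dR : d%:R != 0 :> R by rewrite pnatr_eq0 -lt0n.
have dev (w : outcome d) : k (freq w j) - b j =
    k d%:R^-1 * \sum_(r < d) ((w (j, r))%:R - b j).
  rewrite sumrB sumr_const card_ord -[b j *+ d]mulr_natl mulrBr mulrA.
  rewrite -(rmorph_nat k) -rmorphM mulVf // rmorph1 mul1r; congr (_ - _).
  rewrite /freq (insubT (fun i => i < d)%N (ltn_ord j)) /= mulrC rmorphM.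
  rewrite rmorph_sum; congr (_ * _); apply: eq_bigr => r _.
  rewrite rmorph_nat; congr (w (_, _))%:R; exact: val_inj.
pose c := k (d%:R^-1 * d%:R^-1).
have devM (w : outcome d) :
    bern_weight w * ((k (freq w j) - b j) * (k (freq w j) - b j)) =
    c * \sum_(r < d) \sum_(r' < d)
      bern_weight w * (((w (j, r))%:R - b j) * ((w (j, r'))%:R - b j)).
  rewrite dev mulrACA -rmorphM -/c big_distrlr /= mulrCA mulr_sumr.
  by congr (_ * _); apply: eq_bigr => r _; rewrite mulr_sumr.
under eq_bigr do rewrite devM.
rewrite -mulr_sumr exchange_big /=.
under eq_bigr => r _.
  rewrite exchange_big /=.
  under eq_bigr do rewrite bern_cov.
  rewrite -mulr_suml (bigD1 r) //= eqxx big1 ?addr0 ?mul1r; last first.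
    by move=> i /negbTE; rewrite eq_sym => ->.
  over.
rewrite sumr_const card_ord -[X in c * X]mulr_natl mulrA -(rmorph_nat k) /c.
by rewrite -rmorphM -mulrA mulVf // mulr1.
Qed.

Variable L : positive_functional k.
Hypothesis b01 : forall i, mult_01 L (b i).

Lemma bern_weight_mult_ge0 d (w : outcome d) : mult_ge0 L (bern_weight w).
Proof.
suff [] : mult_01 L (bern_weight w) by [].
apply: mult_01_prod => z _; rewrite /bern_factor.
by case: (w z) => //; exact: mult_01_compl.
Qed.

Definition bern_mean d (f : A) (g : outcome d -> R) : R :=
  \sum_(w : outcome d) g w * L (bern_weight w * f).

(** The error is a sum of terms [L (w * ((freq - b) * f))]. Each is bounded by
    Cauchy-Schwarz for [L] weighted by [w]; splitting the product with [eta]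
    lets the variance be summed separately from [L (w * f^2)]. *)
Lemma bern_mean_step d (j : 'I_d) (g : outcome d -> R) f eta : 0 < eta ->
  (forall w, 0 <= g w <= 1) ->
  `|bern_mean f (fun w => freq w j * g w) - bern_mean (b j * f) g| <=
  eta * L (f * f) + eta^-1 * (d%:R^-1 * L 1).
Proof.
move=> eta0 g01; rewrite /bern_mean -sumrB.
pose dv (w : outcome d) := k (freq w j) - b j.
have -> : eta * L (f * f) =
    \sum_(w : outcome d) eta * L (bern_weight w * (f * f)).
  by rewrite -mulr_sumr -pf_sum -mulr_suml bern_weight_sum mul1r.
have varE : \sum_(w : outcome d) L (bern_weight w * (dv w * dv w)) <=
    d%:R^-1 * L 1.
  rewrite -pf_sum bern_var pfZ ler_wpM2l ?invr_ge0//.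
  have [h0 h1] : mult_01 L (b j * (1 - b j)).
    by apply: mult_01M => //; exact: mult_01_compl.
  by rewrite -subr_ge0 -pfB; exact: mult_ge0_pf.
apply: (@le_trans _ _ (\sum_(w : outcome d) (eta * L (bern_weight w * (f * f)) +
    eta^-1 * L (bern_weight w * (dv w * dv w))))); last first.
  by rewrite big_split lerD2l -mulr_sumr ler_wpM2l// invr_ge0 ltW.
apply: le_trans (ler_norm_sum _ _ _) _; apply: ler_sum => w _.
have -> : freq w j * g w * L (bern_weight w * f) -
    g w * L (bern_weight w * (b j * f)) = g w * L (bern_weight w * (dv w * f)).
  rewrite (_ : bern_weight w * (dv w * f) = k (freq w j) * (bern_weight w * f) -
    bern_weight w * (b j * f)); last by rewrite /dv; ring.
  by rewrite pfB pfZ; ring.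
have [gw0 gw1] := andP (g01 w).
rewrite normrM (ger0_norm gw0).
apply: (@le_trans _ _ `|L (bern_weight w * (dv w * f))|).
  by rewrite ler_piMl.
pose W := pf_weight (bern_weight_mult_ge0 w).
have cs : L (bern_weight w * (dv w * f)) ^+ 2 <=
  L (bern_weight w * (dv w * dv w)) * L (bern_weight w * (f * f)).
  exact: (pf_cauchy_schwarz W (dv w) f).
have x0 : 0 <= L (bern_weight w * (dv w * dv w)) := pf_sqr_ge0 W _.
have y0 : 0 <= L (bern_weight w * (f * f)) := pf_sqr_ge0 W _.
move: (L (bern_weight w * (dv w * f))) (L (bern_weight w * (dv w * dv w)))
  (L (bern_weight w * (f * f))) cs x0 y0 => z x y cs x0 y0.
have ei0 : 0 < eta^-1 by rewrite invr_gt0.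
have ex0 : 0 <= eta^-1 * x by rewrite mulr_ge0 // ltW.
have ey0 : 0 <= eta * y by rewrite mulr_ge0 // ltW.
rewrite -ler_sqr ?nnegrE ?addr_ge0 // real_normK ?num_real //.
apply: le_trans cs _.
have -> : x * y = (eta^-1 * x) * (eta * y) by field; rewrite gt_eqF.
by nra.
Qed.

(** Frequencies are exchanged for multipliers one at a time: [eta] is chosen
    small to control [L (f * f)], and then [d] large to control the variance. *)
Lemma bern_mean_prod (s : seq nat) f e : 0 < e -> exists N, forall d, (N <= d)%N ->
  `|bern_mean f (fun w : outcome d => \prod_(i <- s) freq w i) -
    L (\prod_(i <- s) b i * f)| <= e.
Proof.
elim: s f e => [|j s IH] f e e0.
  exists 0%N => d _; rewrite big_nil mul1r /bern_mean.
  under eq_bigr do rewrite big_nil mul1r.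
  by rewrite -pf_sum -mulr_suml bern_weight_sum mul1r subrr normr0 ltW.
have e20 : 0 < e / 2 by rewrite divr_gt0.
have [N1 hN1] := IH (b j * f) (e / 2) e20.
have q0 : 0 <= L (f * f) := pf_sqr_ge0 L f.
have l0 := pf1_ge0 L.
pose eta := e / 4 / (L (f * f) + 1).
have eta0 : 0 < eta by rewrite !divr_gt0 // ltr_wpDl.
pose C := eta^-1 * L 1 / (e / 4).
exists (maxn (maxn N1 j.+1) (Num.truncn C).+1) => d.
rewrite !geq_max -andbA => /and3P[dN1 dj dC].
rewrite -(subrKA (bern_mean (b j * f) (fun w : outcome d => \prod_(i <- s) freq w i))).
apply: le_trans (ler_normD _ _) _; rewrite (splitr e); apply: lerD; last first.
  rewrite big_cons (_ : b j * _ * f = \prod_(i <- s) b i * (b j * f)) ?hN1 //.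
  by ring.
rewrite /bern_mean; under eq_bigr do rewrite big_cons.
apply: le_trans (@bern_mean_step d (Ordinal dj) _ f _ eta0 _) _.
  move=> w; apply/andP; split.
    by rewrite prodr_ge0 // => i _; exact: freq_ge0.
  by rewrite prodr_ile1 // => i _; rewrite freq_ge0 freq_le1.
have -> : e / 2 = e / 4 + e / 4 by field.
apply: lerD.
  rewrite /eta -mulrA ger_pMr ?divr_gt0 // mulrC ler_pdivrMr ?mul1r ?lerDl //.
  by rewrite ltr_wpDl.
rewrite mulrCA mulrC ler_pdivrMr; last by rewrite ltr0n (leq_trans _ dj).
rewrite [leRHS]mulrC -ler_pdivrMr ?divr_gt0 //.
by apply: ltW; apply: lt_le_trans (truncnS_gt _) _; rewrite ler_nat.
Qed.

End Bernoulli.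

(** * Real integrals with their values *)

Section HasIntegral.
Context d (T : measurableType d) (R : realType).
Variables (mu : {measure set T -> \bar R}) (D : set T).
Hypothesis mD : measurable D.

(** Integrability is paired with a real value so that linear combinations of
    integrals are computed without leaving the reals. *)
Definition has_integral (f : T -> R) (v : R) : Prop :=
  mu.-integrable D (EFin \o f) /\ (\int[mu]_(x in D) (f x)%:E = v%:E)%E.

Lemma has_integral_unique f v w : has_integral f v -> has_integral f w -> v = w.
Proof. by move=> [_ h] [_]; rewrite h => -[]. Qed.

Lemma eq_has_integral f g v :
  (forall x, D x -> f x = g x) -> has_integral f v -> has_integral g v.
Proof.
move=> fg [fi fv]; split.
  apply: eq_integrable fi => // x; rewrite inE => Dx /=; by rewrite fg.
by rewrite -fv; apply: eq_integral => x; rewrite inE => Dx; rewrite fg.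
Qed.

Lemma has_integralD f g v w : has_integral f v -> has_integral g w ->
  has_integral (fun x => f x + g x) (v + w).
Proof.
move=> [fi fv] [gi gw]; split.
  by apply: eq_integrable (integrableD mD fi gi) => // x _ /=; rewrite EFinD.
under eq_integral do rewrite EFinD.
by rewrite (integralD_EFin mD fi gi) EFinD -fv -gw.
Qed.

Lemma has_integralZ c f v : has_integral f v ->
  has_integral (fun x => c * f x) (c * v).
Proof.
move=> [fi fv]; split.
  by apply: eq_integrable (integrableZl mD c fi) => // x _ /=; rewrite EFinM.
under eq_integral do rewrite EFinM.
by rewrite (integralZl mD fi) fv.
Qed.

Lemma has_integralB f g v w : has_integral f v -> has_integral g w ->
  has_integral (fun x => f x - g x) (v - w).
Proof.
move=> hf hg; have := has_integralD hf (has_integralZ (-1) hg).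
by rewrite mulN1r; apply: eq_has_integral => x _; rewrite mulN1r.
Qed.

Lemma has_integral0 : has_integral (fun=> 0) 0.
Proof. by split; [exact: integrable0|rewrite integral0]. Qed.

Lemma has_integral_sum I (r : seq I) (F : I -> T -> R) (v : I -> R) :
  (forall i, has_integral (F i) (v i)) ->
  has_integral (fun x => \sum_(i <- r) F i x) (\sum_(i <- r) v i).
Proof.
move=> h; elim: r => [|i r IH].
  rewrite big_nil; apply: eq_has_integral has_integral0 => x _.
  by rewrite big_nil.
rewrite big_cons; apply: eq_has_integral (has_integralD (h i) IH) => x _.
by rewrite big_cons.
Qed.

Lemma has_integral_le f g v w : (forall x, D x -> f x <= g x) ->
  has_integral f v -> has_integral g w -> v <= w.
Proof.
move=> fg [fi fv] [gi gw]; rewrite -lee_fin -fv -gw.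
by apply: le_integral => // x; rewrite inE => Dx; rewrite lee_fin fg.
Qed.

Lemma has_integral_indic A v : measurable A -> mu (A `&` D) = v%:E ->
  has_integral (\1_A) v.
Proof.
move=> mA muA; split; last by rewrite integral_indic.
apply/integrableP; split; first by apply/measurable_EFinP; exact: measurable_indic.
under eq_integral => x _.
  by rewrite /= ger0_norm; [over|rewrite indicE ler0n].
by rewrite integral_indic // muA ltry.
Qed.

Lemma has_integral_cst c v : mu D = v%:E -> has_integral (fun=> c) (c * v).
Proof.
move=> muD; have h : has_integral (\1_setT) v.
  by apply: has_integral_indic => //; rewrite setTI.
apply: eq_has_integral (has_integralZ c h) => x _.
by rewrite indicT /cst mulr1.
Qed.

Lemma bounded_has_integral (f : T -> R) C : (mu D < +oo)%E -> measurable_fun D f ->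
  (forall x, D x -> `|f x| <= C) -> exists v, has_integral f v.
Proof.
move=> muD mf fC.
have fi : mu.-integrable D (EFin \o f).
  apply: measurable_bounded_integrable => //.
  exists C; split; first exact: num_real.
  by move=> x Cx y Dy; rewrite /= (le_trans (fC _ Dy))// ltW.
exists (fine (\int[mu]_(x in D) (f x)%:E)); split => //.
by rewrite fineK//; exact: integrable_fin_num.
Qed.

End HasIntegral.

(** * Finitely additive means *)

Section BoundedMean.
Variables (R : realType) (Y : Type).

Definition bounded_real (f : Y -> R) := exists C, forall y, `|f y| <= C.

Record bounded_mean := BoundedMean {
  bm_fun :> (Y -> R) -> R;
  bmD : forall f g, bounded_real f -> bounded_real g ->
    bm_fun (fun y => f y + g y) = bm_fun f + bm_fun g;
  bmZ : forall c f, bounded_real f ->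
    bm_fun (fun y => c * f y) = c * bm_fun f;
  bm_ge0 : forall f, bounded_real f -> (forall y, 0 <= f y) -> 0 <= bm_fun f }.

Lemma bounded_realD f g : bounded_real f -> bounded_real g ->
  bounded_real (fun y => f y + g y).
Proof.
move=> [C fC] [C' gC]; exists (C + C') => y.
by rewrite (le_trans (ler_normD _ _))// lerD.
Qed.

Lemma bounded_realZ c f : bounded_real f -> bounded_real (fun y => c * f y).
Proof. by move=> [C fC]; exists (`|c| * C) => y; rewrite normrM ler_wpM2l. Qed.

Lemma bounded_real_cst c : bounded_real (fun=> c).
Proof. by exists `|c|. Qed.

Lemma bounded_real_bool (b : Y -> bool) : bounded_real (fun y => (b y)%:R).
Proof. by exists 1 => y; case: (b y); rewrite ?normr1 ?normr0. Qed.

Lemma bounded_real_sum I (r : seq I) (F : I -> Y -> R) :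
  (forall i, bounded_real (F i)) -> bounded_real (fun y => \sum_(i <- r) F i y).
Proof.
move=> h; elim: r => [|i r IH].
  by under eq_fun do rewrite big_nil; exact: bounded_real_cst.
by under eq_fun do rewrite big_cons; exact: bounded_realD.
Qed.

Variable Lam : bounded_mean.

Lemma bm0 : Lam (fun=> 0) = 0.
Proof.
by have := bmZ Lam 0 (bounded_real_cst 0); rewrite /= !mul0r.
Qed.

Lemma bm_sum I (r : seq I) (F : I -> Y -> R) : (forall i, bounded_real (F i)) ->
  Lam (fun y => \sum_(i <- r) F i y) = \sum_(i <- r) Lam (F i).
Proof.
move=> h; elim: r => [|i r IH].
  by under eq_fun do rewrite big_nil; rewrite big_nil bm0.
under eq_fun do rewrite big_cons.
by rewrite bmD ?IH ?big_cons //; exact: bounded_real_sum.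
Qed.

Lemma bm_le f g : bounded_real f -> bounded_real g -> (forall y, f y <= g y) ->
  Lam f <= Lam g.
Proof.
move=> hf hg fg; rewrite -subr_ge0.
have := bm_ge0 Lam (bounded_realD hg (bounded_realZ (-1) hf)).
rewrite bmD ?bmZ ?mulN1r //; last exact: bounded_realZ.
by apply => y; rewrite mulN1r subr_ge0.
Qed.

End BoundedMean.

(** * Bits of finitely additive means on the Lebesgue interval *)

Section BitModel.
Variables (R : realType) (Y : Type) (Lam : bounded_mean R Y).
Variable bit : nat -> Y -> bool.

Let c := Lam (fun=> 1).

(** Words list the last bit first, so that the next bit is added by [::]. *)
Fixpoint prefix_word (e : nat -> bool) n : seq bool :=
  if n is m.+1 then e m :: prefix_word e m else [::].

Definition word_mass (w : seq bool) : R :=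
  Lam (fun y => (w == prefix_word (bit^~ y) (size w))%:R).

Fixpoint word_left (w : seq bool) : R :=
  if w is e :: w' then
    word_left w' + (if e then word_mass (false :: w') else 0) else 0.

Fixpoint word_at (u : R) n : seq bool :=
  if n is m.+1 then
    let w := word_at u m in (word_left w + word_mass (false :: w) <= u) :: w
  else [::].

Definition bit_at n u : bool :=
  word_left (word_at u n) + word_mass (false :: word_at u n) <= u.

Lemma word_atE u n : word_at u n = prefix_word (bit_at^~ u) n.
Proof. by elim: n => //= n <-. Qed.

Lemma size_prefix_word e n : size (prefix_word e n) = n.
Proof. by elim: n => //= n ->. Qed.

Lemma word_mass_ge0 w : 0 <= word_mass w.
Proof. by apply: bm_ge0 => [|y]; [exact: bounded_real_bool|rewrite ler0n]. Qed.

Lemma word_mass_nil : word_mass [::] = c.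
Proof. by []. Qed.

Lemma word_mass_split w :
  word_mass w = word_mass (false :: w) + word_mass (true :: w).
Proof.
rewrite /word_mass -bmD; try exact: bounded_real_bool.
congr (Lam _); apply/funext => y /=.
by rewrite !eqseq_cons; case: (bit _ y); case: (w == _); rewrite ?addr0 ?add0r.
Qed.

Lemma word_at_interval w u : 0 <= u < c ->
  (word_at u (size w) == w) = (word_left w <= u < word_left w + word_mass w).
Proof.
move=> uc; elim: w => [|e w IH]; first by rewrite /= add0r word_mass_nil uc.
have mE := word_mass_split w.
have m0 := word_mass_ge0 (false :: w); have m1 := word_mass_ge0 (true :: w).
rewrite /= eqseq_cons; have [h|h] := eqVneq (word_at u (size w)) w.
  move: IH; rewrite h eqxx => /esym/andP[l1 l2]; rewrite andbT.
  have [H|H] := leP (word_left w + word_mass (false :: w)) u; case: e => /=;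
    apply/esym.
  - by apply/andP; split; lra.
  - by apply/negbTE/negP => /andP[? ?]; lra.
  - by apply/negbTE/negP => /andP[? ?]; lra.
  - by apply/andP; split; lra.
move: IH; rewrite (negbTE h) andbF => IH; apply/esym/negbTE/negP => /andP[l1 l2].
suff : word_left w <= u < word_left w + word_mass w by rewrite -IH.
by case: e l1 l2 => l1 l2; apply/andP; split; lra.
Qed.

Lemma word_left_ge0 w : 0 <= word_left w.
Proof.
by elim: w => [//|e w IH]; rewrite /= addr_ge0 //; case: e; rewrite ?word_mass_ge0.
Qed.

Lemma word_right_le w : word_left w + word_mass w <= c.
Proof.
elim: w => [|e w IH]; first by rewrite /= add0r word_mass_nil.
have mE := word_mass_split w.
have m0 := word_mass_ge0 (false :: w); have m1 := word_mass_ge0 (true :: w).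
by case: e => /=; lra.
Qed.

Lemma measurable_word_at n w : measurable [set u : R | word_at u n = w].
Proof.
elim: n w => [|n IH] w /=.
  case: w => [|e w]; first by rewrite (_ : [set _ | _] = setT) // -subTset.
  by rewrite (_ : [set _ | _] = set0) // -subset0.
case: w => [|e w]; first by rewrite (_ : [set _ | _] = set0) // -subset0.
rewrite (_ : [set _ | _] = [set u | word_at u n = w] `&`
    [set u | (word_left w + word_mass (false :: w) <= u) = e]); last first.
  by apply/seteqP; split => u /= [<- //] => [<-|->].
apply: measurableI => //; set a := _ + _.
case: e; last rewrite (_ : [set _ | _] = ~` [set u | a <= u]).
- by rewrite -set_itvcy; exact: measurable_itv.
- by apply: measurableC; rewrite -set_itvcy; exact: measurable_itv.
- by apply/seteqP; split => u /= => [->|/negP/negbTE].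
Qed.

Lemma measurable_bit_at n : measurable_fun setT (bit_at n).
Proof.
apply: (measurable_fun_bool true); rewrite setTI.
rewrite (_ : _ @^-1` _ = \bigcup_(w : seq bool) [set u | word_at u n.+1 = true :: w]).
  by apply: countable_bigcupT_measurable => // w; exact: measurable_word_at.
apply/seteqP; split => u /=.
  by move=> h; exists (word_at u n) => //=; congr cons.
by move=> [w _ /= [<- _]].
Qed.

(** The words of length [n] cut [[0, c[] into consecutive intervals whose
    lengths are their masses, and longer words refine this partition. Hence the
    bits of a Lebesgue random point have the joint laws that [Lam], although
    only finitely additive, gives to the original bits. *)
Lemma bit_model n (G : (nat -> bool) -> R) :
  (forall e e', (forall i, (i < n)%N -> e i = e' i) -> G e = G e') ->
  has_integral (@lebesgue_measure R) `[0, c[ (fun u => G (bit_at^~ u))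
    (Lam (fun y => G (bit^~ y))).
Proof.
move=> Gn.
pose H (w : seq bool) := G (nth false (rev w)).
have prefix_nth e i : (i < n)%N -> nth false (rev (prefix_word e n)) i = e i.
  elim: n {Gn} i => //= n IH i; rewrite rev_cons nth_rcons size_rev.
  by rewrite size_prefix_word ltnS leq_eqVlt => /predU1P[->|i_n]; rewrite ?ltnn ?eqxx // i_n IH.
have GE e : G e = H (prefix_word e n) by apply: Gn => i i_n; rewrite prefix_nth.
have sumE (e : nat -> bool) :
    G e = \sum_(w : n.-tuple bool) H w * (val w == prefix_word e n)%:R.
  have sz : size (prefix_word e n) == n by rewrite size_prefix_word.
  rewrite (bigD1 (Tuple sz)) //= eqxx mulr1 big1 ?addr0 // => w.
  rewrite -val_eqE /= => /negbTE ->; exact: mulr0.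
rewrite (_ : Lam (fun y => G (bit^~ y)) = \sum_(w : n.-tuple bool) H w * word_mass w); last first.
  rewrite (_ : (fun y => G _) = fun y => \sum_(w : n.-tuple bool)
    H w * (val w == prefix_word (bit^~ y) n)%:R); last exact/funext.
  rewrite bm_sum => [|w]; last exact: bounded_realZ (bounded_real_bool _ _).
  apply: eq_bigr => w _; rewrite bmZ; last exact: bounded_real_bool.
  by rewrite /word_mass size_tuple.
rewrite (_ : (fun u => G _) = fun u => \sum_(w : n.-tuple bool)
    H w * (val w == prefix_word (bit_at^~ u) n)%:R); last exact/funext.
apply: has_integral_sum; first exact: measurable_itv.
move=> w; apply: has_integralZ; first exact: measurable_itv.
pose I : set R := `[word_left w, word_left w + word_mass w[%classic.
apply: (@eq_has_integral _ (measurableTypeR R) R _ _ (measurable_itv _) (\1_I)).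
  move=> u; rewrite /= in_itv /= => u0c; rewrite indicE -word_atE.
  have := word_at_interval w u0c; rewrite size_tuple eq_sym => ->.
  by rewrite mem_setE in_itv.
apply: has_integral_indic; [exact: measurable_itv|exact: measurable_itv|].
rewrite setIidl => [|u /=]; last first.
  rewrite !in_itv /= => /andP[h1 h2]; rewrite (le_trans (word_left_ge0 w) h1).
  exact: lt_le_trans h2 (word_right_le w).
apply: (eq_trans (lebesgue_measure_itv _)); rewrite /= lte_fin ltrDl; case: ltP => h.
  by rewrite -EFinB addrAC subrr add0r.
by congr (_%:E); apply/esym/eqP; rewrite eq_le h word_mass_ge0.
Qed.

End BitModel.

(** * Binary digits *)
Section BinaryDigits.
Variable R : realType.

Lemma le0_half_expr (z C : R) : (forall p, z <= C * 2^-1 ^+ p) -> z <= 0.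
Proof.
move=> h; apply: (cvgr_to_ge (f := geometric C 2^-1) (F := \oo)).
  by apply: cvg_geometric; rewrite ger0_norm ?invf_lt1 ?ltr1n.
by apply: nearW => p; exact: h.
Qed.

Lemma ler_norm_prodB (I : Type) (s : seq I) (f g : I -> R) (e : R) :
  (forall i, 0 <= f i <= 1) -> (forall i, 0 <= g i <= 1) ->
  (forall i, `|f i - g i| <= e) ->
  `|\prod_(i <- s) f i - \prod_(i <- s) g i| <= (size s)%:R * e.
Proof.
move=> f01 g01 fg; elim: s => [|i s IH].
  by rewrite !big_nil subrr normr0 mul0r.
rewrite !big_cons -(subrKA (f i * \prod_(j <- s) g j)) -mulrBr -mulrBl.
apply: le_trans (ler_normD _ _) _; rewrite /= -natr1 [leRHS]mulrDl mul1r.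
have [fi0 fi1] := andP (f01 i).
apply: lerD; rewrite normrM; last first.
  apply: le_trans (fg i); apply: ler_piMr => //.
  rewrite ger0_norm; last by apply: prodr_ge0 => j _; case/andP: (g01 j).
  by apply: prodr_ile1 => j _; exact: g01.
by apply: le_trans IH; apply: ler_piMl => //; rewrite ger0_norm.
Qed.

(** The expansion is greedy with a non-strict test, so that all residues stay in
    [[0, 1]] and the value 1 has all its digits equal to 1. *)
Fixpoint bin_residue (v : R) p : R :=
  if p is q.+1 then
    2 * bin_residue v q - ((2^-1 : R) <= bin_residue v q)%R%:R
  else v.

Definition bin_digit (v : R) p : bool := 2^-1 <= bin_residue v p.

Definition bin_partial (e : nat -> bool) p : R :=
  \sum_(q < p) (e q)%:R * 2^-1 ^+ q.+1.

Lemma bin_partialS e p :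
  bin_partial e p.+1 = bin_partial e p + (e p)%:R * 2^-1 ^+ p.+1.
Proof. by rewrite /bin_partial big_ord_recr. Qed.

Lemma bin_residue_itv v p : 0 <= v <= 1 -> 0 <= bin_residue v p <= 1.
Proof.
move=> v01; elim: p => //= p /andP[r0 r1].
by have [h|h] := leP 2^-1 (bin_residue v p); apply/andP;
  rewrite ?mulr0n ?mulr1n; split; lra.
Qed.

Lemma bin_partial_digit v p :
  v - bin_partial (bin_digit v) p = bin_residue v p * 2^-1 ^+ p.
Proof.
elim: p => [|p IH]; first by rewrite /bin_partial big_ord0 subr0 expr0 mulr1.
rewrite bin_partialS opprD addrA IH /=.
by rewrite /bin_digit exprS; field.
Qed.

Lemma bin_partial_ge0 e p : 0 <= bin_partial e p.
Proof. by apply: sumr_ge0 => q _; rewrite mulr_ge0 ?exprn_ge0. Qed.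

Lemma bin_partialD e p r : bin_partial e p <= bin_partial e (p + r)%N <=
  bin_partial e p + 2^-1 ^+ p - 2^-1 ^+ (p + r).
Proof.
elim: r => [|r /andP[h1 h2]]; first by rewrite addn0 addrK lexx.
rewrite addnS bin_partialS exprS.
have x0 : 0 <= (2^-1 : R) ^+ (p + r) by rewrite exprn_ge0.
move: (_ ^+ (p + r)) x0 h2 => x x0 h2.
by case: (e _); rewrite ?mulr0n ?mulr1n; apply/andP; split; lra.
Qed.

Lemma bin_partial_le1 e p : bin_partial e p <= 1.
Proof.
have /andP[_] := bin_partialD e 0 p.
rewrite add0n {2}/bin_partial big_ord0 add0r expr0 => /le_trans; apply.
by rewrite gerBl exprn_ge0.
Qed.

Definition bin_value (e : nat -> bool) : R := limn (bin_partial e).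

Lemma bin_partial_cvg e : bin_partial e @ \oo --> bin_value e.
Proof.
apply: nondecreasing_is_cvgn.
  move=> p q pq; have /andP[h _] := bin_partialD e p (q - p).
  by rewrite subnKC in h.
by exists 1 => _ [p _ <-]; exact: bin_partial_le1.
Qed.

Lemma bin_value_itv e : 0 <= bin_value e <= 1.
Proof.
apply/andP; split.
  apply: (cvgr_to_ge (@bin_partial_cvg e)).
  by apply: nearW => p; exact: bin_partial_ge0.
apply: (cvgr_to_le (@bin_partial_cvg e)).
by apply: nearW => p; exact: bin_partial_le1.
Qed.

Lemma bin_value_partial e p : `|bin_value e - bin_partial e p| <= 2^-1 ^+ p.
Proof.
have h r : bin_partial e p <= bin_partial e (p + r)%N <=
    bin_partial e p + 2^-1 ^+ p.
  have /andP[-> /le_trans] := bin_partialD e p r; apply.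
  by rewrite gerBl exprn_ge0.
have near_h (P : nat -> Prop) : (forall r, P (p + r)%N) -> \forall q \near \oo, P q.
  by move=> hP; exists p => // q /= pq; rewrite -(subnKC pq).
rewrite ler_distl; apply/andP; split.
  apply: (cvgr_to_ge (@bin_partial_cvg e)); apply: near_h => r.
  by have /andP[h1 _] := h r; apply: le_trans h1; rewrite gerBl exprn_ge0.
apply: (cvgr_to_le (@bin_partial_cvg e)); apply: near_h => r.
by have /andP[_ ] := h r.
Qed.

End BinaryDigits.

Section RealModel.
Variables (R : realType) (Y : Type) (Lam : bounded_mean R Y).
Variable y : nat -> Y -> R.
Hypothesis y01 : forall i t, 0 <= y i t <= 1.

Let c := Lam (fun=> 1).

Let bit (n : nat) (t : Y) : bool :=
  if choice.unpickle n is Some (i, q) then bin_digit (y i t) q else false.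

Let digits (e : nat -> bool) (i : nat) : nat -> bool :=
  fun q => e (choice.pickle (i, q)).

(** With each [y i] truncated to [p] digits, a product depends on finitely many
    bits and [bit_model] applies; the truncation changes either side by at most
    [size s * 2^-p] times the total mass. *)
Lemma real_model : exists x : nat -> R -> R,
  [/\ forall i, measurable_fun setT (x i),
      forall i u, 0 <= x i u <= 1
    & forall s : seq nat,
        has_integral (@lebesgue_measure R) `[0, c[
          (fun u => \prod_(i <- s) x i u)
          (Lam (fun t => \prod_(i <- s) y i t))].
Proof.
have c_ge0 : 0 <= c.
  by apply: bm_ge0 => [|t]; [exact: bounded_real_cst|exact: ler01].
have mI : measurable (`[0, c[%classic : set (measurableTypeR R)).
  exact: measurable_itv.
have muI : @lebesgue_measure R `[0, c[%classic = c%:E.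
  rewrite lebesgue_measure_itv /= lte_fin; case: ltP => h.
    by rewrite oppr0 adde0.
  by congr (_%:E); apply/eqP; rewrite eq_le h c_ge0.
pose x i u := bin_value R (digits (bit_at Lam bit ^~ u) i).
have mx i : measurable_fun setT (x i).
  apply: (measurable_fun_cvg (h := fun p u =>
      bin_partial R (digits (bit_at Lam bit ^~ u) i) p)) => [p|u _].
    apply: measurable_sum => q; apply: measurable_funM => //.
    apply: (measurableT_comp (f := fun b : bool => b%:R : R)) => //.
    exact: measurable_bit_at.
  exact: bin_partial_cvg.
have x01 i u : 0 <= x i u <= 1 by exact: bin_value_itv.
exists x; split => // s.
have prod01 (f : nat -> R) : (forall i, 0 <= f i <= 1) ->
    0 <= \prod_(i <- s) f i <= 1.
  move=> f01; rewrite prodr_ge0 => [|i _]; last by case/andP: (f01 i).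
  by rewrite prodr_ile1 // => i _; exact: f01.
have [v hv] : exists v, has_integral (@lebesgue_measure R) `[0, c[
    (fun u => \prod_(i <- s) x i u) v.
  apply: (@bounded_has_integral _ _ _ _ _ mI _ 1).
  - by have := ltry c; rewrite -muI.
  - by apply: measurable_prod => i _; apply: measurable_funTS; exact: mx.
  - by move=> u _; have /andP[h0 h1] := prod01 (x^~ u) (x01^~ u); rewrite ger0_norm.
suff <- : v = Lam (fun t => \prod_(i <- s) y i t) by [].
pose G p (e : nat -> bool) := \prod_(i <- s) bin_partial R (digits e i) p.
have bp01 e i p : 0 <= bin_partial R (digits e i) p <= 1.
  by rewrite bin_partial_ge0 bin_partial_le1.
have G01 p e : 0 <= G p e <= 1 by exact: prod01.
have hG p : has_integral (@lebesgue_measure R) `[0, c[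
    (fun u => G p (bit_at Lam bit ^~ u)) (Lam (fun t => G p (bit^~ t))).
  pose N := (\max_(i <- s) \max_(q < p) (choice.pickle (i, nat_of_ord q)).+1)%N.
  apply: (bit_model Lam bit (n := N)) => e e' ee'.
  rewrite /G !big_seq; apply: eq_bigr => i i_s.
  apply: eq_bigr => q _; rewrite /digits ee' //.
  rewrite /N (big_rem i) //= leq_max; apply/orP; left.
  exact: (leq_bigmax (F := fun q : 'I_p => (choice.pickle (i, nat_of_ord q)).+1)).
apply/eqP; rewrite -subr_eq0 -normr_le0.
apply: (@le0_half_expr _ _ (2 * c * (size s)%:R)) => p.
pose e := (size s)%:R * 2^-1 ^+ p : R.
have bG : bounded_real (fun t => G p (bit^~ t)).
  by exists 1 => t; have /andP[h0 h1] := G01 p (bit^~ t); rewrite ger0_norm.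
have bY : bounded_real (fun t => \prod_(i <- s) y i t).
  by exists 1 => t; have /andP[h0 h1] := prod01 (y^~ t) (y01^~ t); rewrite ger0_norm.
have d1 : `|v - Lam (fun t => G p (bit^~ t))| <= e * c.
  have hB := has_integralB mI hv (hG p).
  have h1 := has_integral_cst mI e muI.
  have h2 := has_integral_cst mI (- e) muI.
  have D u : `|\prod_(i <- s) x i u - G p (bit_at Lam bit ^~ u)| <= e.
    by apply: ler_norm_prodB => // i; exact: bin_value_partial.
  rewrite ler_norml -mulNr; apply/andP; split.
    by apply: has_integral_le h2 hB => // u _; have := D u; rewrite ler_norml => /andP[].
  by apply: has_integral_le hB h1 => // u _; have := D u; rewrite ler_norml => /andP[].
have d2 : `|Lam (fun t => \prod_(i <- s) y i t) - Lam (fun t => G p (bit^~ t))| <= e * c.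
  have D t : `|\prod_(i <- s) y i t - G p (bit^~ t)| <= e.
    apply: ler_norm_prodB => // i.
    rewrite (_ : digits _ _ = bin_digit (y i t)); last first.
      by apply/funext => q; rewrite /digits /bit choice.pickleK.
    rewrite bin_partial_digit; have /andP[r0 r1] := bin_residue_itv p (y01 i t).
    by rewrite ger0_norm ?ler_piMl ?mulr_ge0 ?exprn_ge0.
  have ce : Lam (fun=> e) = e * c.
    by have := bmZ Lam e (bounded_real_cst Y (1 : R)); rewrite /= mulr1.
  rewrite -ce ler_distl -lerBlDr; apply/andP; split.
    rewrite -lerBrDr opprK.
    rewrite -bmD //; last exact: bounded_real_cst.
    apply: bm_le => //; first by apply: bounded_realD => //; exact: bounded_real_cst.
    by move=> t; have := D t; rewrite ler_distlC => /andP[].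
  rewrite lerBlDr -bmD //; last exact: bounded_real_cst.
  apply: bm_le => //; first by apply: bounded_realD => //; exact: bounded_real_cst.
  by move=> t; have := D t; rewrite ler_distl => /andP[].
rewrite (_ : _ * _ = e * c + e * c); last by rewrite /e; ring.
rewrite -(subrKA (Lam (fun t => G p (bit^~ t)))).
apply: le_trans (ler_normD _ _) _; apply: lerD => //.
by rewrite distrC.
Qed.

End RealModel.

(** * Limits of sample means *)
Section UltraMean.
Variables (R : realType) (Y : Type) (E : nat -> bounded_mean R Y) (c : R).
Hypothesis E1 : forall d, E d (fun=> 1) = c.

(** On a bounded function the means stay in a compact interval, so they converge
    along any ultrafilter that refines convergence to infinity. Such limits are
    linear and positive, and agree with the limits that already exist. *)
Lemma ultra_mean : exists Lam : bounded_mean R Y,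
  forall f l, bounded_real f -> E d f @[d --> \oo] --> l -> Lam f = l.
Proof.
have [U [UF sU]] := ultraFilterLemma (_ : ProperFilter \oo).
have Ele C f : (forall y, `|f y| <= C) -> forall d, `|E d f| <= C * c.
  move=> fC d; have bf : bounded_real f by exists C.
  have bC k : bounded_real (fun=> k : R) := bounded_real_cst Y k.
  have EC k : E d (fun=> k) = k * c.
    by have := bmZ (E d) k (bC 1); rewrite /= mulr1 E1.
  rewrite ler_norml -mulNr -!EC; apply/andP; split; apply: bm_le => // y.
    by have := fC y; rewrite ler_norml => /andP[].
  by have := fC y; rewrite ler_norml => /andP[].
have Ecvg f : bounded_real f -> cvg (E d f @[d --> U]).
  move=> [C fC].
  have : compact (`[- (C * c), C * c] : set R) by exact: segment_compact.
  move=> /(_ (E d f @[d --> U])) [].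
    by apply: nearW => d; rewrite /= in_itv /= -ler_norml; exact: Ele.
  move=> p [_ clp]; apply/cvg_ex; exists p => B nB.
  have [//|UB] := in_ultra_setVsetC [set d | B (E d f)] UF.
  by have [z [nBz Bz]] := clp (~` B) B UB nB.
have UP : ProperFilter U by exact: ultra_proper.
pose Lam f := lim (E d f @[d --> U]).
have LamE f l : E d f @[d --> U] --> l -> Lam f = l by move=> h; apply: cvg_lim.
have LD f g : bounded_real f -> bounded_real g ->
    Lam (fun y => f y + g y) = Lam f + Lam g.
  move=> bf bg; apply: LamE.
  under eq_fun do rewrite bmD //.
  by apply: cvgD; exact: Ecvg.
have LZ k f : bounded_real f -> Lam (fun y => k * f y) = k * Lam f.
  move=> bf; apply: LamE.
  under eq_fun do rewrite bmZ //.
  by apply: cvgM; [exact: cvg_cst|exact: Ecvg].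
have L0 f : bounded_real f -> (forall y, 0 <= f y) -> 0 <= Lam f.
  move=> bf f0; apply: limr_ge; first exact: Ecvg.
  by apply: nearW => d; exact: bm_ge0.
exists (BoundedMean LD LZ L0) => f l bf fl; apply: LamE.
by apply: cvg_trans fl; apply: cvg_app; exact: sU.
Qed.

End UltraMean.

Section SampleMean.
Variables (R : realType) (A : comPzRingType) (k : {rmorphism R -> A}).
Variables (L : positive_functional k) (b : nat -> A).
Hypothesis b01 : forall i, mult_01 L (b i).

Let sample := {d : nat & outcome d}.

Let sample_fun d (f : sample -> R) : R :=
  bern_mean b L 1 (fun w => f (existT _ d w)).

Let sample_funD d f g : bounded_real f -> bounded_real g ->
  sample_fun d (fun y => f y + g y) = sample_fun d f + sample_fun d g.
Proof. by move=> _ _; rewrite -big_split; apply: eq_bigr => w _; rewrite mulrDl. Qed.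

Let sample_funZ d c f : bounded_real f ->
  sample_fun d (fun y => c * f y) = c * sample_fun d f.
Proof.
by move=> _; rewrite /sample_fun /bern_mean mulr_sumr; apply: eq_bigr => w _; rewrite mulrA.
Qed.

Let sample_fun_ge0 d f : bounded_real f -> (forall y, 0 <= f y) ->
  0 <= sample_fun d f.
Proof.
move=> _ f0; apply: sumr_ge0 => w _; rewrite mulr_ge0 // mulr1.
exact/mult_ge0_pf/bern_weight_mult_ge0.
Qed.

Definition sample_mean d : bounded_mean R sample :=
  BoundedMean (@sample_funD d) (@sample_funZ d) (@sample_fun_ge0 d).

Lemma sample_mean1 d : sample_mean d (fun=> 1) = L 1.
Proof.
rewrite /= /sample_fun /bern_mean; under eq_bigr do rewrite mul1r mulr1.
by rewrite -pf_sum bern_weight_sum.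
Qed.

Definition sample_freq i (y : sample) : R := freq R (projT2 y) i.

Lemma sample_mean_prod (s : seq nat) :
  sample_mean d (fun y => \prod_(i <- s) sample_freq i y) @[d --> \oo] -->
  L (\prod_(i <- s) b i).
Proof.
apply/cvgrPdist_le => e e0; have [N hN] := bern_mean_prod b01 s 1 e0.
exists N => // d /= Nd; rewrite distrC; have := hN d Nd.
by rewrite mulr1.
Qed.

Lemma multiplier_model_nat : exists x : nat -> R -> R,
  [/\ forall i, measurable_fun setT (x i),
      forall i u, 0 <= x i u <= 1
    & forall s : seq nat,
        has_integral (@lebesgue_measure R) `[0, L 1[
          (fun u => \prod_(i <- s) x i u) (L (\prod_(i <- s) b i))].
Proof.
have [Lam LamE] := ultra_mean sample_mean1.
have f01 i y : 0 <= sample_freq i y <= 1 by rewrite freq_ge0 freq_le1.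
have prodE (s : seq nat) :
    Lam (fun y => \prod_(i <- s) sample_freq i y) = L (\prod_(i <- s) b i).
  apply: LamE; last exact: sample_mean_prod.
  exists 1 => y; rewrite ger0_norm; first by apply: prodr_ile1 => i _; exact: f01.
  by apply: prodr_ge0 => i _; case/andP: (f01 i y).
have [x [mx x01 hx]] := real_model Lam f01.
exists x; split => // s.
have -> : L 1 = Lam (fun=> 1).
  have := prodE [::]; rewrite big_nil => <-; congr (Lam _).
  by apply/funext => y; rewrite big_nil.
by rewrite -prodE.
Qed.

End SampleMean.

(** Only the moments of the multipliers are prescribed; genuine random variables
    with these moments replace a joint spectral resolution. The multiplier 1
    fills the codes that no index uses. *)
Lemma multiplier_model (R : realType) (A : comPzRingType) (k : {rmorphism R -> A})
    (L : positive_functional k) (J : countType) (b : J -> A) :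
  (forall j, mult_01 L (b j)) ->
  exists x : J -> R -> R,
  [/\ forall j, measurable_fun setT (x j),
      forall j u, 0 <= x j u <= 1
    & forall s : seq J,
        has_integral (@lebesgue_measure R) `[0, L 1[
          (fun u => \prod_(j <- s) x j u) (L (\prod_(j <- s) b j))].
Proof.
move=> b01; pose b' n := if choice.unpickle n is Some j then b j else 1.
have b'01 n : mult_01 L (b' n).
  by rewrite /b'; case: choice.unpickle => // ; exact: mult_01_1.
have [x [mx x01 hx]] := multiplier_model_nat b'01.
exists (fun j => x (choice.pickle j)); split => // s.
rewrite (_ : L (\prod_(j <- s) b j) = L (\prod_(i <- map choice.pickle s) b' i)); last first.
  by rewrite big_map; congr (L _); apply: eq_bigr => j _; rewrite /b' choice.pickleK.
rewrite (_ : (fun u => _) = fun u => \prod_(i <- map choice.pickle s) x i u); first exact: hx.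
by apply/funext => u; rewrite big_map.
Qed.

(** * Rational exponents *)

HB.instance Definition _ n := [Countable of nnvec rat n by <:].

Section RationalExponents.
Variable n : nat.
Implicit Types v : nnvec rat n.

Lemma nncoordD (K : numDomainType) (u v : nnvec K n) i :
  nncoord (u + v) i = nncoord u i + nncoord v i.
Proof. by rewrite /nncoord raddfD mxE. Qed.

Lemma nncoord0 (K : numDomainType) i : nncoord (0 : nnvec K n) i = 0.
Proof. by rewrite /nncoord raddf0 mxE. Qed.

Lemma nncoordMn (K : numDomainType) (v : nnvec K n) N i :
  nncoord (v *+ N) i = nncoord v i *+ N.
Proof. by elim: N => [|N IH]; rewrite ?mulr0n ?nncoord0 // !mulrS nncoordD IH. Qed.

Lemma nncoord_sum (K : numDomainType) J (r : seq J) (F : J -> nnvec K n) i :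
  nncoord (\sum_(j <- r) F j) i = \sum_(j <- r) nncoord (F j) i.
Proof.
by elim: r => [|j r IH]; rewrite ?big_nil ?nncoord0 // !big_cons nncoordD IH.
Qed.

Lemma nncoord_basis (K : numDomainType) j i :
  nncoord (nnbasis K j : nnvec K n) i = (i == j)%:R.
Proof. by rewrite /nncoord /= mxE. Qed.

Lemma nnvecP (K : numDomainType) (u v : nnvec K n) :
  (forall i, nncoord u i = nncoord v i) -> u = v.
Proof. by move=> uv; apply/val_inj/rowP. Qed.

(** This makes every monomial a square, hence a positive multiplier. *)
Lemma nnvec_half v : exists u, v = u + u.
Proof.
have h0 : @nnvec_pred rat n (\row_i (nncoord v i / 2)).
  by apply/forallP => i; rewrite mxE divr_ge0 ?nncoord_ge0.
exists (Sub _ h0); apply: nnvecP => i; rewrite nncoordD /nncoord SubK mxE.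
by rewrite -splitr.
Qed.

Lemma nnvec_clear_denominators v : exists N (c : 'I_n -> nat),
  (0 < N)%N /\ v *+ N = \sum_j nnbasis rat j *+ c j.
Proof.
pose N := (\prod_j `|denq (nncoord v j)|)%N.
have /choice[c cE] : forall j, exists c : nat, nncoord v j *+ N = c%:R.
  move=> j.
  exists (`|numq (nncoord v j)| * \prod_(i | i != j) `|denq (nncoord v i)|)%N.
  rewrite /N (bigD1 j) //= mulrnA natrM -[LHS]mulr_natr; congr (_ * _).
  rewrite -[LHS]mulr_natr; have d0 := denq_gt0 (nncoord v j).
  rewrite -[(`|denq _|)%:R]/((Posz `|denq (nncoord v j)|)%:~R) gtz0_abs //.
  rewrite -numqE -[in RHS]/((Posz `|numq (nncoord v j)|)%:~R) gez0_abs //.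
  by rewrite numq_ge0 nncoord_ge0.
exists N, c; split.
  by rewrite /N prodn_gt0 // => j; rewrite absz_gt0 denq_eq0.
apply: nnvecP => i; rewrite nncoordMn cE nncoord_sum (bigD1 i) //= big1.
  by rewrite addr0 nncoordMn nncoord_basis eqxx.
by move=> j ji; rewrite nncoordMn nncoord_basis eq_sym (negbTE ji) mul0rn.
Qed.

End RationalExponents.

(** * The bounded multipliers of the moment functional *)

Section MomentAlgebra.
Variables (R : realType) (n m : nat).
Variables (A : comPzRingType) (k : {rmorphism R -> A}).
Variables (I : 'I_m -> {fset nnvec rat n}) (a : 'I_m -> nnvec rat n -> R).

(** [tau v] and [ma_s] stand for the monomial of exponent [v] and for the extra
    variable [s]. In the algebra of polynomials these are independent: the
    relation [s * w = 1] is imposed on the functional only. *)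
Record moment_algebra := MomentAlgebra {
  ma_pf :> positive_functional k;
  tau : nnvec rat n -> A;
  ma_s : A;
  tau0 : tau 0 = 1;
  tauD : forall u v, tau (u + v) = tau u * tau v;
  ma_poly := fun i => \sum_(xi <- I i) k (a i xi) * tau xi;
  ma_w := 1 + \sum_j tau (nnbasis rat j *+ 2) + \sum_i ma_poly i * ma_poly i;
  ma_sw : forall f, ma_pf (ma_s * ma_w * f) = ma_pf f;
  ma_poly_ge0 : forall i, mult_ge0 ma_pf (ma_poly i) }.

Variable L : moment_algebra.
Local Notation t := (tau L).
Local Notation s := (ma_s L).
Local Notation p := (ma_poly L).
Local Notation w := (ma_w L).

Lemma tau_sum J (r : seq J) (F : J -> nnvec rat n) :
  t (\sum_(j <- r) F j) = \prod_(j <- r) t (F j).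
Proof. by apply: (big_morph t); [exact: tauD|exact: tau0]. Qed.

Lemma tauMn v N : t (v *+ N) = t v ^+ N.
Proof.
by elim: N => [|N IH]; rewrite ?mulr0n ?tau0 ?expr0 // mulrS tauD IH exprS.
Qed.

Lemma tau_ge0 v : mult_ge0 L (t v).
Proof. by have [u ->] := nnvec_half v; rewrite tauD; exact: mult_ge0_sqr. Qed.

(** Under the functional [s] is [s * s * w], a sum of squares. *)
Lemma s_ge0 : mult_ge0 L s.
Proof.
move=> f; rewrite -(ma_sw L).
have -> : s * w * (s * (f * f)) = (s * s + \sum_j (s * t (nnbasis rat j)) *
    (s * t (nnbasis rat j)) + \sum_i (s * p i) * (s * p i)) * (f * f).
  have e1 : \sum_j (s * t (nnbasis rat j)) * (s * t (nnbasis rat j)) =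
      s * s * \sum_j t (nnbasis rat j *+ 2).
    by rewrite mulr_sumr; apply: eq_bigr => j _; rewrite tauMn expr2 mulrACA.
  have e2 : \sum_i (s * p i) * (s * p i) = s * s * \sum_i p i * p i.
    by rewrite mulr_sumr; apply: eq_bigr => i _; rewrite mulrACA.
  by rewrite e1 e2 /ma_w; ring.
by do ![apply: mult_ge0D|apply: mult_ge0_sum => ? _]; exact: mult_ge0_sqr.
Qed.

(** Under the functional [1 - s * f] is [s * (w - f)]. *)
Lemma ma_w_le1 f : mult_ge0 L (s * (w - f)) -> mult_ge0 L (1 - s * f).
Proof.
move=> h g; rewrite mulrBl mul1r pfB -(ma_sw L (g * g)) -pfB -mulrBl -mulrBr.
exact: h.
Qed.

Let sqr_part_ge0 f : mult_ge0 L (s * (f * f)).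
Proof. exact/mult_ge0Msqr/s_ge0. Qed.

Lemma s_01 : mult_01 L s.
Proof.
split; first exact: s_ge0.
rewrite -[X in 1 - X]mulr1; apply: ma_w_le1.
have -> : s * (w - 1) = \sum_j s * (t (nnbasis rat j) * t (nnbasis rat j)) +
    \sum_i s * (p i * p i).
  rewrite -!mulr_sumr -mulrDr /ma_w; congr (_ * _).
  rewrite addrAC [1 + _ - 1]addrAC subrr add0r; congr (_ + _).
  by apply: eq_bigr => j _; rewrite tauMn expr2.
by apply: mult_ge0D; apply: mult_ge0_sum => ? _; exact: sqr_part_ge0.
Qed.

Let half_sqr f : 1 - f + f * f =
  (1 - k 2^-1 * f) * (1 - k 2^-1 * f) + k (3 / 4) * (f * f).
Proof.
have h2 : k 2^-1 + k 2^-1 = 1.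
  by rewrite -rmorphD -(rmorph1 k); congr (k _); field.
have h4 : k 2^-1 * k 2^-1 + k (3 / 4) = 1.
  by rewrite -rmorphM -rmorphD -(rmorph1 k); congr (k _); field.
transitivity (1 - (k 2^-1 + k 2^-1) * f + (k 2^-1 * k 2^-1 + k (3 / 4)) * (f * f)).
  by rewrite h2 h4 !mul1r.
by ring.
Qed.

(** A square in [w] bounds its root, as [1 - f + f * f] is a sum of squares. *)
Let sqr_le1 f r : w = 1 + f * f + r -> mult_ge0 L (s * r) ->
  mult_ge0 L (1 - s * f).
Proof.
move=> wE hr; apply: ma_w_le1.
have -> : s * (w - f) = s * ((1 - k 2^-1 * f) * (1 - k 2^-1 * f)) +
    k (3 / 4) * (s * (f * f)) + s * r.
  rewrite wE (_ : 1 + f * f + r - f = (1 - f + f * f) + r); last by ring.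
  by rewrite half_sqr; ring.
apply: mult_ge0D => //; apply: mult_ge0D; first exact: sqr_part_ge0.
by apply: mult_ge0Z; [lra|exact: sqr_part_ge0].
Qed.

Lemma tau_basis_01 j : mult_01 L (s * t (nnbasis rat j)).
Proof.
split; first by rewrite mulrC; apply: mult_ge0M; [exact: tau_ge0|exact: s_01].
apply: (@sqr_le1 _ (\sum_(i | i != j) t (nnbasis rat i *+ 2) + \sum_i p i * p i)).
  by rewrite /ma_w (bigD1 j) //= tauMn expr2 -!addrA.
rewrite mulrDr !mulr_sumr.
apply: mult_ge0D; apply: mult_ge0_sum => i _; last exact: sqr_part_ge0.
by rewrite tauMn expr2; exact: sqr_part_ge0.
Qed.

Lemma poly_01 i : mult_01 L (s * p i).
Proof.
split; first by rewrite mulrC; apply: mult_ge0M; [exact: ma_poly_ge0|exact: s_01].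
apply: (@sqr_le1 _ (\sum_j t (nnbasis rat j *+ 2) + \sum_(l | l != i) p l * p l)).
  have pE : \sum_l p l * p l = p i * p i + \sum_(l | l != i) p l * p l.
    by rewrite (bigD1 i).
  by rewrite /ma_w pE; ring.
rewrite mulrDr !mulr_sumr.
apply: mult_ge0D; apply: mult_ge0_sum => j _; last exact: sqr_part_ge0.
by rewrite tauMn expr2; exact: sqr_part_ge0.
Qed.

(** A power of [s] makes every fractional monomial a bounded multiplier:
    clearing denominators reduces this to the coordinates. *)
Lemma tau_01 v : exists b, mult_01 L (t v * s ^+ b).
Proof.
have [N [c [N0 vN]]] := nnvec_clear_denominators v.
exists (\sum_j c j)%N; apply: (mult_01_root N0).
  by apply: mult_ge0M; [exact: tau_ge0|apply: mult_01X; exact: s_01].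
have -> : (t v * s ^+ (\sum_j c j)) ^+ N =
    (\prod_j (s * t (nnbasis rat j)) ^+ c j) * s ^+ ((\sum_j c j) * N.-1).
  rewrite exprMn -tauMn vN tau_sum -exprM.
  under [in RHS]eq_bigr do rewrite exprMn -tauMn mulrC.
  rewrite big_split /= -mulrA prodrXr -exprD.
  by rewrite -[in LHS](prednK N0) mulnS.
apply: mult_01M; last by apply: mult_01X; exact: s_01.
by apply: mult_01_prod => j _; apply: mult_01X; exact: tau_basis_01.
Qed.

End MomentAlgebra.

(** * Topology and Borel sets of the orthant *)

Lemma measurable_continuous_borel (R : realType) (T : ptopologicalType)
    (f : T -> R) : continuous f -> measurable_fun setT (f : borel T -> R).
Proof.
move=> /continuousP cf; apply: (measurability _ (RGenOpens.measurableE R)).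
move=> _ [_ [a [b ->] <-]]; rewrite setTI; apply: sub_sigma_algebra.
exact/cf/interval_open.
Qed.

Section Orthant.
Variables (R : realType) (n : nat).
Local Notation V := (nnvec R n).

Lemma nnvec_ballE (x y : V) e :
  ball x e y <-> 0 < e /\ forall i, `|nncoord x i - nncoord y i| < e.
Proof.
rewrite /ball /= /initial_ball /ball /= /mx_ball; split=> -[e0 h]; split => // i.
  by have := h 0 i; rewrite -ball_normE.
by move=> j; rewrite -ball_normE (ord1 i); exact: h.
Qed.

Lemma continuous_nnvecP (f : V -> R) :
  (forall t e, 0 < e -> exists2 r, 0 < r & forall u,
     (forall i, `|nncoord t i - nncoord u i| < r) -> `|f t - f u| < e) ->
  continuous f.
Proof.
move=> h t U /nbhs_ballP[e /= e0 eU]; have [r r0 hr] := h t e e0.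
suff : nbhs t (f @^-1` U) by [].
apply/nbhs_ballP; exists r => // u /nnvec_ballE[_ tu]; apply: eU.
by rewrite -ball_normE; exact: hr.
Qed.

Lemma powR_continuous_ge0 (a x : R) : 0 <= a -> 0 <= x -> forall e, 0 < e ->
  exists2 r, 0 < r & forall y, 0 <= y -> `|x - y| < r -> `|x `^ a - y `^ a| < e.
Proof.
move=> a0 x0 e e0.
have [->|a_neq0] := eqVneq a 0.
  by exists 1 => // y _ _; rewrite !powRr0 subrr normr0.
have a_gt0 : 0 < a by rewrite lt_def a_neq0.
have [->|x_neq0] := eqVneq x 0.
  exists (e `^ a^-1) => [|y y0]; first exact: powR_gt0.
  rewrite sub0r normrN ger0_norm // powR0 // sub0r normrN.
  rewrite ger0_norm ?powR_ge0 // => ye.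
  have := gt0_ltr_powR a_gt0; move=> /(_ y (e `^ a^-1)).
  rewrite -powRrM mulVf // powRr1 ?(ltW e0) //; apply => //.
  by rewrite nnegrE powR_ge0.
have x_gt0 : 0 < x by rewrite lt_def x_neq0.
have /differentiable_continuous : differentiable (fun z : R => z `^ a) x.
  by apply/derivable1_diffP; apply: derivable_powR; rewrite in_itv /= x_gt0.
move=> /cvgrPdist_lt/(_ e e0)/nbhs_ballP[r /= r0 hr].
by exists r => // y _ xy; apply: hr; rewrite -ball_normE.
Qed.

Lemma continuous_nncoord_powR i (a : R) : 0 <= a ->
  continuous (fun t : V => nncoord t i `^ a).
Proof.
move=> a0; apply: continuous_nnvecP => t e e0.
have [r r0 hr] := powR_continuous_ge0 a0 (nncoord_ge0 t i) e0.
by exists r => // u tu; apply: hr => //; exact: nncoord_ge0.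
Qed.

Lemma continuous_nnpow (v : V) : continuous (fun t : V => nnpow t v).
Proof.
rewrite /nnpow; elim: (index_enum _) => [|i r IH].
  rewrite (_ : (fun _ => _) = cst 1); first exact: cst_continuous.
  by apply/funext => t; rewrite big_nil.
rewrite (_ : (fun _ => _) = (fun t : V => nncoord t i `^ nncoord v i) \*
    (fun t : V => \prod_(j <- r) (nncoord t j `^ nncoord v j))).
  move=> t; have h := @continuous_nncoord_powR i _ (nncoord_ge0 v i) t.
  exact: cvgM h (IH t).
by apply/funext => t; rewrite big_cons.
Qed.

Lemma continuous_fracpoly (S : {fset nnvec rat n}) (c : nnvec rat n -> R) :
  continuous (fracpoly S c).
Proof.
rewrite (_ : fracpoly S c = fun t => \sum_(xi <- S) c xi * nnpow t (nnratr R xi)) //.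
elim: (enum_fset S) => [|xi r IH].
  rewrite (_ : (fun _ => _) = cst 0); first exact: cst_continuous.
  by apply/funext => t; rewrite big_nil.
rewrite (_ : (fun _ => _) = (fun t : V => c xi * nnpow t (nnratr R xi)) \+
    (fun t : V => \sum_(xi <- r) c xi * nnpow t (nnratr R xi))).
  move=> t; have h := @continuous_nnpow (nnratr R xi) t.
  exact: cvgD (cvgM (cvg_cst _) h) (IH t).
by apply/funext => t; rewrite big_cons.
Qed.

Lemma open_fracpoly_lt0 S c : open [set t : V | fracpoly S c t < 0].
Proof.
have /continuousP/(_ [set z : R | z < 0]) h := @continuous_fracpoly S c.
exact: h (@open_lt _ 0).
Qed.

Lemma measurable_nncoord i :
  measurable_fun setT (fun t : borel V => nncoord t i).
Proof.
apply: measurable_continuous_borel; apply: continuous_nnvecP => t e e0.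
by exists e => // u; exact.
Qed.

Lemma measurable_nnpow v : measurable_fun setT (fun t : borel V => nnpow t v).
Proof. by apply: measurable_continuous_borel; exact: continuous_nnpow. Qed.

Lemma measurable_fracpoly S c :
  measurable_fun setT (fracpoly S c : borel V -> R).
Proof. by apply: measurable_continuous_borel; exact: continuous_fracpoly. Qed.

Definition rat_box (cr : {ffun 'I_n -> rat} * rat) : set V :=
  [set t | forall i, `|nncoord t i - ratr (cr.1 i)| < ratr cr.2].

Lemma rat_box_base (U : set V) t : open U -> U t ->
  exists cr, rat_box cr t /\ rat_box cr `<=` U.
Proof.
move=> oU Ut; have : nbhs t U by exact: open_nbhs_nbhs.
move=> /nbhs_ballP[e /= e0 eU].
have e20 : 0 < e / 2 by rewrite divr_gt0.
have [r /[!in_itv]/= /andP[r0 re]] := rat_in_itvoo e20.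
have /choice[c cE] i : exists q : rat, `|nncoord t i - ratr q| < ratr r.
  have [|q] := @rat_in_itvoo R (nncoord t i - ratr r) (nncoord t i + ratr r).
    by rewrite ltrBlDr -addrA ltrDl addr_gt0.
  by rewrite in_itv /= => h; exists q; rewrite ltr_distlC.
exists ([ffun i => c i], r); split=> [i|u hu]; first by rewrite ffunE.
apply: eU; apply/nnvec_ballE; split => // i.
have := hu i; rewrite ffunE /= => hui.
rewrite -(subrKA (ratr (c i))); apply: le_lt_trans (ler_normD _ _) _.
by rewrite [_ (_ - nncoord u i)]distrC (splitr e) ltrD // (lt_trans _ re).
Qed.

Lemma open_rat_boxE (U : set V) : open U ->
  U = \bigcup_(cr in [set cr | rat_box cr `<=` U]) rat_box cr.
Proof.
move=> oU; apply/seteqP; split => [t Ut|t [cr crU tcr]]; last exact: crU.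
by have [cr [tcr crU]] := rat_box_base oU Ut; exists cr.
Qed.

Lemma measurable_rat_box_preimage d (T : measurableType d) (f : T -> V) cr :
  (forall i, measurable_fun setT (fun u => nncoord (f u) i)) ->
  measurable (f @^-1` rat_box cr).
Proof.
move=> mf; rewrite (_ : _ @^-1` _ = \bigcap_(i in [set: 'I_n])
    [set u | `|nncoord (f u) i - ratr (cr.1 i)| < ratr cr.2]); last first.
  by apply/seteqP; split => [u h i _|u h i]; exact: h.
apply: fin_bigcap_measurable => [|i _]; first exact: finite_finset.
rewrite -[X in measurable X]setTI.
apply: (measurable_fun_ltr (f := fun u => `|nncoord (f u) i - ratr (cr.1 i)|)
  (g := cst (ratr cr.2))) => //.
apply: measurableT_comp => //; exact: measurable_funB.
Qed.

(** Every open set is a union of the countably many rational boxes, and these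
    only involve the coordinates. *)
Lemma measurable_borel_nnvec d (T : measurableType d) (f : T -> V) :
  (forall i, measurable_fun setT (fun u => nncoord (f u) i)) ->
  measurable_fun setT (f : T -> borel V).
Proof.
move=> mf; apply: (@measurability _ _ T (borel V) setT f (@open V)) => //.
move=> _ [U oU <-]; rewrite setTI (open_rat_boxE oU) preimage_bigcup.
rewrite bigcup_mkcond; apply: countable_bigcupT_measurable => // cr.
by case: ifP => // _; exact: measurable_rat_box_preimage.
Qed.

Lemma measurable_rat_box cr : measurable (rat_box cr : set (borel V)).
Proof.
by have := @measurable_rat_box_preimage _ (borel V) id cr; apply; exact: measurable_nncoord.
Qed.

(** The complement of the support is covered by countably many null boxes. *)
Lemma msupportC_null (mu : {measure set (borel V) -> \bar R}) (C : set V) :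
  closed C -> msupport mu `<=` C -> mu (~` C) = 0.
Proof.
move=> cC suppC.
have oC : open (~` C) by rewrite openC.
pose N (cr : {ffun 'I_n -> rat} * rat) : set (borel V) :=
  if `[< mu (rat_box cr) = 0%E >] then rat_box cr else set0.
have mN cr : measurable (N cr).
  by rewrite /N; case: ifP => // _; exact: measurable_rat_box.
have N0 cr : mu (N cr) = 0%E.
  by rewrite /N; case: asboolP => // _; exact: measure0.
pose NN k := oapp N set0 (choice.unpickle k).
have : mu.-negligible (\bigcup_k NN k).
  apply: negligible_bigcup => k; rewrite /NN; case: choice.unpickle => [cr|] /=.
    by exists (N cr); split.
  exact: negligible_set0.
move=> nullN; apply/negligibleP.
  exact: sub_sigma_algebra.
apply: negligibleS nullN => t Ct.
have : ~ msupport mu t by move=> /suppC.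
rewrite /msupport /= => /existsNP[U /not_implyP[oU /not_implyP[Ut /negP U0]]].
have [cr [tcr crU]] := rat_box_base oU Ut.
exists (choice.pickle cr) => //; rewrite /NN choice.pickleK /= /N.
case: asboolP => // -[]; apply/eqP; rewrite -measure_le0.
apply: (@le_trans _ _ (mu U)); last by rewrite leNgt.
by apply: le_measure => //; rewrite inE; [exact: measurable_rat_box|exact: sub_sigma_algebra].
Qed.

End Orthant.

(** * Removing the weight [s] from an integral formula *)

Section Unweight.
Variables (R : realType) (n m : nat).
Variables (A : comPzRingType) (k : {rmorphism R -> A}).
Variables (I : 'I_m -> {fset nnvec rat n}) (a : 'I_m -> nnvec rat n -> R).
Variable L : moment_algebra k I a.
Local Notation s := (ma_s L).
Local Notation w := (ma_w L).

Lemma mult_ge0_w f : mult_ge0 L f -> mult_ge0 L (f * w).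
Proof.
move=> hf; rewrite /ma_w !mulrDr mulr1 !mulr_sumr.
apply: mult_ge0D; last by apply: mult_ge0_sum => i _; exact: mult_ge0Msqr.
apply: mult_ge0D => //; apply: mult_ge0_sum => j _.
by rewrite tauMn expr2; exact: mult_ge0Msqr.
Qed.

(** The numbers [L (f * (1 - s) ^+ K)] decrease, and since [s * w = 1] under
    [L] they are the terms of a series whose sum is at most [L (f * w)]. *)
Lemma unweight_remainder f K : mult_ge0 L f ->
  0 <= L (f * (1 - s) ^+ K) /\ K.+1%:R * L (f * (1 - s) ^+ K) <= L (f * w).
Proof.
move=> hf; have hs := mult_01_compl (s_01 L).
pose v i := L (f * (1 - s) ^+ i).
have vE i : v i = L (f * w * s * (1 - s) ^+ i).
  by rewrite /v -(ma_sw L); congr (L _); ring.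
have pos g i : mult_ge0 L g -> 0 <= L (g * (1 - s) ^+ i).
  by move=> hg; apply/mult_ge0_pf/mult_ge0M => //; exact: mult_01X.
split; first exact: pos.
have vS i : v i.+1 <= v i.
  rewrite -subr_ge0 -pfB (_ : _ - _ = (f * s) * (1 - s) ^+ i).
    by apply: pos; apply: mult_ge0M => //; exact: s_01.
  by rewrite exprS; ring.
have vm i j : (i <= j)%N -> v j <= v i.
  by move=> /subnKC <-; elim: (j - i)%N => [|r IH]; rewrite ?addn0 // addnS (le_trans (vS _)).
have tot N : \sum_(i < N) v i = L (f * w) - L (f * w * (1 - s) ^+ N).
  rewrite -pfB; elim: N => [|N IH]; first by rewrite big_ord0 mulr1 subrr pf0.
  by rewrite big_ord_recr /= IH vE -pfD; congr (L _); rewrite exprS; ring.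
apply: (@le_trans _ _ (\sum_(i < K.+1) v i)).
  rewrite mulr_natl -[in X in X <= _](card_ord K.+1) -sumr_const.
  by apply: ler_sum => i _; apply: vm; rewrite -ltnS.
by rewrite tot lerBlDr lerDl; apply: pos; exact: mult_ge0_w.
Qed.

Context d (T : measurableType d) (mu : {measure set T -> \bar R}) (D : set T).
Hypothesis mD : measurable D.
Variables (y h : T -> R) (f : A).
Hypothesis y01 : forall u, D u -> 0 < y u <= 1.
Hypothesis h_ge0 : forall u, D u -> 0 <= h u.
Hypothesis mh : measurable_fun D h.
Hypothesis f_ge0 : mult_ge0 L f.
Hypothesis hs : forall i,
  has_integral mu D (fun u => h u * y u ^+ i.+1) (L (f * s ^+ i.+1)).

Let weighted i j : has_integral mu D (fun u => h u * y u ^+ j.+1 * (1 - y u) ^+ i)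
  (L (f * s ^+ j.+1 * (1 - s) ^+ i)).
Proof.
elim: i j => [|i IH] j.
  have -> : f * s ^+ j.+1 * (1 - s) ^+ 0 = f * s ^+ j.+1 by rewrite expr0 mulr1.
  apply: eq_has_integral (hs j) => // u _.
  by rewrite expr0 mulr1.
rewrite (_ : f * _ * _ = f * s ^+ j.+1 * (1 - s) ^+ i - f * s ^+ j.+2 * (1 - s) ^+ i).
  rewrite pfB; apply: eq_has_integral (has_integralB mD (IH j) (IH j.+1)) => // u _.
  by rewrite !exprS; ring.
by rewrite !exprS; ring.
Qed.

Let truncated K : has_integral mu D (fun u => h u * (1 - (1 - y u) ^+ K))
  (L f - L (f * (1 - s) ^+ K)).
Proof.
elim: K => [|K IH].
  have -> : L f - L (f * (1 - s) ^+ 0) = 0 by rewrite expr0 mulr1 subrr.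
  apply: eq_has_integral (has_integral0 mu D) => // u _.
  by rewrite expr0 subrr mulr0.
have := has_integralD mD IH (weighted K 0).
rewrite (_ : L f - _ + _ = L f - L (f * (1 - s) ^+ K.+1)).
  by apply: eq_has_integral => // u _; rewrite !exprS; ring.
rewrite -!pfB -pfD; congr (L _); rewrite !exprS; ring.
Qed.

(** The functions [h * (1 - (1 - y) ^ K)] only involve positive powers of [y]
    and increase to [h], as [y] is positive; their integrals differ from [L f]
    by the remainder just estimated. *)
Lemma unweight_has_integral : has_integral mu D h (L f).
Proof.
pose g K u := (h u * (1 - (1 - y u) ^+ K))%:E.
have mg K : measurable_fun D (g K).
  by have [/integrableP[+ _] _] := truncated K.
have y'01 u : D u -> 0 <= 1 - y u < 1.
  by move=> /y01 /andP[? ?]; apply/andP; split; lra.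
have g0 K u : D u -> (0 <= g K u)%E.
  move=> Du; rewrite lee_fin mulr_ge0 ?h_ge0 // subr_ge0.
  by have /andP[? ?] := y'01 _ Du; rewrite exprn_ile1 // ltW.
have gnd u : D u -> {homo g^~ u : p q / (p <= q)%N >-> (p <= q)%E}.
  move=> Du p q pq; rewrite lee_fin ler_wpM2l ?h_ge0 // lerD2l lerN2.
  by have /andP[? ?] := y'01 _ Du; rewrite ler_wiXn2l // ltW.
have limg u : D u -> g^~ u @ \oo --> (h u)%:E.
  move=> Du; apply: cvg_EFin; first exact: nearW.
  rewrite -[X in _ --> X]mulr1 -[X in _ * X]subr0.
  apply: cvgM; first exact: cvg_cst.
  apply: cvgB; first exact: cvg_cst.
  by apply: cvg_expr; have /andP[? ?] := y'01 _ Du; rewrite ger0_norm.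
have cv := cvg_monotone_convergence (mu := mu) mD mg g0 gnd.
have intg K : (\int[mu]_(u in D) g K u = (L f - L (f * (1 - s) ^+ K))%:E)%E.
  by have [_ ->] := truncated K.
have cvL : (\int[mu]_(u in D) g K u)%E @[K --> \oo] --> (L f)%:E.
  under eq_fun do rewrite intg.
  apply: cvg_EFin; first exact: nearW.
  rewrite -[X in _ --> X]subr0; apply: cvgB; first exact: cvg_cst.
  apply: (@squeeze_cvgr _ _ _ _ (cst 0) (fun K => L (f * w) * harmonic K)).
  - apply: nearW => K; have [v0 vK] := unweight_remainder K f_ge0.
    by rewrite v0 /= ler_pdivlMr ?ltr0n // mulrC.
  - exact: cvg_cst.
  - rewrite -[X in _ --> X](mulr0 (L (f * w))); apply: cvgM; first exact: cvg_cst.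
    exact: cvg_harmonic.
have intE : (\int[mu]_(u in D) (h u)%:E = (L f)%:E)%E.
  rewrite -(cvg_lim _ cvL) //; apply/esym; rewrite (cvg_lim _ cv) //.
  by apply: eq_integral => u; rewrite inE => Du; apply: cvg_lim => //; exact: limg.
split => //; apply/integrableP; split; first exact/measurable_EFinP.
under eq_integral => u; first rewrite inE => Du.
  rewrite /= ger0_norm ?h_ge0 //.
  over.
by rewrite intE ltry.
Qed.

End Unweight.

(** * Transfer of algebraic relations to a model of the multipliers *)

Section Transfer.
Variables (R : realType) (n m : nat).
Variables (A : comPzRingType) (k : {rmorphism R -> A}).
Variables (I : 'I_m -> {fset nnvec rat n}) (a : 'I_m -> nnvec rat n -> R).
Variable L : moment_algebra k I a.
Local Notation t := (tau L).
Local Notation s := (ma_s L).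
Local Notation p := (ma_poly L).
Local Notation w := (ma_w L).

Context d (T : measurableType d) (mu : {measure set T -> \bar R}) (D : set T).
Hypothesis mD : measurable D.
Variables (J : Type) (b : J -> A) (x : J -> T -> R).
Hypothesis mx : forall j, measurable_fun setT (x j).
Hypothesis hx : forall r : seq J,
  has_integral mu D (fun u => \prod_(j <- r) x j u) (L (\prod_(j <- r) b j)).

(** [f] is a polynomial in the multipliers and [g] the same polynomial in the
    random variables that model them. *)
Definition represents (f : A) (g : T -> R) := exists q : seq (R * seq J),
  f = \sum_(c <- q) k c.1 * \prod_(j <- c.2) b j /\
  forall u, g u = \sum_(c <- q) c.1 * \prod_(j <- c.2) x j u.

Lemma represents_var j : represents (b j) (x j).
Proof.
exists [:: (1, [:: j])]; split => [|u]; rewrite big_seq1 /= big_seq1.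
  by rewrite rmorph1 mul1r.
by rewrite mul1r.
Qed.

Lemma represents_cst c : represents (k c) (fun=> c).
Proof.
by exists [:: (c, [::])]; split => [|u]; rewrite big_seq1 big_nil mulr1.
Qed.

Lemma representsD f g f' g' : represents f g -> represents f' g' ->
  represents (f + f') (fun u => g u + g' u).
Proof.
move=> [q [-> gE]] [q' [-> g'E]]; exists (q ++ q'); rewrite big_cat; split => // u.
by rewrite big_cat gE g'E.
Qed.

Lemma representsM f g f' g' : represents f g -> represents f' g' ->
  represents (f * f') (fun u => g u * g' u).
Proof.
move=> [q [-> gE]] [q' [-> g'E]].
exists [seq (c.1 * c'.1, c.2 ++ c'.2) | c <- q, c' <- q']; split => [|u].
  rewrite big_allpairs_dep big_distrlr /=; apply: eq_bigr => c _.
  by apply: eq_bigr => c' _; rewrite big_cat rmorphM mulrACA.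
rewrite gE g'E big_allpairs_dep big_distrlr /=; apply: eq_bigr => c _.
by apply: eq_bigr => c' _; rewrite big_cat mulrACA.
Qed.

Lemma representsX f g i : represents f g -> represents (f ^+ i) (fun u => g u ^+ i).
Proof.
move=> h; elim: i => [|i IH].
  by have [q [qE gE]] := represents_cst 1; exists q; split; rewrite ?expr0 -?qE ?rmorph1.
have [q [qE gE]] := representsM h IH; exists q; split; rewrite ?exprS //.
by move=> u; rewrite exprS.
Qed.

Lemma represents_integral f g : represents f g -> has_integral mu D g (L f).
Proof.
move=> [q [-> gE]]; rewrite pf_sum.
under eq_bigr do rewrite pfZ.
apply: (@eq_has_integral _ _ _ _ _ mD
  (fun u => \sum_(c <- q) c.1 * \prod_(j <- c.2) x j u)); first by move=> u _.
by apply: has_integral_sum => // c; apply: has_integralZ.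
Qed.

Lemma represents_null f g : represents f g -> L (f * f) = 0 ->
  {ae mu, forall u, D u -> g u = 0}.
Proof.
move=> fg Lff; have [gi gI] := represents_integral (representsM fg fg).
have [gi1 _] := represents_integral fg.
have mg : measurable_fun D (fun u => (g u * g u)%:E) by have /integrableP[] := gi.
have : (\int[mu]_(u in D) `|(g u * g u)%:E| = 0)%E.
  rewrite -[RHS]/(0%:E) -Lff -gI; apply: eq_integral => u _.
  by rewrite gee0_abs // lee_fin -expr2 sqr_ge0.
move=> /(ae_eq_integral_abs mu mD mg); apply: filterS => u /= h Du.
by have /eqP := h Du; rewrite eqe mulf_eq0 orbb => /eqP.
Qed.

Variable js : J.
Hypothesis bs : b js = s.
Local Notation xs := (x js).

(** [h] is the function that an element [f] becomes where [s] does not vanish: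
    some [f * s ^+ r] is a polynomial in the multipliers. *)
Definition models (f : A) (h : T -> R) := exists r g,
  represents (f * s ^+ r) g /\ forall u, 0 < xs u -> g u = h u * xs u ^+ r.

Lemma represents_s r : represents (s ^+ r) (fun u => xs u ^+ r).
Proof. by apply: representsX; rewrite -bs; exact: represents_var. Qed.

Lemma models_represents f g : represents f g -> models f g.
Proof.
move=> fg; exists 0%N, g; split; first by rewrite expr0 mulr1.
by move=> u _; rewrite expr0 mulr1.
Qed.

Lemma models_s : models s xs.
Proof. by apply: models_represents; rewrite -bs; exact: represents_var. Qed.

Lemma models_cst c : models (k c) (fun=> c).
Proof. exact/models_represents/represents_cst. Qed.

Lemma models_var_div f r j : f * s ^+ r = b j ->
  models f (fun u => x j u / xs u ^+ r).
Proof.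
move=> fE; exists r, (x j); split; first by rewrite fE; exact: represents_var.
by move=> u xu; rewrite divfK // expf_eq0 gt_eqF // andbF.
Qed.

Lemma modelsM f h f' h' : models f h -> models f' h' ->
  models (f * f') (fun u => h u * h' u).
Proof.
move=> [r [g [fg gE]]] [r' [g' [fg' gE']]].
exists (r + r')%N, (fun u => g u * g' u); split.
  by rewrite exprD mulrACA; exact: representsM.
by move=> u xu; rewrite gE // gE' // exprD mulrACA.
Qed.

Lemma modelsD f h f' h' : models f h -> models f' h' ->
  models (f + f') (fun u => h u + h' u).
Proof.
move=> [r [g [fg gE]]] [r' [g' [fg' gE']]].
exists (r + r')%N, (fun u => g u * xs u ^+ r' + g' u * xs u ^+ r); split.
  rewrite (_ : _ * _ = f * s ^+ r * s ^+ r' + f' * s ^+ r' * s ^+ r).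
    by apply: representsD; apply: representsM => //; exact: represents_s.
  by rewrite exprD; ring.
by move=> u xu; rewrite gE // gE' // exprD; ring.
Qed.

Lemma modelsX f h i : models f h -> models (f ^+ i) (fun u => h u ^+ i).
Proof.
move=> fh; elim: i => [|i IH].
  have [r [g [fg gE]]] := models_cst 1; exists r, g; split.
    by rewrite expr0 -(rmorph1 k).
  by move=> u xu; rewrite expr0 gE.
have [r [g [fg gE]]] := modelsM fh IH; exists r, g; split; rewrite ?exprS //.
by move=> u xu; rewrite exprS gE.
Qed.

Lemma models_sum K (r : seq K) (F : K -> A) (h : K -> T -> R) :
  (forall i, models (F i) (h i)) ->
  models (\sum_(i <- r) F i) (fun u => \sum_(i <- r) h i u).
Proof.
move=> Fh; elim: r => [|i r IH].
  rewrite big_nil -(rmorph0 k); have [q [g [fg gE]]] := models_cst 0.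
  by exists q, g; split => // u xu; rewrite big_nil gE.
rewrite big_cons; have [q [g [fg gE]]] := modelsD (Fh i) IH.
by exists q, g; split => // u xu; rewrite big_cons gE.
Qed.

Lemma models_prod K (r : seq K) (F : K -> A) (h : K -> T -> R) :
  (forall i, models (F i) (h i)) ->
  models (\prod_(i <- r) F i) (fun u => \prod_(i <- r) h i u).
Proof.
move=> Fh; elim: r => [|i r IH].
  rewrite big_nil -(rmorph1 k); have [q [g [fg gE]]] := models_cst 1.
  by exists q, g; split => // u xu; rewrite big_nil gE.
rewrite big_cons; have [q [g [fg gE]]] := modelsM (Fh i) IH.
by exists q, g; split => // u xu; rewrite big_cons gE.
Qed.

(** The difference of the two elements, times a power of [s], is a polynomial in
    the multipliers whose square is null under [L]; so its model is null in mean
    square. *)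
Lemma models_ae_unique f h f' h' : models f h -> models f' h' ->
  (forall e, L (f * e) = L (f' * e)) ->
  {ae mu, forall u, D u -> 0 < xs u -> h u = h' u}.
Proof.
move=> fh fh' ff'.
have [r [g [fg gE]]] := modelsD fh (modelsM (models_cst (-1)) fh').
have : {ae mu, forall u, D u -> g u = 0}.
  apply: (represents_null fg).
  have -> : (f + k (-1) * f') * s ^+ r * ((f + k (-1) * f') * s ^+ r) =
    f * (s ^+ r * ((f + k (-1) * f') * s ^+ r)) -
    f' * (s ^+ r * ((f + k (-1) * f') * s ^+ r)).
    by rewrite rmorphN1; ring.
  by rewrite pfB ff' subrr.
apply: filterS => u /= gu Du xu; have := gE u xu; rewrite gu // => /esym/eqP.
rewrite mulf_eq0 expf_eq0 (gt_eqF xu) andbF orbF mulN1r subr_eq0.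
by move=> /eqP.
Qed.

Hypothesis xs01 : forall u, 0 <= xs u <= 1.

Let D1 := D `&` [set u | 0 < xs u].

Lemma measurable_pos_part : measurable D1.
Proof.
apply: measurableI => //; rewrite -[X in measurable X]setTI.
exact: (measurable_fun_ltr (f := cst 0)).
Qed.

Lemma has_integral_pos_part g v : (forall u, D u -> ~ 0 < xs u -> g u = 0) ->
  has_integral mu D g v -> has_integral mu D1 g v.
Proof.
move=> g0 [gi gI]; split.
  by apply: integrableS gi => //; [exact: measurable_pos_part|exact: subIsetl].
rewrite -gI /D1 integral_mkcondr; apply: eq_integral => u; rewrite inE => Du.
rewrite patchE; case: ifPn => //; rewrite notin_setE /= => xu.
by rewrite g0.
Qed.

(** Integrals are known for polynomials in the multipliers, that is, after
    multiplication by a large power of [s]. *)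
Lemma models_integral f h : models f h -> mult_ge0 L f ->
  (forall u, D1 u -> 0 <= h u) -> measurable_fun D1 h ->
  has_integral mu D1 h (L f).
Proof.
move=> [r [g [fg gE]]] f0 h0 mh.
have xs_D1 u : D1 u -> 0 < xs u <= 1.
  by move=> [_ /= xu]; rewrite xu; have /andP[_] := xs01 u.
have mxs : measurable_fun D1 xs by exact: measurable_funTS.
(* descending induction on the power i of s: above r the element is a
   polynomial in the multipliers, and the weight is removed below *)
suff main j i : (r < i + j)%N ->
    has_integral mu D1 (fun u => h u * xs u ^+ i) (L (f * s ^+ i)).
  have := main r.+1 0%N (leqnn r.+1); rewrite expr0 mulr1.
  apply: eq_has_integral; first exact: measurable_pos_part.
  by move=> u _; rewrite expr0 mulr1.
elim: j i => [|j IH] i ri; last first.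
  apply: (@unweight_has_integral _ _ _ _ _ _ _ L _ _ _ _ measurable_pos_part xs) => //.
  - by move=> u Du; rewrite mulr_ge0 ?h0 // exprn_ge0 //; have /andP[] := xs01 u.
  - by apply: measurable_funM => //; exact: measurable_funX.
  - by apply: mult_ge0M => //; apply: mult_01X; exact: s_01.
  - move=> l; rewrite -mulrA -exprD.
    apply: eq_has_integral (IH (i + l.+1)%N _); first exact: measurable_pos_part.
      by move=> u _; rewrite exprD mulrA.
    by move: ri; clear; lia.
have [l il] : exists l, i = (r + l.+1)%N.
  by exists (i - r).-1; rewrite addn0 in ri; lia.
have gl := represents_integral (representsM fg (represents_s l.+1)).
rewrite il exprD mulrA; apply: eq_has_integral (has_integral_pos_part _ gl).
- exact: measurable_pos_part.
- by move=> u [_ xu]; rewrite exprD mulrA gE.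
- move=> u _ /negP; rewrite -leNgt => xu; have /andP[xu0 _] := xs01 u.
  by rewrite (_ : xs u = 0) ?expr0n ?mulr0 //; apply/eqP; rewrite eq_le xu xu0.
Qed.

End Transfer.

(** * The measure on the orthant *)
Section PushRestriction.
Context d d' (T : measurableType d) (T' : measurableType d') (R : realType).
Variables (mu : {measure set T -> \bar R}) (D : set T) (f : T -> T').
Hypotheses (mD : measurable D) (mf : measurable_fun setT f).

Definition push_restr : {measure set T' -> \bar R} :=
  measure_function_pushforward__canonical__measure_function_Measure
    (mrestr mu mD) mf.

Lemma push_restrE B : push_restr B = mu (f @^-1` B `&` D).
Proof. by []. Qed.

Lemma ge0_integral_push_restr (g : T' -> \bar R) : measurable_fun setT g ->
  (forall y, 0 <= g y)%E ->
  (\int[push_restr]_y g y = \int[mu]_(x in D) g (f x))%E.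
Proof.
move=> mg g0; rewrite /push_restr.
rewrite (ge0_integral_pushforward mf (mrestr mu mD)) //.
rewrite preimage_setT.
have mgf : measurable_fun setT (g \o f) by exact: measurableT_comp.
rewrite (@ge0_negligible_integral _ _ _ _ _ (~` D)) //; last 3 first.
- exact: measurableC.
- by move=> x _; exact: g0.
- by apply: (etrans _ (measure0 mu)); rewrite -(setICl D).
rewrite setTD setCK; apply: eq_measure_integral => B mB BD.
by apply: (congr1 mu); rewrite setIidl.
Qed.

Lemma has_integral_push_restr (g : T' -> R) h v : measurable_fun setT g ->
  (forall y, 0 <= g y) -> {ae mu, forall x, D x -> g (f x) = h x} ->
  has_integral mu D h v -> has_integral push_restr setT g v.
Proof.
move=> mg g0 gh [hi hI].
have mgE : measurable_fun setT (EFin \o g) by exact/measurable_EFinP.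
have intE : (\int[push_restr]_y (g y)%:E = v%:E)%E.
  rewrite ge0_integral_push_restr // -hI; apply: ae_eq_integral => //.
  - by apply: measurable_funTS; exact: (measurableT_comp mgE mf).
  - by case/integrableP: hi.
  - by apply: filterS gh => x gfx Dx; rewrite gfx.
split => //; apply/integrableP; split => //.
under eq_integral => y _ do rewrite /= ger0_norm ?g0 //.
by rewrite intE ltry.
Qed.

End PushRestriction.

Lemma ae_countable d (T : measurableType d) (R : realType)
    (mu : {measure set T -> \bar R}) (J : countType) (P : J -> T -> Prop) :
  (forall j, {ae mu, forall x, P j x}) -> {ae mu, forall x, forall j, P j x}.
Proof.
move=> h; have : {ae mu, forall x, forall i : nat,
    if choice.unpickle i is Some j then P j x else True}.
  apply: ae_foralln => i; case: choice.unpickle => [j|]; first exact: h.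
  exact: aeW.
by apply: filterS => x hx j; have := hx (choice.pickle j); rewrite choice.pickleK.
Qed.

Section Theta.
Variables (R : realType) (n m : nat).
Variables (I : 'I_m -> {fset nnvec rat n}) (a : 'I_m -> nnvec rat n -> R).

(** The value that the relation [s * w = 1] forces on [s] at the point [t]. *)
Definition theta (t : nnvec R n) : R :=
  (1 + \sum_(j < n) nncoord t j ^+ 2 + \sum_(i < m) fracpoly (I i) (a i) t ^+ 2)^-1.

Let theta_den_ge1 t : 1 <=
  1 + \sum_(j < n) nncoord t j ^+ 2 + \sum_(i < m) fracpoly (I i) (a i) t ^+ 2.
Proof.
by rewrite -addrA lerDl addr_ge0 // sumr_ge0 // => i _; rewrite sqr_ge0.
Qed.

Lemma theta_gt0 t : 0 < theta t.
Proof. by rewrite invr_gt0 (lt_le_trans ltr01 (theta_den_ge1 t)). Qed.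

Lemma theta_le1 t : theta t <= 1.
Proof. by rewrite invf_le1 ?(lt_le_trans ltr01 (theta_den_ge1 t)). Qed.

Lemma thetaM t : theta t *
  (1 + \sum_(j < n) nncoord t j ^+ 2 + \sum_(i < m) fracpoly (I i) (a i) t ^+ 2) = 1.
Proof. by rewrite mulVf // gt_eqF // (lt_le_trans ltr01 (theta_den_ge1 t)). Qed.

Lemma measurable_invr_ge0 d (T : measurableType d) (f : T -> R) :
  measurable_fun setT f -> (forall u, 0 <= f u) ->
  measurable_fun setT (fun u => (f u)^-1).
Proof.
move=> mf f0; rewrite (_ : (fun u => _) = (fun y : R => y `^ (-1)) \o f).
  by apply: measurableT_comp => //; exact: measurable_powR.
by apply/funext => u; rewrite /= powR_inv1.
Qed.

Lemma measurable_theta : measurable_fun setT (theta : borel (nnvec R n) -> R).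
Proof.
apply: (@measurable_invr_ge0 _ (borel (nnvec R n)) (fun t => 1 +
    \sum_(j < n) nncoord t j ^+ 2 + \sum_(i < m) fracpoly (I i) (a i) t ^+ 2)).
  apply: measurable_funD; first apply: measurable_funD => //.
    by apply: measurable_sum => j; apply: measurable_funX; exact: measurable_nncoord.
  by apply: measurable_sum => i; apply: measurable_funX; exact: measurable_fracpoly.
by move=> t; rewrite (le_trans ler01 (theta_den_ge1 t)).
Qed.

Lemma nnpow_ge0 (t v : nnvec R n) : 0 <= nnpow t v.
Proof. by apply: prodr_ge0 => j _; exact: powR_ge0. Qed.

Lemma nnpow_clear_denominators (t : nnvec R n) (v : nnvec rat n) N (c : 'I_n -> nat) :
  v *+ N = \sum_j nnbasis rat j *+ c j ->
  nnpow t (nnratr R v) ^+ N = \prod_j nncoord t j ^+ c j.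
Proof.
move=> vN; rewrite /nnpow -prodrXl; apply: eq_bigr => j _.
rewrite -powR_mulrn ?powR_ge0 // -powRrM -powR_mulrn ?nncoord_ge0 //.
congr (_ `^ _); have := congr1 (fun u => nncoord u j) vN.
rewrite nncoordMn nncoord_sum (bigD1 j) //= big1 => [|i ij]; last first.
  by rewrite nncoordMn nncoord_basis eq_sym (negbTE ij) mul0rn.
rewrite addr0 nncoordMn nncoord_basis eqxx => vj.
by rewrite /nncoord SubK mxE -(ratr_nat R N) -rmorphM /= mulr_natr vj ratr_nat.
Qed.

End Theta.

Section MomentModel.
Variables (R : realType) (n m : nat).
Variables (A : comPzRingType) (k : {rmorphism R -> A}).
Variables (I : 'I_m -> {fset nnvec rat n}) (a : 'I_m -> nnvec rat n -> R).
Variable L : moment_algebra k I a.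
Local Notation t := (tau L).
Local Notation s := (ma_s L).
Local Notation p := (ma_poly L).
Local Notation w := (ma_w L).

(** Where the model [x js] of [s] is positive, [X v] models the monomial of
    exponent [v] and the [X (nnbasis rat j)] are the coordinates of a random
    point [T u]. Relations of the algebra show that almost everywhere [X v] is
    the monomial at [T u] (clear denominators) and [x js] is [theta] at [T u].
    The elements [s * p i] are included among the modelled multipliers because
    their models are nonnegative, which makes [p i] nonnegative at [T u]. *)
Lemma moment_model : exists mu : {measure set (borel (nnvec R n)) -> \bar R},
  (forall v i, has_integral mu setT
     (fun y => nnpow y (nnratr R v) * theta I a y ^+ i) (L (t v * s ^+ i))) /\
  forall i, mu [set y | fracpoly (I i) (a i) y < 0] = 0%E.
Proof.
have /choice[be be01] := tau_01 L.
pose J := (nnvec rat n + 'I_m + unit)%type.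
pose b (j : J) : A := match j with
  | inl (inl v) => t v * s ^+ be v | inl (inr i) => s * p i | inr _ => s end.
have b01 j : mult_01 L (b j).
  by case: j => [[v|i]|[]]; [exact: be01|exact: poly_01|exact: s_01].
have [x [mx x01 hx]] := multiplier_model b01.
pose leb : {measure set (measurableTypeR R) -> \bar R} := @lebesgue_measure R.
pose I0 : set (measurableTypeR R) := `[0, L 1[%classic.
have mI0 : measurable I0 by exact: measurable_itv.
pose js : J := inr tt.
have bs : b js = s by [].
pose D := I0 `&` [set u | 0 < x js u].
have mD : measurable D by exact: measurable_pos_part.
pose X v u := x (inl (inl v)) u / x js u ^+ be v.
have mod_X v : models L b x js (t v) (X v) by exact: models_var_div.
have X_ge0 v u : 0 <= X v u.
  have /andP[h1 _] := x01 (inl (inl v)) u; have /andP[h2 _] := x01 js u.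
  by rewrite divr_ge0 // exprn_ge0.
have mX v : measurable_fun setT (X v).
  apply: measurable_funM => //; apply: measurable_invr_ge0.
    by apply: measurable_funX.
  by move=> u; rewrite exprn_ge0 //; have /andP[] := x01 js u.
have T0 u : @nnvec_pred R n (\row_j X (nnbasis rat j) u).
  by apply/forallP => j; rewrite mxE.
pose T u : nnvec R n := Sub _ (T0 u).
have TE u j : nncoord (T u) j = X (nnbasis rat j) u by rewrite /nncoord SubK mxE.
have mT : measurable_fun setT (T : measurableTypeR R -> borel (nnvec R n)).
  apply: measurable_borel_nnvec => j.
  rewrite (_ : (fun u => _) = X (nnbasis rat j)); first exact: mX.
  by apply/funext => u; rewrite TE.
have unique f h f' h' : models L b x js f h -> models L b x js f' h' ->
    (forall e, L (f * e) = L (f' * e)) ->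
    {ae leb, forall u, D u -> h u = h' u}.
  move=> fh fh' ff'; have := models_ae_unique mI0 hx bs fh fh' ff'.
  by apply: filterS => u /= hu [Iu xu]; exact: hu.
have powE : {ae leb, forall u v, D u -> nnpow (T u) (nnratr R v) = X v u}.
  apply: ae_countable => v.
  have [N [c [N0 vN]]] := nnvec_clear_denominators v.
  have mX2 := models_prod (index_enum 'I_n)
    (fun j => modelsX (c j) (mod_X (nnbasis rat j))).
  have := unique _ _ _ _ (modelsX N (mod_X v)) mX2.
  rewrite -tauMn vN tau_sum; under eq_bigr do rewrite tauMn.
  move=> /(_ (fun=> erefl)); apply: filterS => u /= hu Du.
  apply: (pexpIrn N0); rewrite ?nnegrE ?nnpow_ge0 //.
  rewrite (nnpow_clear_denominators _ vN) hu //.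
  by apply: eq_bigr => j _; rewrite TE.
pose F i u := \sum_(xi <- I i) a i xi * X xi u.
have mod_F i : models L b x js (p i) (F i).
  by apply: models_sum => // xi; apply: modelsM => //; exact: models_cst.
have F_ge0 : {ae leb, forall u i, D u -> 0 <= F i u}.
  apply: ae_countable => i.
  have mod_F' : models L b x js (p i) (fun u => x (inl (inr i)) u / x js u ^+ 1).
    by apply: models_var_div => //; rewrite expr1 mulrC.
  have := unique _ _ _ _ (mod_F i) mod_F' (fun=> erefl).
  apply: filterS => u /= hu Du; rewrite hu // divr_ge0 ?exprn_ge0 //.
    by have /andP[] := x01 (inl (inr i)) u.
  by have /andP[] := x01 js u.
have polyE : {ae leb, forall u i, D u -> fracpoly (I i) (a i) (T u) = F i u}.
  apply: filterS powE => u hu i Du.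
  by apply: eq_bigr => xi _; rewrite hu.
have thetaE : {ae leb, forall u, D u -> theta I a (T u) = x js u}.
  have mod_w : models L b x js (s * w) (fun u => x js u *
      (1 + \sum_j X (nnbasis rat j) u ^+ 2 + \sum_i F i u ^+ 2)).
    apply: modelsM; first exact: models_s.
    rewrite /ma_w -(rmorph1 k); apply: modelsD => //; first apply: modelsD => //.
    - exact: models_cst.
    - apply: models_sum => // j; rewrite tauMn; exact: modelsX.
    - apply: models_sum => // i; rewrite -expr2; exact: modelsX.
  have := unique _ _ _ _ mod_w (models_cst L b x js 1).
  move=> /(_ (fun e => _)) sw1; apply: filterS2 polyE (sw1 _) => [u hu hu' Du|e].
    have t1 := thetaM I a (T u); have /= h := hu' Du.
    transitivity (theta I a (T u) * (x js u *
        (1 + \sum_j X (nnbasis rat j) u ^+ 2 + \sum_i F i u ^+ 2))).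
      by rewrite h mulr1.
    rewrite mulrCA -[RHS]mulr1 -[X in _ = _ * X]t1; congr (_ * (_ * (_ + _ + _))).
      by apply: eq_bigr => j _; rewrite TE.
    by apply: eq_bigr => i _; rewrite hu.
  by rewrite rmorph1 mul1r ma_sw.
pose mu := push_restr leb mD mT.
exists mu; split.
  move=> v i.
  have mod_vi : models L b x js (t v * s ^+ i) (fun u => X v u * x js u ^+ i).
    by apply: modelsM => //; apply: modelsX => //; exact: models_s.
  have hD : has_integral leb D (fun u => X v u * x js u ^+ i) (L (t v * s ^+ i)).
    apply: (models_integral mI0 mx hx bs _ mod_vi).
    - by move=> u; exact: x01.
    - by apply: mult_ge0M; [exact: tau_ge0|apply: mult_01X; exact: s_01].
    - by move=> u _; rewrite mulr_ge0 // exprn_ge0 //; have /andP[] := x01 js u.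
    - apply: measurable_funTS.
      by apply: measurable_funM; [exact: mX|apply: measurable_funX; exact: mx].
  apply: has_integral_push_restr hD.
  - apply: measurable_funM; first exact: measurable_nnpow.
    by apply: measurable_funX; exact: measurable_theta.
  - by move=> y; rewrite mulr_ge0 ?nnpow_ge0 // exprn_ge0 // ltW // theta_gt0.
  - apply: filterS2 powE thetaE => u hu hu' Du.
    by rewrite hu // hu'.
move=> i; rewrite push_restrE.
have mZ : measurable ([set y | fracpoly (I i) (a i) y < 0] : set (borel (nnvec R n))).
  by apply: sub_sigma_algebra; exact: open_fracpoly_lt0.
apply/negligibleP.
  by apply: measurableI => //; rewrite -[X in measurable X]setTI; exact: (mT measurableT _ mZ).
have : {ae leb, forall u, ~ (T @^-1` [set y | fracpoly (I i) (a i) y < 0] `&` D) u}.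
  apply: filterS2 F_ge0 polyE => u h0 hE [/= hlt Du].
  by move: hlt; rewrite hE // ltNge h0.
by apply: negligibleS => u hu; apply.
Qed.

End MomentModel.

(** * The algebra of fractional polynomials in [(t, s)] *)

Section FractionalAlgebra.
Variables (R : realType) (n : nat).
Local Notation pt := (nnvec R n * {nonneg R})%type.
Local Notation mono := (@cmonomial R n).
Local Notation Q := (@Qtilde R n).

Lemma nncoord_ratr (v : nnvec rat n) j :
  nncoord (nnratr R v) j = ratr (nncoord v j).
Proof. by rewrite /nncoord SubK mxE. Qed.

Lemma nnpow0 (t : nnvec R n) : nnpow t (nnratr R 0) = 1.
Proof.
by rewrite /nnpow big1 // => j _; rewrite nncoord_ratr nncoord0 rmorph0 powRr0.
Qed.

Lemma nnpowD (t : nnvec R n) (u v : nnvec rat n) :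
  nnpow t (nnratr R (u + v)) = nnpow t (nnratr R u) * nnpow t (nnratr R v).
Proof.
rewrite /nnpow -big_split; apply: eq_bigr => j _.
rewrite !nncoord_ratr nncoordD rmorphD /=.
have u0 : 0 <= ratr (nncoord u j) :> R by rewrite ler0q nncoord_ge0.
have v0 : 0 <= ratr (nncoord v j) :> R by rewrite ler0q nncoord_ge0.
have [uv0|uv0] := eqVneq (ratr (nncoord u j) + ratr (nncoord v j) : R) 0.
  rewrite uv0; move/eqP: uv0; rewrite paddr_eq0 // => /andP[/eqP -> /eqP ->].
  by rewrite powRr0 mulr1.
by rewrite powRD // (negbTE uv0).
Qed.

Lemma Qtilde_lin c f g : Q f -> Q g -> Q (fun ts => c * f ts + g ts).
Proof.
move=> [S1 [c1 ->]] [S2 [c2 ->]].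
exists (S1 `|` S2)%fset, (fun ab => c * (if ab \in S1 then c1 ab else 0) +
  (if ab \in S2 then c2 ab else 0)); apply/funext => ts.
under [RHS]eq_bigr do rewrite mulrDl -mulrA.
rewrite big_split /= -mulr_sumr; congr (c * _ + _).
  rewrite -(big_fset_incl _ (fsubsetUl S1 S2)) => [|ab _ /negbTE ->]; last first.
    by rewrite mul0r.
  by rewrite !big_seq; apply: eq_bigr => ab ->.
rewrite -(big_fset_incl _ (fsubsetUr S1 S2)) => [|ab _ /negbTE ->]; last first.
  by rewrite mul0r.
by rewrite !big_seq; apply: eq_bigr => ab ->.
Qed.

Lemma Qtilde_mono ab : Q (mono ab).
Proof.
exists [fset ab]%fset, (fun=> 1); apply/funext => ts.
by rewrite big_seq_fset1 mul1r.
Qed.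

Lemma Qtilde_ind (P : (pt -> R[i]) -> Prop) :
  P (fun=> 0) -> (forall c f g, Q f -> Q g -> P f -> P g -> P (fun ts => c * f ts + g ts)) ->
  (forall ab, P (mono ab)) -> forall f, Q f -> P f.
Proof.
move=> P0 Plin Pmono f [S [c ->]].
suff h (r : seq (nnvec rat n * nat)) : Q (fun ts => \sum_(ab <- r) c ab * mono ab ts) /\
    P (fun ts => \sum_(ab <- r) c ab * mono ab ts) by exact: (h S).2.
elim: r => [|ab r [IHQ IHP]].
  have -> : (fun ts => \sum_(ab <- [::]) c ab * mono ab ts) = fun=> 0.
    by apply/funext => ts; rewrite big_nil.
  split => //; exists fset0, (fun=> 0); apply/funext => ts.
  by rewrite big_seq_fset0.
have -> : (fun ts => \sum_(ab <- ab :: r) c ab * mono ab ts) =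
    fun ts => c ab * mono ab ts + \sum_(ab <- r) c ab * mono ab ts.
  by apply/funext => ts; rewrite big_cons.
split; first by apply: Qtilde_lin => //; exact: Qtilde_mono.
by apply: Plin => //; exact: Qtilde_mono.
Qed.

Lemma Qtilde0 : Q (fun=> 0).
Proof. by exists fset0, (fun=> 0); apply/funext => ts; rewrite big_seq_fset0. Qed.

Lemma Qtilde_sum J (r : seq J) (c : J -> R[i]) (f : J -> pt -> R[i]) :
  (forall i, Q (f i)) -> Q (fun ts => \sum_(i <- r) c i * f i ts).
Proof.
move=> Qf; elim: r => [|i r IH].
  rewrite (_ : (fun ts => _) = fun=> 0); first exact: Qtilde0.
  by apply/funext => ts; rewrite big_nil.
rewrite (_ : (fun ts => _) = fun ts => c i * f i ts + \sum_(j <- r) c j * f j ts).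
  exact: Qtilde_lin.
by apply/funext => ts; rewrite big_cons.
Qed.

Lemma mono1 ts : mono (0, 0%N) ts = 1.
Proof. by rewrite /cmonomial /= nnpow0 mul1r. Qed.

Lemma monoM ab ab' ts : mono ab ts * mono ab' ts = mono (ab.1 + ab'.1, (ab.2 + ab'.2)%N) ts.
Proof. by rewrite /cmonomial -rmorphM /= nnpowD exprD mulrACA. Qed.

Lemma Qtilde_mul f f' : Q f -> Q f' -> Q (fun ts => f ts * f' ts).
Proof.
move=> Qf; apply: (@Qtilde_ind (fun f' => Q (fun ts => f ts * f' ts))).
- rewrite (_ : (fun ts => _) = fun=> 0); first exact: Qtilde0.
  by apply/funext => ts; rewrite mulr0.
- move=> c g g' _ _ Qg Qg'; rewrite (_ : (fun ts => _) =
    fun ts => c * (f ts * g ts) + f ts * g' ts); first exact: Qtilde_lin.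
  by apply/funext => ts; ring.
move=> ab; apply: (@Qtilde_ind (fun f => Q (fun ts => f ts * mono ab ts))) Qf.
- rewrite (_ : (fun ts => _) = fun=> 0); first exact: Qtilde0.
  by apply/funext => ts; rewrite mul0r.
- move=> c g g' _ _ Qg Qg'; rewrite (_ : (fun ts => _) =
    fun ts => c * (g ts * mono ab ts) + g' ts * mono ab ts); first exact: Qtilde_lin.
  by apply/funext => ts; ring.
- move=> ab'; rewrite (_ : (fun ts => _) = mono (ab'.1 + ab.1, (ab'.2 + ab.2)%N)).
    exact: Qtilde_mono.
  by apply/funext => ts; rewrite monoM.
Qed.

(** The real functions of the algebra, as a subring of all real functions, so
    that ring identities can be computed in it. *)
Definition fracalg_pred : {pred pt -> R} :=
  fun f => `[< Q (fun ts => (f ts)%:C) >].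

Lemma fracalg_subring : subring_closed fracalg_pred.
Proof.
split => [|f g|f g].
- apply/asboolP; rewrite (_ : (fun ts => _) = mono (0, 0%N)); first exact: Qtilde_mono.
  by apply/funext => ts; rewrite mono1.
- move=> /asboolP Qf /asboolP Qg; apply/asboolP.
  rewrite (_ : (fun ts => _) = fun ts => (-1) * (g ts)%:C + (f ts)%:C).
    exact: Qtilde_lin.
  by apply/funext => ts; rewrite mulN1r [RHS]addrC -rmorphB.
- move=> /asboolP Qf /asboolP Qg; apply/asboolP.
  rewrite (_ : (fun ts => _) = fun ts => (f ts)%:C * (g ts)%:C).
    exact: Qtilde_mul.
  by apply/funext => ts; rewrite -rmorphM.
Qed.

Definition fracalg := {f : pt -> R | fracalg_pred f}.
HB.instance Definition _ := SubChoice.on fracalg.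
HB.instance Definition _ :=
  GRing.SubChoice_isSubComPzRing.Build (pt -> R) fracalg_pred fracalg fracalg_subring.

Implicit Types f g : fracalg.

Lemma fracalgQ f : Q (fun ts => (val f ts)%:C).
Proof. exact/asboolP/(valP f). Qed.

Lemma fracalgP f g : (forall ts, val f ts = val g ts) -> f = g.
Proof. by move=> fg; apply/val_inj/funext. Qed.

Lemma fracalg_valD f g ts : val (f + g) ts = val f ts + val g ts.
Proof. by []. Qed.

Lemma fracalg_valM f g ts : val (f * g) ts = val f ts * val g ts.
Proof. by []. Qed.

Lemma fracalg_val1 ts : val (1 : fracalg) ts = 1.
Proof. by []. Qed.

Lemma fracalg_val_sum J (r : seq J) (F : J -> fracalg) ts :
  val (\sum_(i <- r) F i) ts = \sum_(i <- r) val (F i) ts.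
Proof.
by elim: r => [|i r IH]; rewrite ?big_nil // !big_cons fracalg_valD IH.
Qed.

Lemma fracalg_cst_subproof (c : R) : fracalg_pred (fun=> c).
Proof.
apply/asboolP; rewrite (_ : (fun ts => _) = fun ts => c%:C * mono (0, 0%N) ts + 0).
  by apply: Qtilde_lin; [exact: Qtilde_mono|exact: Qtilde0].
by apply/funext => ts; rewrite mono1 mulr1 addr0.
Qed.

Definition fracalg_cst (c : R) : fracalg := Sub _ (fracalg_cst_subproof c).

Lemma fracalg_cst_zmod : zmod_morphism fracalg_cst.
Proof. by move=> c c'; apply: fracalgP. Qed.

Lemma fracalg_cst_monoid : monoid_morphism fracalg_cst.
Proof. by split => [|c c']; apply: fracalgP. Qed.

HB.instance Definition _ := GRing.isZmodMorphism.Build R fracalg fracalg_cst fracalg_cst_zmod.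
HB.instance Definition _ := GRing.isMonoidMorphism.Build R fracalg fracalg_cst fracalg_cst_monoid.

Lemma fracalg_mono_subproof ab : fracalg_pred (fun ts => nnpow ts.1 (nnratr R ab.1) * ts.2%:num ^+ ab.2).
Proof. by apply/asboolP; exact: Qtilde_mono. Qed.

Definition fracalg_mono ab : fracalg := Sub _ (fracalg_mono_subproof ab).

Lemma fracalg_monoM ab ab' : fracalg_mono ab * fracalg_mono ab' =
  fracalg_mono (ab.1 + ab'.1, (ab.2 + ab'.2)%N).
Proof. by apply: fracalgP => ts /=; rewrite /= nnpowD exprD mulrACA. Qed.

Lemma fracalg_monoE ab ts : (val (fracalg_mono ab) ts)%:C = mono ab ts.
Proof. by []. Qed.

End FractionalAlgebra.

(** * From an extension to a positive functional *)
Section InducedFunctional.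
Variables (R : realType) (n : nat).
Local Notation pt := (nnvec R n * {nonneg R})%type.
Local Notation mono := (@cmonomial R n).
Local Notation Q := (@Qtilde R n).
Variables (delta : nnvec rat n -> nat -> R[i]) (L : (pt -> R[i]) -> R[i]).
Hypothesis HL : induced_functional delta L.

Lemma induced0 : L (fun=> 0) = 0.
Proof.
have := HL.1 (-1) _ _ (Qtilde0 R n) (Qtilde0 R n).
by under eq_fun do rewrite mulr0 addr0; rewrite mulN1r addNr.
Qed.

Lemma inducedZ c f : Q f -> L (fun ts => c * f ts) = c * L f.
Proof.
move=> Qf; have := HL.1 c _ _ Qf (Qtilde0 R n); rewrite induced0 addr0 => <-.
by congr L; apply/funext => ts; rewrite addr0.
Qed.

Lemma inducedD f g : Q f -> Q g -> L (fun ts => f ts + g ts) = L f + L g.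
Proof.
move=> Qf Qg; have := HL.1 1 _ _ Qf Qg; rewrite mul1r => <-.
by congr L; apply/funext => ts; rewrite mul1r.
Qed.

Lemma induced_sum J (r : seq J) (c : J -> R[i]) (f : J -> pt -> R[i]) :
  (forall i, Q (f i)) ->
  L (fun ts => \sum_(i <- r) c i * f i ts) = \sum_(i <- r) c i * L (f i).
Proof.
move=> Qf; elim: r => [|i r IH].
  rewrite big_nil -[RHS]induced0; congr L; apply/funext => ts; exact: big_nil.
rewrite big_cons -IH -HL.1 //; last exact: Qtilde_sum.
by congr L; apply/funext => ts; rewrite big_cons.
Qed.

(** Turns relations between the entries of [delta] into relations between
    functionals: [W] is [s * w] for the recursion and [p i] for the family
    weighted by [p i]. *)
Lemma eq_induced (L' : (pt -> R[i]) -> R[i]) delta' (W : pt -> R[i]) :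
  induced_functional delta' L' -> Q W ->
  (forall ab, L (fun ts => W ts * mono ab ts) = L' (mono ab)) ->
  forall f, Q f -> L (fun ts => W ts * f ts) = L' f.
Proof.
move=> HL' QW LW; apply: Qtilde_ind => [|c f g Qf Qg Hf Hg|ab]; last exact: LW.
  transitivity (L (fun=> 0)); last first.
    rewrite induced0; apply/esym.
    have := HL'.1 (-1) _ _ (Qtilde0 R n) (Qtilde0 R n).
    by under eq_fun do rewrite mulr0 addr0; rewrite mulN1r addNr.
  by congr L; apply/funext => ts; rewrite mulr0.
rewrite (HL'.1 _ _ _ Qf Qg) -Hf -Hg -HL.1; try exact: Qtilde_mul.
by congr L; apply/funext => ts; ring.
Qed.

Hypothesis L_ge0 : forall f, Q f -> 0 <= L (fun ts => `|f ts| ^+ 2).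

Lemma induced_sqr_ge0 (f : fracalg R n) :
  0 <= L (fun ts => (val (f * f) ts)%:C).
Proof.
have := L_ge0 (fracalgQ f).
rewrite (_ : (fun ts => `|_| ^+ 2) = fun ts => (val (f * f) ts)%:C) //.
apply/funext => ts; rewrite -add_Re2_Im2 /= expr0n addr0 expr2 rmorphM /=.
by rewrite -rmorphM.
Qed.

(** Polarisation: twice the value at a monomial [x] is the difference between
    the value at [(1 + x)^2] and those at [1] and [x^2], which are nonnegative
    and so real. *)
Lemma induced_real ab : complex.Im (L (mono ab)) = 0.
Proof.
have Q1 := @Qtilde_mono R n (0, 0%N); have Qab := @Qtilde_mono R n ab.
pose f : fracalg R n := 1 + fracalg_mono R ab.
have h := induced_sqr_ge0 f.
have h1 := induced_sqr_ge0 1.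
have h2 := induced_sqr_ge0 (fracalg_mono R ab).
have E : L (fun ts => (val (f * f) ts)%:C) = L (fun ts => (val (1 * 1 : fracalg R n) ts)%:C) +
   ((1 + 1) * L (mono ab) + L (fun ts => (val (fracalg_mono R ab * fracalg_mono R ab) ts)%:C)).
  rewrite -HL.1 // -?inducedD //; try exact: fracalgQ.
  - congr L; apply/funext => ts; rewrite -fracalg_monoE.
    rewrite (_ : (1 + 1 : R[i]) = (1 + 1)%:C); last by rewrite rmorphD rmorph1.
    rewrite -rmorphM -!rmorphD; congr (_%:C).
    by rewrite /f !(fracalg_valM, fracalg_valD, fracalg_val1); ring.
  - by apply: Qtilde_lin => //; exact: fracalgQ.
have {}h := ger0_Im h; have {}h1 := ger0_Im h1; have {}h2 := ger0_Im h2.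
move: h; rewrite E; case: (L (mono ab)) => x y.
move: h1 h2; case: (L _) => x1 y1; case: (L _) => x2 y2 /= -> ->.
have lin (u v : R) : 0 + ((1 + 1) * u + (0 + 0) * v + 0) = 0 -> u = 0 by lra.
by move=> /lin.
Qed.

Definition induced_pf_fun (f : fracalg R n) : R :=
  complex.Re (L (fun ts => (val f ts)%:C)).

Lemma induced_pfD f g :
  induced_pf_fun (f + g) = induced_pf_fun f + induced_pf_fun g.
Proof.
rewrite /induced_pf_fun -raddfD -inducedD; try exact: fracalgQ.
by congr (complex.Re (L _)); apply/funext => ts; rewrite -rmorphD.
Qed.

Lemma induced_pfZ c f :
  induced_pf_fun (fracalg_cst n c * f) = c * induced_pf_fun f.
Proof.
rewrite /induced_pf_fun; transitivity (complex.Re (c%:C * L (fun ts => (val f ts)%:C))).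
  rewrite -inducedZ; last exact: fracalgQ.
  by congr (complex.Re (L _)); apply/funext => ts; rewrite -rmorphM.
by case: (L _) => x y /=; rewrite mul0r subr0.
Qed.

Lemma induced_pf_ge0 f : 0 <= induced_pf_fun (f * f).
Proof. by have := induced_sqr_ge0 f; rewrite lecE => /andP[]. Qed.

Definition induced_pf : positive_functional (fracalg_cst n : {rmorphism R -> fracalg R n}) :=
  PositiveFunctional induced_pfD induced_pfZ induced_pf_ge0.

Lemma induced_pf_mono ab : (induced_pf (fracalg_mono R ab))%:C = delta ab.1 ab.2.
Proof.
rewrite -(HL.2 ab.1 ab.2) -surjective_pairing [RHS]complexE induced_real.
by rewrite mulr0 addr0.
Qed.

End InducedFunctional.

Section FromExtension.
Variables (R : realType) (n m : nat).
Variables (I : 'I_m -> {fset nnvec rat n}) (a : 'I_m -> nnvec rat n -> R).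
Local Notation pt := (nnvec R n * {nonneg R})%type.
Local Notation mono := (@cmonomial R n).
Local Notation FA := (fracalg R n).
Local Notation kst := (fracalg_cst n : {rmorphism R -> FA}).

Let tau_fa (v : nnvec rat n) : FA := fracalg_mono R (v, 0%N).
Let s_fa : FA := fracalg_mono R (0, 1%N).
Let poly_fa i : FA := \sum_(xi <- I i) kst (a i xi) * tau_fa xi.
Let w_fa : FA := 1 + \sum_j tau_fa (nnbasis rat j *+ 2) + \sum_i poly_fa i * poly_fa i.

Let tau_fa0 : tau_fa 0 = 1.
Proof.
apply: fracalgP => ts; apply: complexI; rewrite fracalg_monoE.
by rewrite mono1 fracalg_val1.
Qed.

Let tau_faD u v : tau_fa (u + v) = tau_fa u * tau_fa v.
Proof. by rewrite /tau_fa fracalg_monoM. Qed.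

Let mono_poly_fa i v l : poly_fa i * fracalg_mono R (v, l) =
  \sum_(xi <- I i) kst (a i xi) * fracalg_mono R (v + xi, l).
Proof.
rewrite /poly_fa mulr_suml; apply: eq_bigr => xi _.
by rewrite -mulrA /tau_fa fracalg_monoM addrC add0n.
Qed.

Let mono_sw v l : s_fa * w_fa * fracalg_mono R (v, l) =
  fracalg_mono R (v, l.+1) + \sum_j fracalg_mono R (v + nnbasis rat j *+ 2, l.+1) +
  \sum_i \sum_(xi <- I i) \sum_(eta <- I i)
    kst (a i xi * a i eta) * fracalg_mono R (v + xi + eta, l.+1).
Proof.
have -> : s_fa * w_fa * fracalg_mono R (v, l) = w_fa * fracalg_mono R (v, l.+1).
  by rewrite mulrAC /s_fa fracalg_monoM /= add0r add1n mulrC.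
rewrite /w_fa !mulrDl mul1r !mulr_suml; congr (_ + _ + _).
  by apply: eq_bigr => j _; rewrite /tau_fa fracalg_monoM addrC add0n.
apply: eq_bigr => i _; rewrite -mulrA mono_poly_fa mulr_sumr.
apply: eq_bigr => xi _; rewrite mulrCA mono_poly_fa mulr_sumr.
by apply: eq_bigr => eta _; rewrite mulrA -rmorphM.
Qed.

Variables (gamma : nnvec R n -> R) (delta : nnvec rat n -> nat -> R[i]).
Hypothesis adm : admissible_extension I a gamma delta.

(** The entries of [delta] being real, the functional of [delta] restricts to
    real functions with real values. *)
Lemma extension_moment_algebra :
  exists L : moment_algebra kst I a,
    forall v i, (L (tau L v * ma_s L ^+ i))%:C = delta v i.
Proof.
have [[L0 HL L0_ge0] _ delta_rel delta_poly] := adm.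
pose pf := induced_pf HL L0_ge0.
have Qsum J (r : seq J) (c : J -> R) (F : J -> FA) (L' : (pt -> R[i]) -> R[i]) d' :
    induced_functional d' L' ->
    L' (fun ts => (val (\sum_(i <- r) kst (c i) * F i) ts)%:C) =
    \sum_(i <- r) (c i)%:C * L' (fun ts => (val (F i) ts)%:C).
  move=> HL'; rewrite -(induced_sum HL') => [|i]; last exact: fracalgQ.
  congr L'; apply/funext => ts; rewrite fracalg_val_sum rmorph_sum.
  by apply: eq_bigr => i _; rewrite fracalg_valM rmorphM.
have L0D (f g : FA) : L0 (fun ts => (val (f + g) ts)%:C) =
    L0 (fun ts => (val f ts)%:C) + L0 (fun ts => (val g ts)%:C).
  rewrite -(inducedD HL); try exact: fracalgQ.
  by congr L0; apply/funext => ts; rewrite fracalg_valD rmorphD.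
have L0sum J (r : seq J) (F : J -> FA) :
    L0 (fun ts => (val (\sum_(i <- r) F i) ts)%:C) =
    \sum_(i <- r) L0 (fun ts => (val (F i) ts)%:C).
  elim: r => [|i r IH]; last by rewrite !big_cons L0D IH.
  by rewrite !big_nil -(induced0 HL).
have pf_sw f : pf (s_fa * w_fa * f) = pf f.
  rewrite /pf /= /induced_pf_fun; congr (complex.Re _).
  rewrite -(@eq_induced _ _ _ _ HL L0 delta (fun ts => (val (s_fa * w_fa) ts)%:C)
    HL _ _ (fun ts => (val f ts)%:C)) //.
  - by congr L0; apply/funext => ts; rewrite fracalg_valM rmorphM.
  - exact: fracalgQ.
  - move=> [v l]; rewrite HL.2 delta_rel.
    transitivity (L0 (fun ts => (val (s_fa * w_fa * fracalg_mono R (v, l)) ts)%:C)).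
      by congr L0; apply/funext => ts; rewrite [in RHS]fracalg_valM [in RHS]rmorphM.
    rewrite mono_sw !L0D !L0sum; congr (_ + _ + _); first exact: HL.2.
      by apply: eq_bigr => j _; exact: HL.2.
    apply: eq_bigr => i _; rewrite L0sum; apply: eq_bigr => xi _.
    by rewrite (Qsum _ _ _ _ _ delta HL); apply: eq_bigr => eta _; rewrite -HL.2.
  - exact: fracalgQ.
have pf_poly i : mult_ge0 pf (poly_fa i).
  move=> f; have [L1 HL1 L1_ge0] := delta_poly i.
  suff E : L0 (fun ts => (val (poly_fa i * (f * f)) ts)%:C) =
      L1 (fun ts => (val (f * f) ts)%:C).
    have := induced_sqr_ge0 L1_ge0 f; rewrite -E lecE => /andP[_].
    by [].
  transitivity (L0 (fun ts => (val (poly_fa i) ts)%:C * (val (f * f) ts)%:C)).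
    by congr L0; apply/funext => ts; rewrite fracalg_valM rmorphM.
  apply: (eq_induced HL HL1); [exact: fracalgQ| |exact: fracalgQ].
  move=> [v l]; rewrite HL1.2.
  transitivity (L0 (fun ts => (val (poly_fa i * fracalg_mono R (v, l)) ts)%:C)).
    by congr L0; apply/funext => ts; rewrite fracalg_valM rmorphM.
  rewrite mono_poly_fa (Qsum _ _ _ _ _ delta HL); apply: eq_bigr => xi _.
  by rewrite -HL.2.
exists (MomentAlgebra tau_fa0 tau_faD pf_sw pf_poly) => v i.
rewrite -(induced_pf_mono HL L0_ge0 (v, i)) /=; congr (_%:C); congr induced_pf_fun.
have -> : s_fa ^+ i = fracalg_mono R (0, i).
  elim: i => [|i IH]; first by rewrite expr0 -tau_fa0.
  by rewrite exprS IH /s_fa fracalg_monoM addr0 add1n.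
by rewrite /tau_fa fracalg_monoM addr0 add0n.
Qed.

Lemma extension_measure : exists mu : {measure set (borel (nnvec R n)) -> \bar R},
  (forall v i, exists2 r, delta v i = r%:C & has_integral mu setT
     (fun y => nnpow y (nnratr R v) * theta I a y ^+ i) r) /\
  forall i, mu [set y | fracpoly (I i) (a i) y < 0] = 0%E.
Proof.
have [L LE] := extension_moment_algebra.
have [mu [muI mu0]] := moment_model L.
by exists mu; split => // v i; exists (L (tau L v * ma_s L ^+ i)).
Qed.

End FromExtension.

(** * The extension defined by a measure *)

Section HasIntegralMore.
Context d (T : measurableType d) (R : realType).
Variables (mu : {measure set T -> \bar R}) (D : set T).
Hypothesis mD : measurable D.

Lemma has_integral_dominated (f g : T -> R) v : measurable_fun D f ->
  (forall x, D x -> `|f x| <= g x) -> has_integral mu D g v ->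
  exists w, has_integral mu D f w.
Proof.
move=> mf fg [gi _].
have fi : mu.-integrable D (EFin \o f).
  apply: le_integrable gi => //; first exact/measurable_EFinP.
  by move=> x Dx; rewrite /= lee_fin (le_trans (fg _ Dx)) ?ler_norm.
exists (fine (\int[mu]_(x in D) (f x)%:E)); split => //.
by rewrite fineK //; exact: integrable_fin_num.
Qed.

Lemma has_integral_fine (f : T -> R) v : has_integral mu D f v ->
  fine (\int[mu]_(x in D) (f x)%:E) = v.
Proof. by move=> [_ ->]. Qed.

Lemma fine_integral_ae_ge0 (f : T -> R) : measurable_fun D f ->
  {ae mu, forall x, D x -> 0 <= f x} -> 0 <= fine (\int[mu]_(x in D) (f x)%:E).
Proof.
move=> mf f0; rewrite (@ae_eq_integral _ _ _ _ _ (fun x => (Num.max (f x) 0)%:E)) //.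
- by apply: fine_ge0; apply: integral_ge0 => x _; rewrite lee_fin le_max lexx orbT.
- exact/measurable_EFinP.
- by apply/measurable_EFinP; apply: measurable_maxr => //; exact: measurable_cst.
- by apply: filterS f0 => x fx Dx; rewrite max_l ?fx.
Qed.

Lemma ge0_has_integral (f : T -> R) v : measurable_fun D f ->
  (forall x, D x -> 0 <= f x) -> (\int[mu]_(x in D) (f x)%:E = v%:E)%E ->
  has_integral mu D f v.
Proof.
move=> mf f0 fv; split => //; apply/integrableP; split; first exact/measurable_EFinP.
under eq_integral => x; first rewrite inE => Dx.
  rewrite /= ger0_norm ?f0 //; over.
by rewrite fv ltry.
Qed.

End HasIntegralMore.

Section WeightedFunctional.
Variables (R : realType) (n m : nat).
Variables (I : 'I_m -> {fset nnvec rat n}) (a : 'I_m -> nnvec rat n -> R).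
Local Notation pt := (nnvec R n * {nonneg R})%type.
Local Notation mono := (@cmonomial R n).
Local Notation Q := (@Qtilde R n).
Variable mu : {measure set (borel (nnvec R n)) -> \bar R}.

Let theta_nng (y : nnvec R n) : {nonneg R} := NngNum (ltW (theta_gt0 I a y)).

(** A measure on the orthant acts on functions of [(t, s)] through the graph
    [s = theta t]. *)
Let on_graph (f : pt -> R[i]) (y : nnvec R n) : R[i] := f (y, theta_nng y).

Let onRe f y := complex.Re (on_graph f y).
Let onIm f y := complex.Im (on_graph f y).

Variables (g : nnvec R n -> R) (D : nnvec rat n -> nat -> R).
Hypothesis mg : measurable_fun setT (g : borel (nnvec R n) -> R).
Hypothesis g_ge0 : {ae mu, forall y : borel (nnvec R n), 0 <= g y}.
Hypothesis gD : forall v i, has_integral mu setT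
  (fun y : borel (nnvec R n) => g y * (nnpow y (nnratr R v) * theta I a y ^+ i)) (D v i).

Let linRe c f h y : onRe (fun ts => c * f ts + h ts) y =
  complex.Re c * onRe f y - complex.Im c * onIm f y + onRe h y.
Proof.
rewrite /onRe /onIm /on_graph; case: c => c1 c2.
by case: (f _) => f1 f2; case: (h _) => h1 h2.
Qed.

Let linIm c f h y : onIm (fun ts => c * f ts + h ts) y =
  complex.Re c * onIm f y + complex.Im c * onRe f y + onIm h y.
Proof.
rewrite /onRe /onIm /on_graph; case: c => c1 c2.
by case: (f _) => f1 f2; case: (h _) => h1 h2.
Qed.

Let measurable_on f : Q f -> measurable_fun setT (onRe f : borel (nnvec R n) -> R) /\
  measurable_fun setT (onIm f : borel (nnvec R n) -> R).
Proof.
move: f; apply: Qtilde_ind => [|c f h _ _ [fR fI] [hR hI]|ab].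
- by split; exact: measurable_cst.
- split.
    rewrite (_ : onRe _ = fun y => complex.Re c * onRe f y - complex.Im c * onIm f y + onRe h y).
      apply: measurable_funD => //; apply: measurable_funB; exact: measurable_funM.
    by apply/funext => y; exact: linRe.
  rewrite (_ : onIm _ = fun y => complex.Re c * onIm f y + complex.Im c * onRe f y + onIm h y).
    apply: measurable_funD => //; apply: measurable_funD; exact: measurable_funM.
  by apply/funext => y; exact: linIm.
- split; last exact: measurable_cst.
  apply: measurable_funM; first exact: measurable_nnpow.
  by apply: measurable_funX; exact: measurable_theta.
Qed.

Let mT : measurable [set: borel (nnvec R n)] := measurableT.

Let integral_on f : Q f -> exists r,
  has_integral mu setT (fun y : borel (nnvec R n) => g y * onRe f y) (complex.Re r) /\
  has_integral mu setT (fun y : borel (nnvec R n) => g y * onIm f y) (complex.Im r).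
Proof.
move: f; apply: Qtilde_ind => [|c f h _ _ [r [fR fI]] [r' [hR hI]]|ab].
- exists 0; split; apply: eq_has_integral (has_integral0 mu setT) => // y _;
    by rewrite mulr0.
- exists (c * r + r'); split.
    have := has_integralD mT (has_integralB mT (has_integralZ mT (complex.Re c) fR)
      (has_integralZ mT (complex.Im c) fI)) hR.
    case: c r r' {fR fI hR hI} => c1 c2 [r1 r2] [r3 r4] /=.
    by apply: eq_has_integral => // y _; rewrite linRe /=; ring.
  have := has_integralD mT (has_integralD mT (has_integralZ mT (complex.Re c) fI)
    (has_integralZ mT (complex.Im c) fR)) hI.
  case: c r r' {fR fI hR hI} => c1 c2 [r1 r2] [r3 r4] /=.
  by apply: eq_has_integral => // y _; rewrite linIm /=; ring.
- exists (D ab.1 ab.2)%:C; split; first exact: gD.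
  by apply: eq_has_integral (has_integral0 mu setT) => // y _; rewrite mulr0.
Qed.

Let fint (h : borel (nnvec R n) -> R) : R := fine (\int[mu]_y (h y)%:E).

Let wL f : R[i] := fint (fun y => g y * onRe f y) +i* fint (fun y => g y * onIm f y).

Let wLE f r :
  has_integral mu setT (fun y : borel (nnvec R n) => g y * onRe f y) (complex.Re r) ->
  has_integral mu setT (fun y : borel (nnvec R n) => g y * onIm f y) (complex.Im r) ->
  wL f = r.
Proof.
by rewrite /wL /fint => /has_integral_fine -> /has_integral_fine ->; case: r.
Qed.

(** The functional is the integral of [g] times the restriction to the graph,
    and [|f|^2] is nonnegative there. The weights of interest are [g = 1] and
    [g = p i]. *)
Lemma psd_of_weight : psd (R := R) (fun v i => (D v i)%:C).
Proof.
exists wL.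
  split=> [c f h Qf Qh|v i].
    have [r [fR fI]] := integral_on Qf; have [r' [hR hI]] := integral_on Qh.
    have [r'' [lR lI]] := integral_on (Qtilde_lin c Qf Qh).
    rewrite (wLE fR fI) (wLE hR hI) (wLE lR lI).
    apply/eqP; rewrite eq_complex; apply/andP; split; apply/eqP.
      apply: (has_integral_unique lR).
      have := has_integralD mT (has_integralB mT (has_integralZ mT (complex.Re c) fR)
        (has_integralZ mT (complex.Im c) fI)) hR.
      case: c r r' {fR fI hR hI lR lI} => c1 c2 [r1 r2] [r3 r4] /=.
      by apply: eq_has_integral => // y _; rewrite linRe /=; ring.
    apply: (has_integral_unique lI).
    have := has_integralD mT (has_integralD mT (has_integralZ mT (complex.Re c) fI)
      (has_integralZ mT (complex.Im c) fR)) hI.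
    case: c r r' {fR fI hR hI lR lI} => c1 c2 [r1 r2] [r3 r4] /=.
    by apply: eq_has_integral => // y _; rewrite linIm /=; ring.
  apply: wLE; first exact: gD.
  by apply: eq_has_integral (has_integral0 mu setT) => // y _; rewrite mulr0.
move=> f Qf; have [mR mI] := measurable_on Qf.
have sqE y : on_graph (fun ts => `|f ts| ^+ 2) y = (onRe f y ^+ 2 + onIm f y ^+ 2)%:C.
  by rewrite /on_graph -add_Re2_Im2.
rewrite /wL lecE /=; apply/andP; split.
  rewrite /fint (_ : (fun y => _) = fun=> 0%E) ?integral0 //.
  by apply/funext => y; rewrite /onIm sqE mulr0.
apply: fine_integral_ae_ge0 => //.
  apply: measurable_funM => //.
  rewrite (_ : onRe _ = fun y => onRe f y ^+ 2 + onIm f y ^+ 2).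
    by apply: measurable_funD; exact: measurable_funX.
  by apply/funext => y; rewrite /onRe sqE.
apply: filterS g_ge0 => y gy _; rewrite /onRe sqE mulr_ge0 //.
by rewrite addr_ge0 // sqr_ge0.
Qed.

End WeightedFunctional.

Section MeasureExtension.
Variables (R : realType) (n m : nat).
Variables (I : 'I_m -> {fset nnvec rat n}) (a : 'I_m -> nnvec rat n -> R).
Variable gamma : nnvec R n -> R.
Variable mu : {measure set (borel (nnvec R n)) -> \bar R}.
Hypothesis mu_rep : supported_representing_measure I a gamma mu.

Let mT : measurable [set: borel (nnvec R n)] := measurableT.

Lemma locus_compl_null : mu (~` nonneg_locus I a) = 0%E.
Proof.
apply: msupportC_null mu_rep.2; rewrite /nonneg_locus.
apply: closed_bigI => i _.
rewrite (_ : [set _ | _] = ~` [set t | fracpoly (I i) (a i) t < 0]).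
  by rewrite closedC; exact: open_fracpoly_lt0.
by apply/seteqP; split => t /=; rewrite leNgt => /negP.
Qed.

Lemma poly_ae_ge0 : {ae mu, forall y : borel (nnvec R n), forall i,
  0 <= fracpoly (I i) (a i) y}.
Proof.
have : mu.-negligible (~` nonneg_locus I a).
  apply/negligibleP; last exact: locus_compl_null.
  rewrite /nonneg_locus setC_bigcap; apply: fin_bigcup_measurable => [|i _].
    exact: finite_finset.
  rewrite (_ : ~` _ = [set t | fracpoly (I i) (a i) t < 0]).
    by apply: sub_sigma_algebra; exact: open_fracpoly_lt0.
  by apply/seteqP; split => t /=; [move/negP; rewrite -ltNge|rewrite ltNge => /negP].
apply: negligibleS => y h hy; apply: h => i; exact: hy.
Qed.

Lemma nnpow_has_integral alpha : has_integral mu setT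
  (fun y : borel (nnvec R n) => nnpow y alpha) (gamma alpha).
Proof.
apply: ge0_has_integral.
- exact: measurable_nnpow.
- by move=> y _; exact: nnpow_ge0.
- exact: mu_rep.1.
Qed.

Definition theta_moment (v : nnvec rat n) (i : nat) : R :=
  fine (\int[mu]_y (nnpow y (nnratr R v) * theta I a y ^+ i)%:E).

Lemma theta_momentP v i : has_integral mu setT
  (fun y : borel (nnvec R n) => nnpow y (nnratr R v) * theta I a y ^+ i)
  (theta_moment v i).
Proof.
have [r hr] : exists r, has_integral mu setT
    (fun y : borel (nnvec R n) => nnpow y (nnratr R v) * theta I a y ^+ i) r.
  apply: (has_integral_dominated mT _ _ (nnpow_has_integral (nnratr R v))).
    apply: measurable_funM; first exact: measurable_nnpow.
    by apply: measurable_funX; exact: measurable_theta.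
  move=> y _; have t0 := theta_gt0 I a y.
  rewrite ger0_norm; last by rewrite mulr_ge0 ?nnpow_ge0 // exprn_ge0 // ltW.
  by rewrite ler_piMr ?nnpow_ge0 // exprn_ile1 ?theta_le1 // ltW.
by rewrite /theta_moment (has_integral_fine hr).
Qed.

Lemma nnpow_basis (y : nnvec R n) j : nnpow y (nnratr R (nnbasis rat j)) = nncoord y j.
Proof.
rewrite /nnpow (bigD1 j) //= nncoord_ratr nncoord_basis eqxx rmorph1.
rewrite powRr1 ?nncoord_ge0 // big1 ?mulr1 // => i ij.
by rewrite nncoord_ratr nncoord_basis (negbTE ij) rmorph0 powRr0.
Qed.

(** The recursion is [theta * (1 + \sum_j t_j^2 + \sum_i p_i^2) = 1] integrated
    against [t^v * theta^l]; the [p i] are admissible weights because the support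
    carries the whole measure. *)
Lemma measure_admissible :
  admissible_extension I a gamma (fun v i => (theta_moment v i)%:C).
Proof.
have polyM i v l : has_integral mu setT (fun y : borel (nnvec R n) =>
    fracpoly (I i) (a i) y * (nnpow y (nnratr R v) * theta I a y ^+ l))
    (\sum_(xi <- I i) a i xi * theta_moment (v + xi) l).
  have := has_integral_sum mT (I i)
    (fun xi => has_integralZ mT (a i xi) (theta_momentP (v + xi) l)).
  apply: eq_has_integral => // y _.
  rewrite /fracpoly mulr_suml; apply: eq_bigr => xi _.
  by rewrite nnpowD; ring.
split.
- apply: (@psd_of_weight _ _ _ I a mu (fun=> 1)); first exact: measurable_cst.
    by apply: aeW => y; exact: ler01.
  by move=> v i; under eq_fun do rewrite mul1r; exact: theta_momentP.
- move=> v; congr (_%:C).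
  apply: (has_integral_unique (theta_momentP v 0)).
  apply: eq_has_integral (nnpow_has_integral _) => // y _.
  by rewrite expr0 mulr1.
- move=> v l.
  have rel : theta_moment v l = theta_moment v l.+1 +
      \sum_(j < n) theta_moment (v + nnbasis rat j *+ 2) l.+1 +
      \sum_(i < m) \sum_(xi <- I i) \sum_(eta <- I i)
        a i xi * a i eta * theta_moment (v + xi + eta) l.+1.
    apply: (has_integral_unique (theta_momentP v l)).
    have hj := has_integral_sum mT (index_enum 'I_n)
      (fun j => theta_momentP (v + nnbasis rat j *+ 2) l.+1).
    have hi := has_integral_sum mT (index_enum 'I_m) (fun i =>
      has_integral_sum mT (I i) (fun xi => has_integral_sum mT (I i) (fun eta =>
      has_integralZ mT (a i xi * a i eta) (theta_momentP (v + xi + eta) l.+1)))).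
    have := has_integralD mT (has_integralD mT (theta_momentP v l.+1) hj) hi.
    apply: eq_has_integral => // y _.
    rewrite -[RHS]mulr1 -(thetaM I a y) !mulrDr !mulr1.
    congr (_ + _ + _); first by rewrite exprS; ring.
      rewrite !mulr_sumr; apply: eq_bigr => j _.
      by rewrite mulr2n !nnpowD nnpow_basis exprS; ring.
    rewrite !mulr_sumr; apply: eq_bigr => i _.
    rewrite expr2 /fracpoly big_distrlr /= !mulr_sumr; apply: eq_bigr => xi _.
    rewrite !mulr_sumr; apply: eq_bigr => eta _.
    by rewrite !nnpowD exprS; ring.
  rewrite rel !rmorphD !rmorph_sum; congr (_ + _).
  apply: eq_bigr => i _; rewrite rmorph_sum; apply: eq_bigr => xi _.
  by rewrite rmorph_sum; apply: eq_bigr => eta _; rewrite rmorphM.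
- move=> i.
  have := @psd_of_weight _ _ _ I a mu (fracpoly (I i) (a i)) _ _ _ (polyM i).
  rewrite (_ : (fun v l => _) = fun v l =>
      \sum_(xi <- I i) (a i xi)%:C * (theta_moment (v + xi) l)%:C); last first.
    apply/funext => v; apply/funext => l; rewrite rmorph_sum.
    by apply: eq_bigr => xi _; rewrite rmorphM.
  apply; first exact: measurable_fracpoly.
  by apply: filterS poly_ae_ge0 => y; exact.
Qed.

End MeasureExtension.

(** * From rational to real exponents *)

Section RealExponents.
Variables (R : realType) (n : nat).
Local Notation V := (nnvec R n).

Definition rat_approx (x : R) (k : nat) : rat :=
  (Num.truncn (x * k.+1%:R))%:R / k.+1%:R.

Lemma rat_approx_ge0 x k : 0 <= rat_approx x k.
Proof. by rewrite divr_ge0. Qed.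

Lemma rat_approxP (x : R) k : 0 <= x ->
  ratr (rat_approx x k) <= x <= ratr (rat_approx x k) + k.+1%:R^-1.
Proof.
move=> x0; have k0 : 0 < k.+1%:R :> R by rewrite ltr0n.
rewrite /rat_approx rmorphM fmorphV /= !ratr_nat; apply/andP; split.
  by rewrite ler_pdivrMr // truncn_le // mulr_ge0 // ltW.
rewrite -[X in _ + X]mul1r -mulrDl ler_pdivlMr // natr1.
exact/ltW/truncnS_gt.
Qed.

Lemma rat_approx_cvg (x : R) : 0 <= x -> ratr (rat_approx x k) @[k --> \oo] --> x.
Proof.
move=> x0; apply: (@squeeze_cvgr _ _ _ _ (fun k => x - harmonic k) (cst x)).
- by apply: nearW => k; have /andP[h1 h2] := rat_approxP k x0; rewrite h1 lerBlDr h2.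
- rewrite -[X in _ --> X]subr0; apply: cvgB; [exact: cvg_cst|exact: cvg_harmonic].
- exact: cvg_cst.
Qed.

Lemma nnvec_approx_subproof (al : V) k :
  @nnvec_pred rat n (\row_i rat_approx (nncoord al i) k).
Proof. by apply/forallP => i; rewrite mxE rat_approx_ge0. Qed.

(** Approximating the exponents from below keeps the zero ones, for which the
    monomials are discontinuous in the exponent at the boundary. *)
Definition nnvec_approx (al : V) k : nnvec rat n := Sub _ (nnvec_approx_subproof al k).

Lemma nncoord_approx al k i :
  nncoord (nnratr R (nnvec_approx al k)) i = ratr (rat_approx (nncoord al i) k).
Proof. by rewrite nncoord_ratr /nncoord SubK mxE. Qed.

Lemma nnvec_approx_cvg (al : V) : nnratr R (nnvec_approx al k) @[k --> \oo] --> al.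
Proof.
move=> U /nbhs_ballP[e /= e0 eU].
have /cvgrPdist_lt/(_ e e0) := @cvg_harmonic R.
apply: filterS => k; rewrite sub0r normrN /= => hk; apply: eU.
apply/nnvec_ballE; split => // i; rewrite nncoord_approx.
have /andP[h1 h2] := rat_approxP k (nncoord_ge0 al i).
rewrite ger0_norm ?subr_ge0 //; apply: le_lt_trans hk.
by rewrite ger0_norm ?invr_ge0 // lerBlDl.
Qed.

Lemma powR_approx_cvg (x al : R) : 0 <= x -> 0 <= al ->
  x `^ ratr (rat_approx al k) @[k --> \oo] --> x `^ al.
Proof.
move=> x0 al0.
have [->|xn0] := eqVneq x 0; last first.
  rewrite /powR (negbTE xn0).
  apply: (cvg_comp (fun k => ratr (rat_approx al k) * ln x) expR); last exact: continuous_expR.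
  by apply: cvgM; [exact: rat_approx_cvg|exact: cvg_cst].
have [al_0|aln0] := eqVneq al 0.
  apply: cvg_near_cst; apply: nearW => k; congr (_ `^ _).
  have /andP[h1 _] := rat_approxP k al0.
  by apply/eqP; rewrite eq_le h1 /= [X in X <= _]al_0 ler0q rat_approx_ge0.
have al_gt0 : 0 < al by rewrite lt_def aln0.
apply: cvg_near_cst.
have pos : \forall k \near \oo, 0 < ratr (rat_approx al k) :> R.
  exact: (cvgr_gt al (@rat_approx_cvg al al0)).
by apply: filterS pos => k hk; rewrite !powR0 // gt_eqF.
Qed.

Lemma nnpow_approx_cvg (t al : V) :
  nnpow t (nnratr R (nnvec_approx al k)) @[k --> \oo] --> nnpow t al.
Proof.
rewrite /nnpow.
suff h (r : seq 'I_n) :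
    \prod_(i <- r) (nncoord t i `^ nncoord (nnratr R (nnvec_approx al k)) i) @[k --> \oo] -->
    \prod_(i <- r) (nncoord t i `^ nncoord al i) by exact: h.
elim: r => [|i r IH].
  rewrite (_ : (fun k => _) = cst 1) ?big_nil; first exact: cvg_cst.
  by apply/funext => k; rewrite big_nil.
rewrite (_ : (fun k => _) = (fun k => nncoord t i `^ ratr (rat_approx (nncoord al i) k)) \*
    (fun k => \prod_(i <- r) (nncoord t i `^ nncoord (nnratr R (nnvec_approx al k)) i))).
  by rewrite big_cons; apply: cvgM => //; apply: powR_approx_cvg; exact: nncoord_ge0.
by apply/funext => k; rewrite big_cons nncoord_approx.
Qed.

Lemma block_exponent_subproof (N : nat) (S : {set 'I_n}) :
  @nnvec_pred rat n (\row_i (if i \in S then N%:R else 0)).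
Proof. by apply/forallP => i; rewrite mxE; case: ifP. Qed.

Definition block_exponent N S : nnvec rat n := Sub _ (block_exponent_subproof N S).

(** Exponents at most [N] are dominated by [N] on the coordinates that are at
    least 1 and by 0 on the others. *)
Lemma nnpow_le_block (t al : V) (N : nat) : (forall i, nncoord al i <= N%:R) ->
  nnpow t al <= \sum_(S : {set 'I_n}) nnpow t (nnratr R (block_exponent N S)).
Proof.
move=> alN; pose S : {set 'I_n} := finset (fun i => 1 <= nncoord t i).
rewrite (bigD1 S) //= -[leLHS]addr0; apply: lerD; last first.
  by apply: sumr_ge0 => S' _; exact: nnpow_ge0.
apply: ler_prod => i _; rewrite powR_ge0 /= nncoord_ratr.
rewrite [nncoord (block_exponent _ _) _]/nncoord SubK mxE inE; case: ifPn => ti.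
  by rewrite ratr_nat ler_powR.
rewrite rmorph0 powRr0; apply: (@le_trans _ _ (1 `^ nncoord al i)); last by rewrite powR1.
apply: ge0_ler_powR; rewrite ?nnegrE ?nncoord_ge0 //.
by rewrite -ltNge in ti; exact: ltW.
Qed.

Variables (mu : {measure set (borel V) -> \bar R}) (gamma : V -> R).
Hypothesis gamma_cont : continuous gamma.
Hypothesis mu_rat : forall v : nnvec rat n, has_integral mu setT
  (fun y : borel V => nnpow y (nnratr R v)) (gamma (nnratr R v)).

(** The approximating exponents stay below [N], so that one integrable function
    dominates all the approximating monomials. *)
Lemma rational_moments_representing : representing_measure gamma mu.
Proof.
move=> al; pose N := (\sum_(i < n) (Num.truncn (nncoord al i)).+1)%N.
have alN i : nncoord al i <= N%:R.
  apply: (le_trans (ltW (truncnS_gt _))); rewrite ler_nat /N (bigD1 i) //=.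
  exact: leq_addr.
pose g (y : borel V) := \sum_(S : {set 'I_n}) nnpow y (nnratr R (block_exponent N S)).
have mT : measurable [set: borel V] := measurableT.
have [gi _] : has_integral mu setT g
    (\sum_(S : {set 'I_n}) gamma (nnratr R (block_exponent N S))).
  by apply: has_integral_sum => // S; exact: mu_rat.
pose f k (y : borel V) := (nnpow y (nnratr R (nnvec_approx al k)))%:E.
have fint k : (\int[mu]_y f k y = (gamma (nnratr R (nnvec_approx al k)))%:E)%E.
  by have [] := mu_rat (nnvec_approx al k).
have cg : (\int[mu]_y f k y)%E @[k --> \oo] --> (gamma al)%:E.
  under eq_fun do rewrite fint.
  apply: cvg_EFin; first exact: nearW.
  exact: (cvg_comp _ gamma (@nnvec_approx_cvg al) (@gamma_cont al)).
have [] := @dominated_convergence _ _ _ mu setT mT f (fun y => (nnpow y al)%:E) (EFin \o g).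
- by move=> k; apply/measurable_EFinP; exact: measurable_nnpow.
- by apply/measurable_EFinP; exact: measurable_nnpow.
- apply: aeW => y _; apply: cvg_EFin; first exact: nearW.
  exact: nnpow_approx_cvg.
- exact: gi.
- apply: aeW => y k _; rewrite /f /= lee_fin ger0_norm ?nnpow_ge0 //.
  apply: nnpow_le_block => i; rewrite nncoord_approx.
  have /andP[h1 _] := rat_approxP k (nncoord_ge0 al i).
  exact: le_trans h1 (alN i).
- by move=> _ _ cv; exact: (cvg_unique _ cv cg).
Qed.

End RealExponents.

(** * Determinacy *)

Section SignIteration.
Variable R : realType.

(** The iterates of [z |-> (3 z - z^3) / 2] converge on [-1, 1] to the sign,
    including the value 0 at 0. *)
Fixpoint sign_iter k (y : R) : R :=
  if k is l.+1 then let z := sign_iter l y in (3 * z - z ^+ 3) / 2 else y.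

Definition step_iter k (y : R) : R := (sign_iter k y + sign_iter k y ^+ 2) / 2.

Lemma sign_iterN k y : sign_iter k (- y) = - sign_iter k y.
Proof. by elim: k => //= k ->; field. Qed.

Lemma sign_iter0 k : sign_iter k 0 = 0.
Proof. by elim: k => //= k ->; rewrite mulr0 expr0n subrr mul0r. Qed.

(** One step multiplies the error [1 - z] by [(2 - z - z^2) / 2], at most
    [1 - y / 2] because the iterates increase from [y]. *)
Lemma sign_iter_itv k y : 0 < y <= 1 ->
  [/\ y <= sign_iter k y, sign_iter k y <= 1 &
      1 - sign_iter k y <= (1 - y / 2) ^+ k].
Proof.
move=> /andP[y0 y1]; elim: k => [|k [h1 h2 h3]] /=; first by split; lra.
move: (sign_iter k y) h1 h2 h3 => z h1 h2 h3.
have z0 : 0 < z := lt_le_trans y0 h1.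
have zz : z <= (3 * z - z ^+ 3) / 2.
  rewrite -subr_ge0 (_ : _ - z = z * (1 - z) * (1 + z) / 2); last by field.
  by rewrite divr_ge0 // !mulr_ge0 ?subr_ge0 // ltW // addr_gt0.
have zE : 1 - (3 * z - z ^+ 3) / 2 = (1 - z) * ((2 - z - z ^+ 2) / 2) by field.
have z2 : 0 <= z ^+ 2 by rewrite sqr_ge0.
have z21 : z ^+ 2 <= 1 by rewrite exprn_ile1 // ltW.
split; first exact: le_trans h1 zz.
  rewrite -subr_ge0 zE mulr_ge0 ?subr_ge0 //.
  by rewrite divr_ge0 //; lra.
rewrite zE [leRHS]exprSr; apply: ler_pM; rewrite ?subr_ge0 ?divr_ge0 //; lra.
Qed.

Lemma sign_iter_norm k y : `|y| <= 1 -> `|sign_iter k y| <= 1.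
Proof.
have pos x : 0 < x <= 1 -> `|sign_iter k x| <= 1.
  move=> /[dup] /andP[x0 _] /(sign_iter_itv k)[h1 h2 _].
  by rewrite ger0_norm // (le_trans (ltW x0)).
move=> y1; have [y0|y0|->] := ltgtP y 0.
- by rewrite -normrN -sign_iterN pos // oppr_gt0 y0 -(ltr0_norm y0).
- by rewrite pos // y0 -(gtr0_norm y0).
- by rewrite sign_iter0 normr0.
Qed.

Lemma step_iter_norm k y : `|y| <= 1 -> `|step_iter k y| <= 1.
Proof.
move=> /(sign_iter_norm k); rewrite /step_iter; move: (sign_iter k y) => z z1.
have z2 : `|z ^+ 2| <= 1 by rewrite normrX exprn_ile1.
rewrite normrM [X in _ * X]ger0_norm // ler_pdivrMr // mul1r.
by apply: le_trans (ler_normD _ _) _; rewrite (_ : 2 = 1 + 1) ?lerD.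
Qed.

Lemma step_iter_cvg y : `|y| <= 1 -> step_iter k y @[k --> \oo] --> ((0 < y)%R%:R : R).
Proof.
have pos x : 0 < x <= 1 -> sign_iter k x @[k --> \oo] --> (1 : R).
  move=> x01; have /andP[x0 x1] := x01.
  apply: (@squeeze_cvgr _ _ _ _ (fun k => 1 - (1 - x / 2) ^+ k) (cst 1)).
  - apply: nearW => k; have [_ h2 h3] := sign_iter_itv k x01.
    by rewrite h2 andbT lerBlDr -lerBlDl.
  - rewrite -[X in _ --> X]subr0; apply: cvgB; first exact: cvg_cst.
    by apply: cvg_expr; rewrite ger0_norm; lra.
  - exact: cvg_cst.
have comb z l : sign_iter k z @[k --> \oo] --> (l : R) ->
    step_iter k z @[k --> \oo] --> (l + l ^+ 2) / 2.
  move=> h; apply: cvgM; last exact: cvg_cst.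
  by apply: cvgD => //; rewrite expr2; under eq_fun do rewrite expr2; exact: cvgM.
move=> y1; have [y0|y0|->] := ltgtP y 0.
- rewrite (_ : false%:R = (-1 + (-1) ^+ 2) / 2 :> R).
    apply: comb; rewrite -[y]opprK; under eq_fun do rewrite sign_iterN.
    by apply: cvgN; apply: pos; rewrite oppr_gt0 y0 -(ltr0_norm y0).
  by rewrite sqrrN expr1n addNr mul0r.
- rewrite (_ : true%:R = (1 + 1 ^+ 2) / 2 :> R).
    by apply: comb; apply: pos; rewrite y0 -(gtr0_norm y0).
  by rewrite expr1n mulr1n; field.
- rewrite (_ : false%:R = (0 + 0 ^+ 2) / 2 :> R).
    by apply: comb; under eq_fun do rewrite sign_iter0; exact: cvg_cst.
  by rewrite expr0n addr0 mul0r.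
Qed.

End SignIteration.

Section DominatedHasIntegral.
Context d (T : measurableType d) (R : realType).
Variable mu : {measure set T -> \bar R}.

Lemma has_integral_cvg (f : nat -> T -> R) (g h : T -> R) (r : nat -> R) v :
  (forall k, has_integral mu setT (f k) (r k)) -> measurable_fun setT g ->
  (forall x, f k x @[k --> \oo] --> g x) ->
  (forall k x, `|f k x| <= `|h x|) -> has_integral mu setT h v ->
  exists l, has_integral mu setT g l /\ r k @[k --> \oo] --> l.
Proof.
move=> fr mg fg fh [hi _].
have [] := @dominated_convergence _ _ _ mu setT measurableT
  (fun k x => (f k x)%:E) (EFin \o g) (fun x => (`|h x|)%:E).
- by move=> k; have [/integrableP[]] := fr k.
- exact/measurable_EFinP.
- by apply: aeW => x _; apply: cvg_EFin; [exact: nearW|exact: fg].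
- exact: integrable_abse hi.
- by apply: aeW => x k _ /=; rewrite lee_fin.
move=> gi _ cv; exists (fine (\int[mu]_x (g x)%:E)).
have gE : (\int[mu]_x (g x)%:E = (fine (\int[mu]_x (g x)%:E))%:E)%E.
  by rewrite fineK //; exact: integrable_fin_num.
split; first by split.
have rE : r = fun k => fine (\int[mu]_x (f k x)%:E).
  by apply/funext => k; rewrite (has_integral_fine (fr k)).
rewrite rE; apply: fine_cvg; rewrite -gE; exact: cv.
Qed.

End DominatedHasIntegral.

Section Determinacy.
Variables (R : realType) (n m : nat).
Variables (I : 'I_m -> {fset nnvec rat n}) (a : 'I_m -> nnvec rat n -> R).
Local Notation V := (nnvec R n).
Local Notation th := (theta I a).
Variables (mu nu : {measure set (borel V) -> \bar R}).

Let mT : measurable [set: borel V] := measurableT.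

Definition same_integral (g : borel V -> R) := exists r,
  has_integral mu setT g r /\ has_integral nu setT g r.

Hypothesis same_moments : forall v i,
  same_integral (fun y => nnpow y (nnratr R v) * th y ^+ i).

(** Polynomials restricted to the graph [s = theta t]. *)
Inductive graph_poly : (borel V -> R) -> Prop :=
| graph_poly_mono v i : graph_poly (fun y => nnpow y (nnratr R v) * th y ^+ i)
| graph_poly_lin c f g : graph_poly f -> graph_poly g ->
    graph_poly (fun y => c * f y + g y).

Lemma same_integral_lin c f g : same_integral f -> same_integral g ->
  same_integral (fun y => c * f y + g y).
Proof.
move=> [r [fr fr']] [r' [gr gr']]; exists (c * r + r').
by split; apply: has_integralD => //; exact: has_integralZ.
Qed.

Lemma graph_poly_same f : graph_poly f -> same_integral f.
Proof. by elim=> [v i|c g h _ hg _ hh] //; exact: same_integral_lin. Qed.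

Lemma graph_poly_ext f g : f =1 g -> graph_poly f -> graph_poly g.
Proof. by move=> /funext ->. Qed.

Lemma graph_polyM f g : graph_poly f -> graph_poly g -> graph_poly (fun y => f y * g y).
Proof.
move=> hf hg; elim: hf => [v i|c f1 f2 _ h1 _ h2]; last first.
  by apply: graph_poly_ext (graph_poly_lin c h1 h2) => y; ring.
elim: hg => [u j|c g1 g2 _ h1 _ h2]; last first.
  by apply: graph_poly_ext (graph_poly_lin c h1 h2) => y; ring.
apply: graph_poly_ext (graph_poly_mono (v + u) (i + j)) => y.
by rewrite nnpowD exprD mulrACA.
Qed.

Lemma graph_poly1 : graph_poly (fun=> 1).
Proof.
by apply: graph_poly_ext (graph_poly_mono 0 0) => y; rewrite nnpow0 mul1r expr0.
Qed.

Lemma graph_poly_cst c : graph_poly (fun=> c).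
Proof.
by apply: graph_poly_ext (graph_poly_lin (c - 1) graph_poly1 graph_poly1) => y; ring.
Qed.

Lemma graph_polyD f g : graph_poly f -> graph_poly g -> graph_poly (fun y => f y + g y).
Proof.
move=> hf hg; apply: graph_poly_ext (graph_poly_lin 1 hf hg) => y.
by rewrite mul1r.
Qed.

Lemma measurable_graph_poly f : graph_poly f -> measurable_fun setT f.
Proof.
elim=> [v i|c g h _ mg _ mh].
  apply: measurable_funM; first exact: measurable_nnpow.
  by apply: measurable_funX; exact: measurable_theta.
by apply: measurable_funD => //; exact: measurable_funM.
Qed.

Lemma graph_poly_sign_iter f k : graph_poly f ->
  graph_poly (fun y => sign_iter k (f y)).
Proof.
move=> hf; elim: k => //= k h.
have h3 := graph_polyM h (graph_polyM h h).
apply: graph_poly_ext (graph_polyD (graph_polyM (graph_poly_cst (3 / 2)) h)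
  (graph_polyM (graph_poly_cst (- 2^-1)) h3)) => y.
by field.
Qed.

Lemma graph_poly_step_iter f k : graph_poly f ->
  graph_poly (fun y => step_iter k (f y)).
Proof.
move=> hf; have h := graph_poly_sign_iter k hf.
apply: graph_poly_ext (graph_polyM (graph_poly_cst 2^-1)
  (graph_polyD h (graph_polyM h h))) => y.
by rewrite /step_iter; field.
Qed.

(** Testing [h] against all polynomials, and not only against 1, makes the
    property stable under multiplication by indicators of half-spaces, hence
    valid for indicators of finite intersections of them. *)
Definition indistinct (h : borel V -> R) :=
  [/\ measurable_fun setT h, forall y, `|h y| <= 1 &
      forall g, graph_poly g -> same_integral (fun y => h y * g y)].

(** The indicator is the bounded limit of the polynomials [step_iter k f]. *)
Lemma indistinct_step h f : indistinct h -> graph_poly f ->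
  (forall y, `|f y| <= 1) -> indistinct (fun y => h y * (0 < f y)%R%:R).
Proof.
move=> [mh h1 hh] hf f1; have mf := measurable_graph_poly hf.
have m0 : measurable_fun setT (fun y => (0 < f y)%R%:R : R).
  apply: (measurableT_comp (f := fun b : bool => b%:R : R)) => //.
  by apply: measurable_fun_ltr => //; exact: measurable_cst.
split; first exact: measurable_funM.
  by move=> y; rewrite normrM; case: (0 < f y); rewrite ?normr1 ?mulr1 ?normr0 ?mulr0.
move=> g hg; have [v [gv gv']] := graph_poly_same hg.
have /choice[r hr] k : exists r,
    has_integral mu setT (fun y => h y * (step_iter k (f y) * g y)) r /\
    has_integral nu setT (fun y => h y * (step_iter k (f y) * g y)) r.
  by apply: hh; apply: graph_polyM => //; exact: graph_poly_step_iter.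
have mhg : measurable_fun setT (fun y => h y * (0 < f y)%R%:R * g y).
  apply: measurable_funM; first exact: measurable_funM.
  exact: measurable_graph_poly.
have cvh y : h y * (step_iter k (f y) * g y) @[k --> \oo] --> h y * (0 < f y)%R%:R * g y.
  rewrite -mulrA; apply: cvgM; first exact: cvg_cst.
  by apply: cvgM; [exact: step_iter_cvg|exact: cvg_cst].
have bnd k y : `|h y * (step_iter k (f y) * g y)| <= `|g y|.
  rewrite !normrM mulrA ler_piMl //.
  by apply: mulr_ile1 => //; rewrite -normrM; exact: (step_iter_norm k (f1 y)).
have [l [hl rl]] := has_integral_cvg (fun k => (hr k).1) mhg cvh bnd gv.
have [l' [hl' rl']] := has_integral_cvg (fun k => (hr k).2) mhg cvh bnd gv'.
exists l; split => //.
by rewrite (cvg_unique _ rl rl').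
Qed.

Let sets (E : set (borel V)) := measurable E /\
  forall h, indistinct h -> indistinct (fun y => h y * \1_E y).

Let sets_ext h h' : h =1 h' -> indistinct h -> indistinct h'.
Proof. by move=> /funext ->. Qed.

Let setsI : setI_closed sets.
Proof.
move=> E F [mE hE] [mF hF]; split; first exact: measurableI.
move=> h hh; apply: sets_ext (hF _ (hE _ hh)) => y.
by rewrite indicI /= mulrA.
Qed.

Let setsT : sets setT.
Proof.
split => // h hh; apply: sets_ext hh => y.
by rewrite indicT mulr1.
Qed.

Let sets_pos f : graph_poly f -> (forall y, `|f y| <= 1) -> sets [set y | 0 < f y].
Proof.
move=> hf f1; split.
  rewrite (_ : [set y | _] = setT `&` f @^-1` `]0, +oo[%classic).
    exact: (measurable_graph_poly hf mT (measurable_itv _)).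
  by rewrite setTI; apply/seteqP; split => y /=; rewrite in_itv /= andbT.
move=> h hh; apply: sets_ext (indistinct_step hh hf f1) => y.
by rewrite indicE mem_setE.
Qed.

Let coord_theta_le1 (y : V) j : nncoord y j * th y <= 1.
Proof.
have t0 := theta_gt0 I a y; rewrite -(thetaM I a y) mulrC ler_wpM2l ?(ltW t0) //.
rewrite (bigD1 j) //=.
have h1 : 0 <= \sum_(i < n | i != j) nncoord y i ^+ 2.
  by apply: sumr_ge0 => i _; rewrite sqr_ge0.
have h2 : 0 <= \sum_(i < m) fracpoly (I i) (a i) y ^+ 2.
  by apply: sumr_ge0 => i _; rewrite sqr_ge0.
have := sqr_ge0 (nncoord y j - 1); rewrite sqrrB1 => h3.
have := sqr_ge0 (nncoord y j).
by lra.
Qed.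

(** Multiplication by [theta] keeps the sign of [c * t_j + e] and makes it
    bounded. *)
Let sets_affine (c e : R) j : sets [set y : borel V | 0 < c * nncoord y j + e].
Proof.
pose N := `|c| + `|e| + 1.
have N0 : 0 < N by rewrite ltr_wpDl // addr_ge0.
pose f (y : borel V) := N^-1 * (c * nncoord y j + e) * th y.
have hf : graph_poly f.
  apply: graph_poly_ext (graph_polyD
    (graph_polyM (graph_poly_cst (N^-1 * c)) (graph_poly_mono (nnbasis rat j) 1))
    (graph_polyM (graph_poly_cst (N^-1 * e)) (graph_poly_mono 0 1))) => y.
  by rewrite nnpow_basis nnpow0 /f; ring.
have f1 y : `|f y| <= 1.
  have t0 := theta_gt0 I a y; have t1 := theta_le1 I a y.
  have y0 := nncoord_ge0 y j.
  rewrite /f -mulrA normrM ger0_norm ?invr_ge0 ?(ltW N0) //.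
  rewrite mulrC ler_pdivrMr // mul1r mulrDl.
  apply: le_trans (ler_normD _ _) _; rewrite -mulrA !normrM.
  rewrite (ger0_norm y0) (ger0_norm (ltW t0)).
  apply: (@le_trans _ _ (`|c| + `|e|)); last by rewrite /N lerDl.
  by apply: lerD; rewrite ler_piMr // coord_theta_le1.
rewrite (_ : [set _ | _] = [set y | 0 < f y]); first exact: sets_pos.
apply/seteqP; split => y /=; rewrite /f pmulr_lgt0 ?theta_gt0 // pmulr_rgt0 //;
  by rewrite invr_gt0.
Qed.

Let sets_box cr : sets (rat_box cr).
Proof.
rewrite (_ : rat_box cr = \big[setI/setT]_(i < n)
    [set y : borel V | `|nncoord y i - ratr (cr.1 i)| < ratr cr.2]).
  apply: (big_ind sets) => [//|E F|i _]; first exact: setsI.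
  rewrite (_ : [set _ | _] = [set y : borel V | 0 < 1 * nncoord y i + (ratr cr.2 - ratr (cr.1 i))] `&`
     [set y : borel V | 0 < (-1) * nncoord y i + (ratr cr.2 + ratr (cr.1 i))]).
    by apply: setsI; exact: sets_affine.
  by apply/seteqP; split => y /=; rewrite ltr_norml; [move=> /andP[? ?]; split; lra|
    move=> [? ?]; apply/andP; split; lra].
rewrite -bigcap_seq; apply/seteqP; split => y /=; first by move=> h i _; exact: h.
by move=> h i; apply: h; rewrite /= mem_index_enum.
Qed.

(** The half-spaces cut out by a single coordinate intersect in boxes, which
    generate the Borel sets. *)
Lemma theta_moments_determine (A : set (borel V)) : measurable A -> nu A = mu A.
Proof.
have gen : @measurable _ (borel V) = <<s sets >>.
  apply/seteqP; split.
    apply: smallest_sub; first exact: smallest_sigma_algebra.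
    move=> U oU; rewrite (open_rat_boxE oU) bigcup_mkcond.
    apply: (@countable_bigcupT_measurable _ (g_sigma_algebraType sets)) => // cr.
    by case: ifP => _; [apply: sub_sigma_algebra; exact: sets_box|exact: measurable0].
  apply: smallest_sub; first exact: sigma_algebra_measurable.
  by move=> E [].
have one : indistinct (fun=> 1).
  split => [|y|g hg]; [exact: measurable_cst|by rewrite normr1|].
  by under eq_fun do rewrite mul1r; exact: graph_poly_same.
have [r [mu1 nu1]] := graph_poly_same graph_poly1.
move=> mA; apply/esym.
apply: (measure_unique sets (fun=> setT) gen setsI (fun=> setsT) _ mu nu _ _ A mA) => //.
- by rewrite bigcup_const.
- move=> E [mE hE]; have [_ _ /(_ _ graph_poly1)[e [emu enu]]] := hE _ one.
  have indicE (la : {measure set (borel V) -> \bar R}) :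
      has_integral la setT (fun y => 1 * \1_E y * 1) e -> la E = e%:E.
    move=> [_ <-]; under eq_integral do rewrite mulr1 mul1r.
    by rewrite integral_indic // setIT.
  by rewrite (indicE mu) // (indicE nu).
- move=> _ /=; have [_] := mu1; rewrite integral_cst // mul1e => ->.
  exact: ltry.
Qed.

End Determinacy.

(** * Extensions and their measures *)

(** The moments without [theta] are those of [gamma]. An open set [p_i < 0] is
    null and so misses the support. That [delta] is recovered from the measure
    is what relates the two uniqueness statements. *)
Lemma extension_supported_measure (R : realType) (n m : nat)
    (I : 'I_m -> {fset nnvec rat n}) (a : 'I_m -> nnvec rat n -> R)
    (gamma : nnvec R n -> R) (delta : nnvec rat n -> nat -> R[i]) :
  continuous gamma -> admissible_extension I a gamma delta ->
  exists mu : {measure set (borel (nnvec R n)) -> \bar R},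
    supported_representing_measure I a gamma mu /\
    delta = fun v i => (theta_moment I a mu v i)%:C.
Proof.
move=> gamma_cont adm; have [mu [muE mu0]] := extension_measure adm.
exists mu; split; [split|].
- apply: rational_moments_representing => // v.
  have [r rE hr] := muE v 0%N; have [_ gammaE _ _] := adm.
  have <- : r = gamma (nnratr R v) by apply: complexI; rewrite -rE gammaE.
  apply: eq_has_integral hr => // y _.
  by rewrite expr0 mulr1.
- move=> y ysupp i _ /=; rewrite leNgt; apply/negP => hlt.
  have := ysupp _ (@open_fracpoly_lt0 R n (I i) (a i)) hlt.
  by rewrite mu0 ltxx.
- apply/funext => v; apply/funext => i; have [r -> hr] := muE v i.
  by rewrite /theta_moment (has_integral_fine hr).
Qed.

Theorem theorem2p6 (R : realType) (n m : nat) (n_gt0 : (0 < n)%N)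
    (m_gt0 : (0 < m)%N)
    (gamma : nnvec R n -> R)
    (gamma_ge0 : forall alpha, 0 <= gamma alpha)
    (gamma_cont : continuous gamma)
    (I : 'I_m -> {fset nnvec rat n}) (a : 'I_m -> nnvec rat n -> R) :
  ((exists mu : {measure set (borel (nnvec R n)) -> \bar R},
       supported_representing_measure I a gamma mu)
   <-> (exists delta : nnvec rat n -> nat -> R[i],
       admissible_extension I a gamma delta))
  /\
  ((exists mu : {measure set (borel (nnvec R n)) -> \bar R},
       supported_representing_measure I a gamma mu /\
       forall nu : {measure set (borel (nnvec R n)) -> \bar R},
         supported_representing_measure I a gamma nu ->
         forall A : set (borel (nnvec R n)), measurable A -> nu A = mu A)
   <-> (exists! delta : nnvec rat n -> nat -> R[i],
       admissible_extension I a gamma delta)).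
Proof.
split; split.
- by move=> [mu mu_rep]; eexists; exact: measure_admissible mu_rep.
- move=> [delta adm].
  by have [mu [mu_rep _]] := extension_supported_measure gamma_cont adm; exists mu.
- move=> [mu [mu_rep mu_uniq]]; eexists; split; first exact: measure_admissible mu_rep.
  move=> delta adm.
  have [nu [nu_rep ->]] := extension_supported_measure gamma_cont adm.
  apply/funext => v; apply/funext => i; congr (fine _)%:C.
  by apply: eq_measure_integral => A mA _; rewrite (mu_uniq nu).
- move=> [delta [adm delta_uniq]].
  have [mu [mu_rep deltaE]] := extension_supported_measure gamma_cont adm.
  exists mu; split => // nu nu_rep A mA.
  apply: (theta_moments_determine (I := I) (a := a)) => // v i.
  exists (theta_moment I a mu v i); split; first exact: theta_momentP mu_rep v i.
  have nuE : theta_moment I a mu v i = theta_moment I a nu v i.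
    have := delta_uniq _ (measure_admissible nu_rep); rewrite deltaE.
    by move=> /(congr1 (fun d => d v i)) /complexI.
  by rewrite nuE; exact: theta_momentP nu_rep v i.
Qed.
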